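(* Let $N\ge1$, $\alpha\in(0,1]$, and let $(r_n)_{n\ge0}$ satisfy $0\le r_n<1$ and $\lim_{n\to\infty}n^\gamma r_n=c>0$ for some $\gamma\in(\tfrac12,1]$. Let $Z_n(i)\in[0,1]$ ($i=1,\dots,N$, $n\ge0$) evolve by $Z_{n+1}(i)=(1-r_n)Z_n(i)+r_n I_{n+1}(i)$, where, with $\mathcal F_n=\sigma(Z_k(i):\,1\le i\le N,\ 0\le k\le n)$ and $Z_n=\frac1N\sum_{i=1}^N Z_n(i)$, the $I_{n+1}(1),\dots,I_{n+1}(N)\in\{0,1\}$ are conditionally independent given $\mathcal F_n$ with $P(I_{n+1}(i)=1\mid\mathcal F_n)=(1-\alpha)Z_n(i)+\alpha Z_n$. Assume the law of $(Z_0(1),\dots,Z_0(N))$ is permutation invariant, $E[Z_0(i)]=\tfrac12$ and $E[Z_0(1-Z_0)]>0$. Let $Z$ be the almost sure limit of $Z_n$. Then $P(Z\in\{0,1\})<1$ and $P(Z=z)=0$ for all $z\in(0,1)$. Moreover \[\Big(t^{2\gamma-1}n^{\gamma-\frac12}(Z_{\lfloor nt\rfloor}-Z)\Big)_{t\ge0}\xrightarrow{d}(W_{V_t})_{t\ge0},\qquad V_t=\frac{c^2}{N(2\gamma-1)}Z(1-Z)t^{2\gamma-1},\] where $W=(W_t)_{t\ge0}$ is a Wiener process independent of $V=(V_t)_{t\ge0}$, and convergence in distribution is with respect to the Skorohod topology on $D[0,+\infty)$.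
   Context: This is the interacting model with $\rho=1$ (pure reinforcement, no drift towards a fixed $q$). The almost sure limit $Z$ of $Z_n$ exists since $(Z_n)$ is then a bounded martingale. *)

(* Defs.v *)
From HB Require Import structures.
From mathcomp Require Import all_boot all_order all_algebra all_fingroup.
From mathcomp Require Import all_classical all_reals all_analysis.
Set Implicit Arguments. Unset Strict Implicit. Unset Printing Implicit Defensive.
Import Order.TTheory GRing.Theory Num.Theory Num.Def.
Import numFieldNormedType.Exports.
Local Open Scope classical_set_scope.
Local Open Scope ring_scope.

Section Defs.
Context {R : realType}.

(** Elements of D[0,+oo): we represent a path as a function R -> R which is
    identically 0 on (-oo,0) (normalisation), right-continuous at every t >= 0
    and has a left limit at every t > 0. *)
Definition cadlag (x : R -> R) : Prop :=
  (forall t, t < 0 -> x t = 0) /\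
  (forall t, 0 <= t -> x s @[s --> t^'+] --> x t) /\
  (forall t, 0 < t -> exists l : R, x s @[s --> t^'-] --> l).

Definition time_change (l : R -> R) : Prop :=
  {within `[0, +oo[%classic, continuous l} /\
  (forall s t, 0 <= s -> s < t -> l s < l t) /\
  (forall t, 0 <= t -> 0 <= l t) /\
  (forall u, 0 <= u -> exists2 t, 0 <= t & l t = u).

(** Convergence in the Skorohod (J1) topology of D[0,+oo)
    (Ethier--Kurtz, Prop. 3.5.3): there are time changes lam_k with
    lam_k -> id and x_k o lam_k -> y, both uniformly on compacts of [0,+oo). *)
Definition skorohod_cvg (xs : nat -> R -> R) (y : R -> R) : Prop :=
  exists lam : nat -> R -> R, (forall k, time_change (lam k)) /\
    forall T : R, 0 < T -> forall e : R, 0 < e ->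
      \forall k \near \oo, forall t, 0 <= t <= T ->
        `|lam k t - t| <= e /\ `|xs k (lam k t) - y t| <= e.

(** Bounded real functionals on path space that are continuous on D[0,+oo)
    for the Skorohod topology (D is metrisable, so sequential continuity). *)
Definition skorohod_bcont (f : (R -> R) -> R) : Prop :=
  (exists M : R, forall x, `|f x| <= M) /\
  (forall xs y, (forall k, cadlag (xs k)) -> cadlag y -> skorohod_cvg xs y ->
     f (xs k) @[k --> \oo] --> f y).

Definition cvg_dist_skorohod {d d'} {Om : measurableType d}
  {Om' : measurableType d'} (P : probability Om R) (X : nat -> Om -> R -> R)
  (P' : probability Om' R) (Y : Om' -> R -> R) : Prop :=
  forall f, skorohod_bcont f ->
    (\int[P]_w (f (X n w))%:E)%E @[n --> \oo] --> (\int[P']_w (f (Y w))%:E)%E.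

Definition zmean {Om : Type} (N : nat) (Z : nat -> 'I_N -> Om -> R)
  (n : nat) (w : Om) : R := (\sum_(i < N) Z n i w) / N%:R.

Definition filtr {d} {Om : measurableType d} (N : nat)
  (Z : nat -> 'I_N -> Om -> R) (n : nat) : set (set Om) :=
  <<s [set A | exists k (i : 'I_N) (B : set R),
        (k <= n)%N /\ measurable B /\ A = Z k i @^-1` B] >>.

Definition rescaled {Om : Type} (N : nat) (Z : nat -> 'I_N -> Om -> R)
  (Zlim : Om -> R) (g : R) (n : nat) (w : Om) (t : R) : R :=
  if t < 0 then 0 else
  powR t (2 * g - 1) * powR n%:R (g - 2^-1)
    * (zmean Z (truncn (n%:R * t)) w - Zlim w).

Definition time_changed_bm {Om : Type} (N : nat) (c g : R) (W : R -> Om -> R)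
  (Zl : Om -> R) (w : Om) (t : R) : R :=
  if t < 0 then 0 else
  W (c ^+ 2 / (N%:R * (2 * g - 1)) * (Zl w * (1 - Zl w)) * powR t (2 * g - 1)) w.

End Defs.

(* Main.v *)
Require Import Defs.
From HB Require Import structures.
From mathcomp Require Import all_boot all_order all_algebra all_fingroup.
From mathcomp Require Import all_classical all_reals all_analysis.
From mathcomp Require Import measurable_realfun ring lra zify.
Set Implicit Arguments. Unset Strict Implicit. Unset Printing Implicit Defensive.
Import Order.TTheory GRing.Theory Num.Theory Num.Def.
Import numFieldNormedType.Exports.
Local Open Scope classical_set_scope.
Local Open Scope ring_scope.

(** The mean [Z_n] is a bounded martingale with steps at most [r_n] and conditional
    variance [r_n^2 v_n], where [v_n] is close to [Z_n (1 - Z_n) / N] because the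
    gaps [Z_n(i) - Z_n] contract at rate [alpha r_n] (synchronization).

    The expectation of [Z_n (1 - Z_n)] decreases at most by the factors [1 - r_n^2],
    whose product is positive, so [Z] is not concentrated on {0, 1}. A Lindeberg
    argument with characteristic functions, uniform over the past, shows that
    the tail [Z_m - Z] is conditionally close to a centred Gaussian of variance
    [Z (1 - Z) / N] times the tail sum of the [r_k^2]; letting the frequency grow with
    [m], the Fourier transform of [Z (1 - Z) dP] vanishes at infinity, and by Wiener's
    averaging [Z] has no atom in ]0, 1[. The same Lindeberg bound gives the
    convergence of the finite-dimensional marginals to those of [W_(V_t)].

    For the functional statement, a fourth-moment maximal inequality (combined with
    summation by parts near [t = 0]) bounds the distance between the rescaled path and
    its discretization on a grid, uniformly on compact sets. A bounded Skorohod
    continuous functional is the increasing limit of functionals which are Lipschitz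
    for the uniform distance on a compact interval; on these the marginals and the
    grid estimate suffice, and applying the resulting lower bound to [f] and [- f]
    concludes. *)

(** * Bounded measurable functions and their expectations *)

(** No conditional expectation is ever formed: a conditional statement is an identity of
    expectations tested against every bounded [G] measurable for the past, and uniformity over the
    past is uniformity over [|G| <= CG]. The limit [Z] is not known at any finite time, so a
    Gaussian factor built from it could not be part of such a [G]; the variance is frozen at
    [Z_m (1 - Z_m) / N] instead. With [p = 2 gamma - 1], the tails at times [n s] and [n t] have
    covariance proportional to [max(s, t) ^ (- p)]; the weight [t ^ p] turns it into
    [min(s, t) ^ p], that of a Brownian motion run at the clock [t ^ p]. This is time inversion.
    Characteristic functions stay real: an arbitrary phase [phi] in [cos (phi + ...)] carries both
    parts. The passage to Lipschitz functions is explicit, through binomial averages of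
    trigonometric polynomials. Test functionals come with no measurability: of the Skorohod topology
    only continuity along locally uniform convergence is used, and it also yields measurability, by
    rounding the process to countably many values. *)

Definition bmf {R : realType} {d} {T : measurableType d} (X : T -> R) : Prop :=
  measurable_fun setT X /\ exists M : R, forall w, `|X w| <= M.

Definition Ex {R : realType} {d} {T : measurableType d} (P : probability T R)
  (X : T -> R) : R := \int[P]_w X w.

Section bounded_measurable.
Context {R : realType} {d} {T : measurableType d}.
Implicit Types X Y : T -> R.

Lemma bmf_cst (c : R) : bmf (fun _ : T => c).
Proof. by split; [exact: measurable_cst|exists `|c|]. Qed.

Lemma bmfD X Y : bmf X -> bmf Y -> bmf (fun w => X w + Y w).
Proof.
move=> [mX [M hM]] [mY [M' hM']]; split; first exact: measurable_funD.
by exists (M + M') => w; apply: le_trans (ler_normD _ _) _; exact: lerD.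
Qed.

Lemma bmfN X : bmf X -> bmf (fun w => - X w).
Proof.
move=> [mX [M hM]]; split; first exact: measurableT_comp.
by exists M => w; rewrite normrN.
Qed.

Lemma bmfB X Y : bmf X -> bmf Y -> bmf (fun w => X w - Y w).
Proof. by move=> hX hY; apply: bmfD => //; exact: bmfN. Qed.

Lemma bmfM X Y : bmf X -> bmf Y -> bmf (fun w => X w * Y w).
Proof.
move=> [mX [M hM]] [mY [M' hM']]; split; first exact: measurable_funM.
by exists (M * M') => w; rewrite normrM; exact: ler_pM.
Qed.

Lemma bmfZ (c : R) X : bmf X -> bmf (fun w => c * X w).
Proof. by move=> hX; apply: bmfM => //; exact: bmf_cst. Qed.

Lemma bmfZr (c : R) X : bmf X -> bmf (fun w => X w * c).
Proof. by move=> hX; apply: bmfM => //; exact: bmf_cst. Qed.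

Lemma bmf_sum (J : Type) (s : seq J) (Q : pred J) (F : J -> T -> R) :
  (forall i, Q i -> bmf (F i)) -> bmf (fun w => \sum_(i <- s | Q i) F i w).
Proof.
move=> h; elim: s => [|i s ih].
  by under eq_fun do rewrite big_nil; exact: bmf_cst.
under eq_fun do rewrite big_cons.
case: (boolP (Q i)) => [Qi|_]; last exact: ih.
apply: bmfD => //; exact: h.
Qed.

Lemma bmf_prod (J : Type) (s : seq J) (Q : pred J) (F : J -> T -> R) :
  (forall i, Q i -> bmf (F i)) -> bmf (fun w => \prod_(i <- s | Q i) F i w).
Proof.
move=> h; elim: s => [|i s ih].
  by under eq_fun do rewrite big_nil; exact: bmf_cst.
under eq_fun do rewrite big_cons.
case: (boolP (Q i)) => [Qi|_]; last exact: ih.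
apply: bmfM => //; exact: h.
Qed.

Lemma bmfX n X : bmf X -> bmf (fun w => X w ^+ n).
Proof.
move=> hX; elim: n => [|n ih]; first exact: bmf_cst.
by under eq_fun do rewrite exprS; exact: bmfM.
Qed.

Lemma bmf_norm X : bmf X -> bmf (fun w => `|X w|).
Proof.
move=> [mX [M hM]]; split; first exact: measurableT_comp.
by exists M => w; rewrite normr_id.
Qed.

Lemma bmf_indic (A : set T) : measurable A -> bmf (\1_A : T -> R).
Proof.
move=> mA; split; first exact: measurable_indic.
by exists 1 => w; rewrite indicE; case: (_ \in _); rewrite ?normr1 ?normr0.
Qed.

Lemma bmf_comp (g : R -> R) (M : R) X : continuous g -> (forall x, `|g x| <= M) ->
  measurable_fun setT X -> bmf (fun w => g (X w)).
Proof.
move=> cg hg mX; split; last by exists M => w.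
by apply: measurableT_comp => //; exact: continuous_measurable_fun.
Qed.

Lemma bmf_cos X : measurable_fun setT X -> bmf (fun w => cos (X w)).
Proof.
apply: (@bmf_comp cos 1); first exact: continuous_cos.
by move=> x; rewrite ler_norml cos_geN1 cos_le1.
Qed.

Lemma bmf_sin X : measurable_fun setT X -> bmf (fun w => sin (X w)).
Proof.
apply: (@bmf_comp sin 1); first exact: continuous_sin.
by move=> x; rewrite ler_norml sin_geN1 sin_le1.
Qed.

Lemma bmf_bounded X (a b : R) : measurable_fun setT X ->
  (forall w, a <= X w <= b) -> bmf X.
Proof.
move=> mX h; split => //; exists (`|a| + `|b|) => w.
have /andP[h1 h2] := h w.
rewrite ler_norml; apply/andP; split.
  by rewrite (le_trans _ h1)// opprD; have := ler_norm (- a); rewrite normrN; have := normr_ge0 b; lra.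
by rewrite (le_trans h2)//; have := ler_norm b; have := normr_ge0 a; lra.
Qed.

End bounded_measurable.

Section expectation.
Context {R : realType} {d} {T : measurableType d} (P : probability T R).
Implicit Types X Y : T -> R.

Lemma bmf_integrable X : bmf X -> P.-integrable setT (EFin \o X).
Proof.
move=> [mX [M hM]]; apply: measurable_bounded_integrable => //.
  by rewrite (le_lt_trans (@probability_le1 _ _ _ P _ _))// ltry.
exists M; split; first exact: num_real.
by move=> x Mx t _ /=; rewrite (le_trans (hM t))// ltW.
Qed.

Lemma Ex_EFin X : bmf X -> (\int[P]_w (X w)%:E)%E = (Ex P X)%:E.
Proof. by move=> /bmf_integrable h; rewrite /Ex /Rintegral fineK//; exact: integrable_fin_num. Qed.

Lemma ExD X Y : bmf X -> bmf Y -> Ex P (fun w => X w + Y w) = Ex P X + Ex P Y.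
Proof. by move=> hX hY; rewrite /Ex RintegralD//; exact: bmf_integrable. Qed.

Lemma ExB X Y : bmf X -> bmf Y -> Ex P (fun w => X w - Y w) = Ex P X - Ex P Y.
Proof. by move=> hX hY; rewrite /Ex RintegralB//; exact: bmf_integrable. Qed.

Lemma ExZ (c : R) X : bmf X -> Ex P (fun w => c * X w) = c * Ex P X.
Proof. by move=> hX; rewrite /Ex RintegralZl//; exact: bmf_integrable. Qed.

Lemma Ex_cst (c : R) : Ex P (fun _ => c) = c.
Proof.
rewrite /Ex Rintegral_cst//; set x := fine _.
have -> : x = 1 by rewrite /x [X in fine X](@probability_setT _ _ _ P).
by rewrite mulr1.
Qed.

Lemma ExN X : bmf X -> Ex P (fun w => - X w) = - Ex P X.
Proof.
move=> hX; rewrite -mulN1r -ExZ//; congr (Ex P _).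
by apply/funext => w; rewrite mulN1r.
Qed.

Lemma Ex_sum (J : Type) (s : seq J) (Q : pred J) (F : J -> T -> R) :
  (forall i, Q i -> bmf (F i)) ->
  Ex P (fun w => \sum_(i <- s | Q i) F i w) = \sum_(i <- s | Q i) Ex P (F i).
Proof.
move=> h; elim: s => [|i s ih].
  by rewrite big_nil; under eq_fun do rewrite big_nil; exact: Ex_cst.
rewrite big_cons; under eq_fun do rewrite big_cons.
case: (boolP (Q i)) => [Qi|_]; last exact: ih.
by rewrite ExD ?ih//; [exact: h|exact: bmf_sum].
Qed.

Lemma Ex_ge0 X : (forall w, 0 <= X w) -> 0 <= Ex P X.
Proof. by move=> h; apply: Rintegral_ge0. Qed.

Lemma le_Ex X Y : bmf X -> bmf Y -> (forall w, X w <= Y w) -> Ex P X <= Ex P Y.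
Proof. by move=> hX hY h; apply: le_Rintegral => //; exact: bmf_integrable. Qed.

Lemma Ex_norm X : bmf X -> `|Ex P X| <= Ex P (fun w => `|X w|).
Proof. by move=> hX; apply: le_normr_Rintegral => //; exact: bmf_integrable. Qed.

Lemma Ex_norm_le X Y : bmf X -> bmf Y -> (forall w, `|X w| <= Y w) -> `|Ex P X| <= Ex P Y.
Proof.
move=> hX hY h; apply: le_trans (Ex_norm hX) _; apply: le_Ex => //.
exact: bmf_norm.
Qed.

Lemma Ex_norm_bound X (M : R) : bmf X -> (forall w, `|X w| <= M) -> `|Ex P X| <= M.
Proof.
move=> hX h; rewrite -[leRHS](Ex_cst M); apply: Ex_norm_le => //; exact: bmf_cst.
Qed.

Lemma Ex_le_cst X (M : R) : bmf X -> (forall w, X w <= M) -> Ex P X <= M.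
Proof.
by move=> hX h; rewrite -[leRHS](Ex_cst M); apply: le_Ex => //; exact: bmf_cst.
Qed.

Lemma Ex_dist X Y (e : R) : bmf X -> bmf Y -> (forall w, `|X w - Y w| <= e) ->
  `|Ex P X - Ex P Y| <= e.
Proof.
by move=> hX hY h; rewrite -ExB//; apply: Ex_norm_bound => //; exact: bmfB.
Qed.

Lemma Ex_indic (A : set T) : measurable A -> Ex P (\1_A) = fine (P A).
Proof.
by move=> mA; rewrite /Ex /Rintegral integral_indic// setIT.
Qed.

Lemma Ex_eq_ae X Y : bmf X -> bmf Y -> {ae P, forall w, X w = Y w} -> Ex P X = Ex P Y.
Proof.
move=> [mX _] [mY _] h; rewrite /Ex /Rintegral; congr fine.
apply: ae_eq_integral => //; try exact/measurable_EFinP.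
by apply: filterS h => w /= + _ => ->.
Qed.

Lemma Ex_cvg (X_ : nat -> T -> R) X (M : R) : (forall n, measurable_fun setT (X_ n)) ->
  measurable_fun setT X -> (forall n w, `|X_ n w| <= M) ->
  {ae P, forall w, X_ n w @[n --> \oo] --> X w} ->
  Ex P (X_ n) @[n --> \oo] --> Ex P X.
Proof.
move=> mX_ mX hM hcvg.
have h1 : {ae P, forall x, setT x -> (EFin \o X_ n) x @[n --> \oo] --> (EFin \o X) x}.
  by apply: filterS hcvg => w /= hw _; apply: cvg_EFin => //; exact: nearW.
have h2 : P.-integrable setT (fun _ : T => M%:E).
  by have /bmf_integrable := bmf_cst (T:=T) M.
have h3 : {ae P, forall x n, setT x -> (`|(EFin \o X_ n) x| <= M%:E)%E}.
  by apply: aeW => /= w n _; rewrite lee_fin.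
have [h4 _ h5] := @dominated_convergence _ _ _ P setT measurableT
  (fun n => EFin \o X_ n) (EFin \o X) (fun=> M%:E)
  (fun n => (measurable_EFinP _ _).2 (mX_ n)) ((measurable_EFinP _ _).2 mX) h1 h2 h3.
by apply: fine_cvg; rewrite fineK//; exact: integrable_fin_num.
Qed.

Lemma Ex_markov X (l : R) (A : set T) : bmf X -> measurable A -> 0 < l ->
  (forall w, 0 <= X w) -> (forall w, A w -> l <= X w) -> fine (P A) <= Ex P X / l.
Proof.
move=> hX mA l0 X0 hA; rewrite ler_pdivlMr// mulrC -Ex_indic// -ExZ; last exact: bmf_indic.
apply: le_Ex => //; first exact/bmfZ/bmf_indic.
move=> w; rewrite indicE; case: (boolP (w \in A)) => wA; last by rewrite mulr0.
by rewrite mulr1; apply: hA; exact: set_mem.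
Qed.

(** Pointwise [|X| <= e + X ^ 2 / e]. With [e] of the order of the root mean square this is
    Cauchy-Schwarz up to a factor 2, without square roots; it turns the second-moment bounds below
    into first-moment bounds. *)
Lemma Ex_cauchy_schwarz1 X (e : R) : bmf X -> 0 < e ->
  Ex P (fun w => `|X w|) <= e + Ex P (fun w => X w ^+ 2) / e.
Proof.
move=> hX e0.
have -> : e + Ex P (fun w => X w ^+ 2) / e = Ex P (fun w => e + e^-1 * X w ^+ 2).
  by rewrite ExD ?Ex_cst ?ExZ ?[e^-1 * _]mulrC//; [exact: bmfX|exact: bmf_cst|exact/bmfZ/bmfX].
apply: le_Ex; [exact: bmf_norm|apply: bmfD; [exact: bmf_cst|exact/bmfZ/bmfX]|].
move=> w; have [h|h] := leP `|X w| e.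
  by rewrite (le_trans h)// lerDl mulr_ge0 ?sqr_ge0// invr_ge0 ltW.
rewrite -[X w ^+ 2](real_normK (num_real _)).
apply: le_trans (_ : e^-1 * `|X w| ^+ 2 <= _); last by rewrite lerDr ltW.
by rewrite expr2 mulrA ler_peMl// mulrC ler_pdivlMr// mul1r ltW.
Qed.

End expectation.

(** * Quantization and measurability of functionals of sequences *)

Section quantization.
Context {R : realType}.

Definition quant (n : nat) (x : R) : R := (floor (n.+1%:R * x))%:~R / n.+1%:R.

Lemma near_natSinv_le (e : R) : 0 < e -> \forall n \near \oo, n.+1%:R^-1 <= e.
Proof.
by move=> e0; apply: filterS (near_infty_natSinv_lt (PosNum e0)) => n /ltW.
Qed.

Lemma quant_dist n x : `|quant n x - x| <= n.+1%:R^-1.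
Proof.
have n0 : (0 : R) < n.+1%:R by rewrite ltr0n.
have /andP[h1 h2] := floor_itv (n.+1%:R * x).
rewrite intrD in h2.
have -> : quant n x - x = ((floor (n.+1%:R * x))%:~R - n.+1%:R * x) / n.+1%:R.
  by rewrite /quant mulrBl mulrAC mulfV ?mul1r// gt_eqF.
rewrite normrM normfV (gtr0_norm n0) ler_piMl ?invr_ge0 ?(ltW n0)//.
by rewrite ler_norml; lra.
Qed.

Lemma measurable_floor_eq (z : int) : measurable [set x : R | floor x = z].
Proof.
rewrite (_ : [set x | _] = `[z%:~R, (z + 1)%:~R[%classic) //.
apply/seteqP; split => x /=; rewrite in_itv /=.
  by move=> <-; exact: floor_itv.
by move=> h; exact: floor_def.
Qed.

(** The index [j] stands for the floor value [j - K (n + 1) - 1], and the [2 K (n + 1) + 2] indices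
    cover every floor of a number of absolute value at most [K (n + 1)]. A rounded bounded function
    is thus a finite combination of indicators. *)
Lemma quant_sum (n K : nat) (x : R) : `|x| <= K%:R ->
  quant n x = \sum_(j < (2 * (K * n.+1)).+2)
    ((j%:~R - (K * n.+1)%:R - 1) / n.+1%:R) *
    \1_[set y : R | floor (n.+1%:R * y) = j%:Z - (K * n.+1)%:Z - 1] x.
Proof.
move=> hx.
have n0 : (0 : R) < n.+1%:R by rewrite ltr0n.
have /andP[h1 h2] := floor_itv (n.+1%:R * x).
rewrite intrD in h2.
set z := floor _ in h1 h2 *.
have /andP[hx1 hx2] : - K%:R <= x <= K%:R by rewrite -ler_norml.
have hz1 : - (K * n.+1)%:Z - 1 < z.
  rewrite -(ltr_int R) intrB intrN -!pmulrn natrM.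
  have : - (K%:R * n.+1%:R) <= n.+1%:R * x by rewrite mulrC -mulrN ler_pM2l.
  lra.
have hz2 : z <= (K * n.+1)%:Z.
  rewrite -(ler_int R) -pmulrn natrM (le_trans h1)// mulrC ler_pM2r//.
have hj : (absz (z + (K * n.+1)%:Z + 1)%R < (2 * (K * n.+1)).+2)%N by lia.
rewrite (bigD1 (Ordinal hj)) //= big1 ?addr0.
  rewrite indicE mem_set /=; last by rewrite -/z; lia.
  rewrite mulr1 /quant -/z; congr (_ / _).
  have -> : ((absz (z + (K * n.+1)%:Z + 1)%R)%:Z%:~R : R) = (z + (K * n.+1)%:Z + 1)%:~R.
    by congr (_%:~R); rewrite gez0_abs//; lia.
  by rewrite !intrD -!pmulrn; lra.
move=> j /eqP jne; rewrite indicE memNset ?mulr0//= -/z => hz; apply: jne.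
apply/val_inj => /=; lia.
Qed.

End quantization.

Section measurability.
Context {R : realType} {d} {T : measurableType d}.

(** [F] is arbitrary: a preimage under a countably valued map is a countable union of level sets. *)
Lemma measurable_fun_count (C : countType) (c : T -> C) (F : C -> R) :
  (forall t, measurable [set w | c w = t]) -> measurable_fun setT (F \o c).
Proof.
move=> mc _ B mB; rewrite setTI.
rewrite (_ : _ @^-1` B = \bigcup_(k in [set k | exists2 t : C, pickle t = k & B (F t)])
   [set w | pickle (c w) = k]).
  apply: bigcup_measurable => k [t <- _].
  rewrite (_ : [set w | _] = [set w | c w = t])//.
  by apply/seteqP; split => w /= => [/(pcan_inj pickleK)|->].
apply/seteqP; split => w /=.
  by move=> h; exists (pickle (c w)) => //; exists (c w).
by move=> [k [t <- Bt] /= /(pcan_inj pickleK) ->].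
Qed.

(** Rounding the first [n] coordinates and putting 0 for the others leaves countably many arguments,
    so [g] of them is measurable whatever [g] is; coordinatewise continuity then gives the limit. No
    sigma-algebra on sequences is involved. *)
Lemma measurable_seq_continuous (xi : nat -> T -> R) (g : (nat -> R) -> R) :
  (forall k, measurable_fun setT (xi k)) ->
  (forall (a_ : nat -> nat -> R) a, (forall k, a_ n k @[n --> \oo] --> a k) ->
     g (a_ n) @[n --> \oo] --> g a) ->
  measurable_fun setT (fun w => g (fun k => xi k w)).
Proof.
move=> mxi hg.
pose a_ n w k := if (k < n)%N then quant n (xi k w) else 0.
apply: (@measurable_fun_cvg _ _ _ _ (fun n w => g (a_ n w))); last first.
  move=> w _; apply: hg => k.
  apply/cvgrPdist_le => e e0; near=> n.
  rewrite /a_ /= ifT; last by near: n; exact: nbhs_infty_gt.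
  by rewrite distrC (le_trans (quant_dist _ _))//; near: n; exact: near_natSinv_le.
move=> n.
pose c w : seq int := mkseq (fun k => floor (n.+1%:R * xi k w)) n.
pose F (s : seq int) := g (fun k => if (k < n)%N then (nth 0 s k)%:~R / n.+1%:R else 0).
rewrite (_ : (fun w => _) = F \o c); last first.
  apply/funext => w; rewrite /F /= /a_; congr g; apply/funext => k.
  by case: ifPn => // kn; rewrite nth_mkseq.
apply: measurable_fun_count => t.
have [st|st] := eqVneq (size t) n; last first.
  rewrite (_ : [set w | _] = set0)//.
  by apply/seteqP; split => w //= h; move: st; rewrite -h size_mkseq eqxx.
rewrite (_ : [set w | _] =
  \bigcap_(k in `I_n) ((fun w => n.+1%:R * xi k w) @^-1` [set x | floor x = nth 0 t k])).
  apply: fin_bigcap_measurable => // k kn; rewrite -[X in measurable X]setTI.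
  have : measurable_fun setT (fun w => n.+1%:R * xi k w) by exact: measurable_funM.
  by apply => //; exact: measurable_floor_eq.
apply/seteqP; split => w /=.
  by move=> <- k /= kn; rewrite nth_mkseq.
move=> h; apply: (@eq_from_nth _ 0); first by rewrite size_mkseq st.
by rewrite size_mkseq => k kn; rewrite nth_mkseq//; exact: h.
Unshelve. all: by end_near. Qed.

End measurability.

(** * Extension of identities from past events to bounded past variables *)

Section extension.
Context {R : realType} {d} {T : measurableType d} (P : probability T R).

(** [S] stands for the past, but only has to contain the preimages of [G]. Rounding [G] gives finite
    combinations of indicators of such preimages, with a uniform error. *)
Lemma Ex_sub_ext (S : set (set T)) (X Y G : T -> R) : (forall A, S A -> measurable A) ->
  bmf X -> bmf Y -> (forall A, S A -> Ex P (fun w => \1_A w * X w) = Ex P (fun w => \1_A w * Y w)) ->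
  (forall B : set R, measurable B -> S (G @^-1` B)) -> (exists M : R, forall w, `|G w| <= M) ->
  Ex P (fun w => G w * X w) = Ex P (fun w => G w * Y w).
Proof.
move=> mS hX hY hXY hG [M0 hM0].
have [K hK] : exists K : nat, forall w, `|G w| <= K%:R.
  have [K hK] : exists K : nat, M0 <= K%:R.
    exists (truncn M0).+1; apply: ltW; exact: truncnS_gt.
  by exists K => w; exact: le_trans (hM0 w) hK.
have mG : bmf G.
  split; last by exists M0.
  by move=> _ B mB; rewrite setTI; apply: mS; exact: hG.
have hSm (n : nat) (z : int) : S (G @^-1` [set y : R | floor (n.+1%:R * y) = z]).
  apply: hG; rewrite -[X in measurable X]setTI.
  have : measurable_fun setT (fun y : R => n.+1%:R * y) by exact: measurable_funM.
  by move/(_ measurableT _ (measurable_floor_eq z)).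
pose s n z := G @^-1` [set y : R | floor (n.+1%:R * y) = z].
have key n U : bmf U -> Ex P (fun w => quant n (G w) * U w) =
    \sum_(j < (2 * (K * n.+1)).+2) ((j%:~R - (K * n.+1)%:R - 1) / n.+1%:R) *
       Ex P (fun w => \1_(s n (j%:Z - (K * n.+1)%:Z - 1)) w * U w).
  move=> hU.
  have b1 j : bmf (fun w => \1_(s n j) w * U w).
    by apply: bmfM => //; apply: bmf_indic; apply: mS; exact: hSm.
  transitivity (Ex P (fun w => \sum_(j < (2 * (K * n.+1)).+2) ((j%:~R - (K * n.+1)%:R - 1) / n.+1%:R) *
       (\1_(s n (j%:Z - (K * n.+1)%:Z - 1)) w * U w))).
    congr (Ex P _); apply/funext => w; rewrite (quant_sum n (hK w)) big_distrl/=.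
    by apply: eq_bigr => j _; rewrite [RHS]mulrA.
  rewrite Ex_sum; last by move=> j _; exact: bmfZ.
  by apply: eq_bigr => j _; rewrite ExZ.
have key2 n : Ex P (fun w => quant n (G w) * X w) = Ex P (fun w => quant n (G w) * Y w).
  by rewrite !key//; apply: eq_bigr => j _; rewrite hXY//; exact: hSm.
have mq n : bmf (fun w => quant n (G w)).
  split.
    rewrite (_ : (fun w => _) = (fun z : int => z%:~R / n.+1%:R) \o (fun w => floor (n.+1%:R * G w)))//.
    by apply: measurable_fun_count => z; apply: mS; exact: hSm.
  exists (K%:R + n.+1%:R^-1) => w.
  rewrite -[quant n (G w)](subrK (G w)) (le_trans (ler_normD _ _))// addrC lerD//.
  exact: quant_dist.
have lim U : bmf U -> Ex P (fun w => quant n (G w) * U w) @[n --> \oo] --> Ex P (fun w => G w * U w).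
  move=> hU; have [_ [MU hMU]] := hU.
  have MU0 : 0 < `|MU| + 1 by have := normr_ge0 MU; lra.
  apply/cvgrPdist_le => e e0; near=> n.
  apply: le_trans (_ : n.+1%:R^-1 * (`|MU| + 1) <= _).
    apply: Ex_dist; [exact: bmfM|exact: bmfM|].
    move=> w; rewrite -mulrBl normrM ler_pM//; first by rewrite distrC; exact: quant_dist.
    by have := hMU w; have := ler_norm MU; lra.
  rewrite -ler_pdivlMr//.
  by near: n; apply: near_natSinv_le; rewrite divr_gt0.
have := lim _ hX; under eq_fun do rewrite key2.
by move=> h; apply: (cvg_unique _ h (lim _ hY)).
Unshelve. all: by end_near. Qed.

End extension.

(** * Conditional moments in the interacting model *)

Section model.
Context {R : realType} {d : measure_display} {Om : measurableType d}.
Context (P : probability Om R) (N : nat) (alpha : R) (r : nat -> R).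
Context (Z : nat -> 'I_N -> Om -> R) (I : nat -> 'I_N -> Om -> R).
Hypothesis N_gt0 : (0 < N)%N.
Hypothesis alpha01 : 0 < alpha <= 1.
Hypothesis r01 : forall n, 0 <= r n < 1.
Hypothesis mZ : forall n i, measurable_fun setT (Z n i).
Hypothesis mI : forall n i, measurable_fun setT (I n i).
Hypothesis Z01 : forall n i w, 0 <= Z n i w <= 1.
Hypothesis I01 : forall n i w, I n i w = 0 \/ I n i w = 1.
Hypothesis Zrec : forall n i w, Z n.+1 i w = (1 - r n) * Z n i w + r n * I n.+1 i w.
Hypothesis Icond : forall n (A : set Om), filtr Z n A -> forall e : {ffun 'I_N -> bool},
     P (A `&` [set w | forall i, I n.+1 i w = (e i)%:R]) =
     (\int[P]_(w in A)
        (\prod_(i < N)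
           (if e i then (1 - alpha) * Z n i w + alpha * zmean Z n w
            else 1 - ((1 - alpha) * Z n i w + alpha * zmean Z n w)))%:E)%E.

Definition hist_gen (n : nat) : set (set Om) := [set A | exists k (i : 'I_N) (B : set R),
        (k <= n)%N /\ measurable B /\ A = Z k i @^-1` B].

(** The past is a measurable type of its own on the same points: [@bmf R _ (hist n) G] says that [G]
    is bounded and measurable for the history up to time [n], and all closure properties of [bmf]
    apply there. *)
Definition hist (n : nat) := g_sigma_algebraType (hist_gen n).

Lemma hist_measurable n (A : set Om) : filtr Z n A -> measurable A.
Proof.
apply: smallest_sub; first exact: sigma_algebra_measurable.
by move=> _ [k [i [B [_ [mB ->]]]]]; rewrite -[X in measurable X]setTI; exact: mZ.
Qed.

Lemma bmf_hist n (X : Om -> R) : @bmf R _ (hist n) X -> bmf X.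
Proof.
move=> [mX hX]; split => // _ B mB; rewrite setTI; apply: (@hist_measurable n).
by have := mX measurableT B mB; rewrite setTI.
Qed.

Lemma hist_mono n m (X : Om -> R) : (n <= m)%N -> @bmf R _ (hist n) X -> @bmf R _ (hist m) X.
Proof.
move=> nm [mX hX]; split => // _ B mB; rewrite setTI.
have : filtr Z n (X @^-1` B) by have := mX measurableT B mB; rewrite setTI.
apply: sub_smallest2r; first exact: smallest_sigma_algebra.
move=> _ [k [i [D [kn [mD ->]]]]]; exists k, i, D; split => //.
exact: leq_trans kn nm.
Qed.

Lemma bmf_Z n m i : (n <= m)%N -> @bmf R _ (hist m) (Z n i).
Proof.
move=> nm; split; last first.
  exists 1 => w; have /andP[h1 h2] := Z01 n i w; rewrite ler_norml h2 andbT; lra.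
move=> _ B mB; rewrite setTI; apply: sub_gen_smallest.
by exists n, i, B.
Qed.

Lemma bmf_zm n m : (n <= m)%N -> @bmf R _ (hist m) (zmean Z n).
Proof.
move=> nm; rewrite /zmean; under eq_fun do rewrite mulrC.
by apply: bmfZ; apply: bmf_sum => i _; exact: bmf_Z.
Qed.

Definition draw_prob n (i : 'I_N) w := (1 - alpha) * Z n i w + alpha * zmean Z n w.

Lemma bmf_pick n i : @bmf R _ (hist n) (draw_prob n i).
Proof. by apply: bmfD; apply: bmfZ; [exact: bmf_Z|exact: bmf_zm]. Qed.

Lemma bmf_I n i : bmf (I n i).
Proof.
split; first exact: mI.
by exists 1 => w; case: (I01 n i w) => ->; rewrite ?normr0 ?normr1.
Qed.

Let NR0 : (0 : R) < N%:R. Proof. by rewrite ltr0n. Qed.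

Lemma zm01 n w : 0 <= zmean Z n w <= 1.
Proof.
rewrite /zmean divr_ge0 ?ler0n ?sumr_ge0//=; last by move=> i _; have /andP[] := Z01 n i w.
rewrite ler_pdivrMr// mul1r -[leRHS](_ : \sum_(i < N) 1 = _); last first.
  by rewrite sumr_const card_ord.
by apply: ler_sum => i _; have /andP[] := Z01 n i w.
Qed.

Lemma pick01 n i w : 0 <= draw_prob n i w <= 1.
Proof.
have /andP[? ?] := Z01 n i w; have /andP[? ?] := zm01 n w; have /andP[? ?] := alpha01.
by rewrite /draw_prob; apply/andP; split; nra.
Qed.

Lemma sum_pick n w : \sum_(i < N) draw_prob n i w = N%:R * zmean Z n w.
Proof.
rewrite /draw_prob big_split/= -mulr_sumr sumr_const card_ord -mulr_natl.
have -> : \sum_(i < N) Z n i w = N%:R * zmean Z n w.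
  by rewrite /zmean mulrC divfK// gt_eqF.
by ring.
Qed.

Lemma Ex_cond_config n (e : {ffun 'I_N -> bool}) (G : Om -> R) : @bmf R _ (hist n) G ->
  Ex P (fun w => G w * \1_[set w | forall i, I n.+1 i w = (e i)%:R] w) =
  Ex P (fun w => G w * \prod_(i < N) (if e i then draw_prob n i w else 1 - draw_prob n i w)).
Proof.
move=> [mG bG].
have mE : measurable [set w | forall i, I n.+1 i w = (e i)%:R].
  rewrite (_ : [set w | _] = \bigcap_(i in [set: 'I_N]) (I n.+1 i @^-1` [set (e i)%:R])).
    apply: fin_bigcap_measurable => // i _; rewrite -[X in measurable X]setTI.
    by apply: mI => //; exact: measurable_set1.
  by apply/seteqP; split => w /= h i //=; exact: h.
have bpr : bmf (fun w => \prod_(i < N) (if e i then draw_prob n i w else 1 - draw_prob n i w)).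
  apply: bmf_prod => i _; case: (e i); first exact/bmf_hist/bmf_pick.
  by apply: bmfB; [exact: bmf_cst|exact/bmf_hist/bmf_pick].
apply: (@Ex_sub_ext _ _ _ _ (filtr Z n)) => //.
- exact: hist_measurable.
- exact: bmf_indic.
- move=> A FA; have mA := hist_measurable FA.
  transitivity (fine (P (A `&` [set w | forall i, I n.+1 i w = (e i)%:R]))).
    rewrite -Ex_indic; last exact: measurableI.
    by congr (Ex P _); apply/funext => w; rewrite indicI.
  rewrite Icond// /Ex /Rintegral; congr fine; rewrite [LHS]integral_mkcond.
  apply: eq_integral => w _. rewrite /patch indicE; case: ifPn => wA.
    by rewrite mul1r.
  by rewrite mul0r.
- by move=> B mB; have := mG measurableT B mB; rewrite setTI.
Qed.

(** Expanding over the configurations of all [N] draws reduces to [Ex_cond_config]. When the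
    Bernoulli weights are summed back, a site outside [Q] contributes 1 and a site in [Q] its
    probability. One- and two-point predicates give conditional means and covariances. *)
Lemma Ex_cond_prod n (Q : pred 'I_N) (G : Om -> R) : @bmf R _ (hist n) G ->
  Ex P (fun w => G w * \prod_(i < N | Q i) I n.+1 i w) =
  Ex P (fun w => G w * \prod_(i < N | Q i) draw_prob n i w).
Proof.
move=> hG.
pose h (i : 'I_N) (b : bool) : R := if Q i then b%:R else 1.
pose A (e : {ffun 'I_N -> bool}) := [set w | forall i, I n.+1 i w = (e i)%:R].
have bA e : bmf (\1_(A e) : Om -> R).
  apply: bmf_indic.
  rewrite (_ : A e = \bigcap_(i in [set: 'I_N]) (I n.+1 i @^-1` [set (e i)%:R])).
    apply: fin_bigcap_measurable => // i _; rewrite -[X in measurable X]setTI.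
    by apply: mI => //; exact: measurable_set1.
  by apply/seteqP; split => w /= hh i //=; exact: hh.
have bGo := bmf_hist hG.
transitivity (Ex P (fun w => \sum_(e : {ffun 'I_N -> bool}) (\prod_i h i (e i)) * (G w * \1_(A e) w))).
  congr (Ex P _); apply/funext => w.
  pose e0 := [ffun i => I n.+1 i w == 1].
  have e0E i : I n.+1 i w = (e0 i)%:R.
    by rewrite ffunE; case: (I01 n.+1 i w) => ->; rewrite ?eqxx// eq_sym oner_eq0.
  rewrite (bigD1 e0)//= [X in _ + X]big1 ?addr0; last first.
    move=> e /eqP ne; rewrite indicE memNset ?mulr0// /A /= => he; apply: ne.
    apply/ffunP => i; have := he i; rewrite e0E => /eqP.
    by case: (e i) (e0 i) => -[]//; rewrite ?oner_eq0// eq_sym oner_eq0.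
  rewrite indicE mem_set// mulr1 mulrC; congr (_ * _).
  rewrite [LHS]big_mkcond; apply: eq_bigr => i _; rewrite /h; by case: ifP.
rewrite Ex_sum; last by move=> e _; apply: bmfZ; exact: bmfM.
transitivity (\sum_(e : {ffun 'I_N -> bool}) (\prod_i h i (e i)) *
   Ex P (fun w => G w * \prod_(i < N) (if e i then draw_prob n i w else 1 - draw_prob n i w))).
  apply: eq_bigr => e _; rewrite ExZ; last exact: bmfM.
  by rewrite Ex_cond_config.
have bpr (e : {ffun 'I_N -> bool}) : bmf (fun w => \prod_(i < N) (if e i then draw_prob n i w else 1 - draw_prob n i w)).
  apply: bmf_prod => i _; case: (e i); first exact/bmf_hist/bmf_pick.
  by apply: bmfB; [exact: bmf_cst|exact/bmf_hist/bmf_pick].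
transitivity (\sum_(e : {ffun 'I_N -> bool}) Ex P (fun w => (\prod_i h i (e i)) *
   (G w * \prod_(i < N) (if e i then draw_prob n i w else 1 - draw_prob n i w)))).
  by apply: eq_bigr => e _; rewrite ExZ//; exact: bmfM.
rewrite -Ex_sum; last by move=> e _; apply: bmfZ; exact: bmfM.
congr (Ex P _); apply/funext => w.
under eq_bigr do rewrite mulrCA.
rewrite -mulr_sumr; congr (_ * _).
under eq_bigr do rewrite -big_split/=.
rewrite -(bigA_distr_bigA (fun i b => h i b * (if b then draw_prob n i w else 1 - draw_prob n i w))).
rewrite [RHS]big_mkcond; apply: eq_bigr => i _.
rewrite big_bool /= /h; case: ifP => _; last by ring.
by rewrite mul1r mul0r addr0.
Qed.

Definition eta n (i : 'I_N) w := I n.+1 i w - draw_prob n i w.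

Lemma bmf_eta n i : bmf (eta n i).
Proof. by apply: bmfB; [exact: bmf_I|exact/bmf_hist/bmf_pick]. Qed.

Lemma eta_le1 n i w : `|eta n i w| <= 1.
Proof.
have /andP[h1 h2] := pick01 n i w; rewrite /eta ler_norml.
by case: (I01 n.+1 i w) => ->; apply/andP; split; lra.
Qed.

Lemma Ex_cond1 n i (G : Om -> R) : @bmf R _ (hist n) G ->
  Ex P (fun w => G w * I n.+1 i w) = Ex P (fun w => G w * draw_prob n i w).
Proof.
move=> hG; have := @Ex_cond_prod n (pred1 i) G hG.
by under eq_fun do rewrite big_pred1_eq; under [in RHS]eq_fun do rewrite big_pred1_eq.
Qed.

Lemma Ex_cond2 n i k (G : Om -> R) : i != k -> @bmf R _ (hist n) G ->
  Ex P (fun w => G w * (I n.+1 i w * I n.+1 k w)) =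
  Ex P (fun w => G w * (draw_prob n i w * draw_prob n k w)).
Proof.
move=> ik hG; have := @Ex_cond_prod n (pred2 i k) G hG.
have E (F : 'I_N -> R) : \prod_(j < N | pred2 i k j) F j = F i * F k.
  rewrite (bigD1 i) /= ?eqxx//; congr (_ * _).
  rewrite (big_pred1 k)// => j /=; case: (eqVneq j i) => [->|] //=.
  - by rewrite (negbTE ik).
  - by rewrite andbT.
by under eq_fun do rewrite E; under [in RHS]eq_fun do rewrite E.
Qed.

Lemma Ex_eta n i (G : Om -> R) : @bmf R _ (hist n) G -> Ex P (fun w => G w * eta n i w) = 0.
Proof.
move=> hG; have bG := bmf_hist hG; have bp := bmf_hist (bmf_pick n i); have bI := bmf_I n.+1 i.
transitivity (Ex P (fun w => G w * I n.+1 i w) - Ex P (fun w => G w * draw_prob n i w)).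
  rewrite -ExB; [|exact: bmfM..].
  by congr (Ex P _); apply/funext => w; rewrite /eta mulrBr.
by rewrite Ex_cond1// subrr.
Qed.

(** Conditional independence removes the terms with [i != k]; on the diagonal [I ^ 2 = I] leaves the
    Bernoulli variance. *)
Lemma Ex_eta2 n i k (G : Om -> R) : @bmf R _ (hist n) G ->
  Ex P (fun w => G w * (eta n i w * eta n k w)) =
  if i == k then Ex P (fun w => G w * (draw_prob n i w * (1 - draw_prob n i w))) else 0.
Proof.
move=> hG; have bG := bmf_hist hG.
have hp j := bmf_pick n j; have bp j := bmf_hist (hp j).
have hGp j : @bmf R _ (hist n) (fun w => G w * draw_prob n j w) by exact: bmfM.
have be j := bmf_eta n j.
have -> : Ex P (fun w => G w * (eta n i w * eta n k w)) =
    Ex P (fun w => G w * (I n.+1 i w * eta n k w)).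
  transitivity (Ex P (fun w => G w * (I n.+1 i w * eta n k w)) -
     Ex P (fun w => (G w * draw_prob n i w) * eta n k w)).
    rewrite -ExB; [|apply: bmfM => //; apply: bmfM => //; exact: bmf_I|apply: bmfM => //; exact: bmfM].
    by congr (Ex P _); apply/funext => w; rewrite {1}/eta; ring.
  by rewrite [X in _ - X]Ex_eta// subr0.
transitivity (Ex P (fun w => G w * (I n.+1 i w * I n.+1 k w)) -
     Ex P (fun w => (G w * draw_prob n k w) * I n.+1 i w)).
  rewrite -ExB.
  - by congr (Ex P _); apply/funext => w; rewrite {1}/eta; ring.
  - by apply: bmfM => //; apply: bmfM; exact: bmf_I.
  - by apply: bmfM; [exact: bmfM|exact: bmf_I].
rewrite [X in _ - X]Ex_cond1//.
case: eqVneq => [<-|ik].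
  have -> : (fun w => G w * (I n.+1 i w * I n.+1 i w)) = (fun w => G w * I n.+1 i w).
    by apply/funext => w; case: (I01 n.+1 i w) => ->; rewrite ?mulr0 ?mulr1.
  rewrite Ex_cond1// -ExB.
  - by congr (Ex P _); apply/funext => w; ring.
  - exact: bmfM.
  - by apply: bmfM => //; exact: bmfM.
rewrite Ex_cond2// -[RHS](@subrr _ (Ex P (fun w => G w * (draw_prob n i w * draw_prob n k w)))).
by congr (_ - _); congr (Ex P _); apply/funext => w; ring.
Qed.

(** Conditional variance of [Z_{n+1}] given the past, divided by [r_n ^ 2]. *)
Definition cvar n w : R := (\sum_(i < N) draw_prob n i w * (1 - draw_prob n i w)) / N%:R ^+ 2.

Lemma bmf_cvar n : @bmf R _ (hist n) (cvar n).
Proof.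
rewrite /cvar; under eq_fun do rewrite mulrC; apply: bmfZ; apply: bmf_sum => i _.
by apply: bmfM; [|apply: bmfB; [exact: bmf_cst|]]; exact: bmf_pick.
Qed.

(** The interaction redistributes the draw probabilities among the sites without changing their sum
    ([sum_pick]), so the mean has no drift. *)
Lemma zm_step n w : zmean Z n.+1 w - zmean Z n w = r n * ((\sum_(i < N) eta n i w) / N%:R).
Proof.
rewrite /eta big_split/= sumrN sum_pick.
have E : \sum_(i < N) Z n.+1 i w = (1 - r n) * \sum_(i < N) Z n i w + r n * \sum_(i < N) I n.+1 i w.
  by rewrite !mulr_sumr -big_split/=; apply: eq_bigr => i _; rewrite Zrec.
by rewrite {1}/zmean E /zmean; field; rewrite gt_eqF.
Qed.

Lemma zm_step_le n w : `|zmean Z n.+1 w - zmean Z n w| <= r n.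
Proof.
have /andP[r0 _] := r01 n.
rewrite zm_step normrM (ger0_norm r0) ler_piMr// normrM normfV (gtr0_norm NR0) ler_pdivrMr// mul1r.
apply: le_trans (ler_norm_sum _ _ _) _.
rewrite -[leRHS](_ : \sum_(i < N) 1 = _); last by rewrite sumr_const card_ord.
by apply: ler_sum => i _; exact: eta_le1.
Qed.

Lemma zm_mart n (G : Om -> R) : @bmf R _ (hist n) G ->
  Ex P (fun w => G w * (zmean Z n.+1 w - zmean Z n w)) = 0.
Proof.
move=> hG; have bG := bmf_hist hG.
transitivity (Ex P (fun w => \sum_(i < N) (r n / N%:R) * (G w * eta n i w))).
  congr (Ex P _); apply/funext => w; rewrite zm_step -mulr_sumr -mulr_sumr; ring.
have be i : bmf (fun w => G w * eta n i w) by apply: bmfM => //; exact: bmf_eta.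
rewrite Ex_sum; last by move=> i _; exact: bmfZ.
by rewrite big1// => i _; rewrite ExZ// Ex_eta// mulr0.
Qed.

Lemma zm_cvar n (G : Om -> R) : @bmf R _ (hist n) G ->
  Ex P (fun w => G w * (zmean Z n.+1 w - zmean Z n w) ^+ 2) =
  r n ^+ 2 * Ex P (fun w => G w * cvar n w).
Proof.
move=> hG; have bG := bmf_hist hG.
have be i k : bmf (fun w => G w * (eta n i w * eta n k w)).
  by apply: bmfM => //; apply: bmfM; exact: bmf_eta.
transitivity (Ex P (fun w => \sum_(i < N) \sum_(k < N)
    (r n ^+ 2 / N%:R ^+ 2) * (G w * (eta n i w * eta n k w)))).
  congr (Ex P _); apply/funext => w; rewrite zm_step.
  transitivity ((r n ^+ 2 / N%:R ^+ 2) * (G w * ((\sum_(i < N) eta n i w) * (\sum_(i < N) eta n i w)))).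
    by field; rewrite gt_eqF.
  by rewrite big_distrlr/= !mulr_sumr; apply: eq_bigr => i _; rewrite !mulr_sumr.
rewrite Ex_sum; last by move=> i _; apply: bmf_sum => k _; exact: bmfZ.
have bpp i : bmf (fun w => G w * (draw_prob n i w * (1 - draw_prob n i w))).
  apply: bmfM => //; apply: bmfM; first exact/bmf_hist/bmf_pick.
  by apply: bmfB; [exact: bmf_cst|exact/bmf_hist/bmf_pick].
transitivity (\sum_(i < N) (r n ^+ 2 / N%:R ^+ 2) * Ex P (fun w => G w * (draw_prob n i w * (1 - draw_prob n i w)))).
  apply: eq_bigr => i _; rewrite Ex_sum; last by move=> k _; exact: bmfZ.
  rewrite (bigD1 i)//= big1 ?addr0; last first.
    by move=> k ki; rewrite ExZ// Ex_eta2// eq_sym (negbTE ki) mulr0.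
  by rewrite ExZ// Ex_eta2// eqxx.
rewrite -mulr_sumr -Ex_sum// -mulrA; congr (_ * _); rewrite -ExZ; last exact: bmf_sum.
congr (Ex P _); apply/funext => w; rewrite -mulr_sumr /cvar; ring.
Qed.

Definition gap n (i : 'I_N) w := Z n i w - zmean Z n w.

Lemma bmf_gap n i : @bmf R _ (hist n) (gap n i).
Proof. by apply: bmfB; [exact: bmf_Z|exact: bmf_zm]. Qed.

(** [draw_prob] differs from the mean by [1 - alpha] times the gap, so the gap is multiplied by
    [1 - alpha r_n], whose square is at most itself. The noise [r_n * mu] is conditionally centred
    with [|mu| <= 2], hence the 4. *)
Lemma gap_step n i : Ex P (fun w => gap n.+1 i w ^+ 2) <=
  (1 - alpha * r n) * Ex P (fun w => gap n i w ^+ 2) + 4 * r n ^+ 2.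
Proof.
have /andP[r0 r1] := r01 n; have /andP[a0 a1] := alpha01.
have bg := bmf_hist (bmf_gap n i); have hg := bmf_gap n i.
pose mu w := eta n i w - (\sum_(k < N) eta n k w) / N%:R.
have bmu : bmf mu.
  apply: bmfB; first exact: bmf_eta.
  by under eq_fun do rewrite mulrC; apply: bmfZ; apply: bmf_sum => k _; exact: bmf_eta.
have mu2 w : mu w ^+ 2 <= 4.
  have h : `|mu w| <= 2.
    apply: le_trans (ler_normB _ _) _.
    have := eta_le1 n i w; suff : `|(\sum_(k < N) eta n k w) / N%:R| <= 1 by lra.
    rewrite normrM normfV (gtr0_norm NR0) ler_pdivrMr// mul1r.
    apply: le_trans (ler_norm_sum _ _ _) _.
    rewrite -[leRHS](_ : \sum_(i < N) 1 = _); last by rewrite sumr_const card_ord.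
    by apply: ler_sum => k _; exact: eta_le1.
  rewrite -[mu w ^+ 2](real_normK (num_real _)).
  by have := normr_ge0 (mu w); nra.
have E w : gap n.+1 i w = (1 - alpha * r n) * gap n i w + r n * mu w.
  rewrite /mu /gap Zrec.
  have -> : zmean Z n.+1 w = zmean Z n w + r n * ((\sum_(i < N) eta n i w) / N%:R).
    by rewrite -zm_step addrC subrK.
  rewrite /eta /draw_prob; ring.
have E0 : Ex P (fun w => gap n i w * mu w) = 0.
  transitivity (Ex P (fun w => gap n i w * eta n i w - \sum_(k < N) N%:R^-1 * (gap n i w * eta n k w))).
    congr (Ex P _); apply/funext => w; rewrite /mu -!mulr_sumr; ring.
  have be k : bmf (fun w => gap n i w * eta n k w) by apply: bmfM => //; exact: bmf_eta.
  rewrite ExB//; last by apply: bmf_sum => k _; exact: bmfZ.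
  rewrite Ex_eta// Ex_sum; last by move=> k _; exact: bmfZ.
  by rewrite big1 ?subrr// => k _; rewrite ExZ// Ex_eta// mulr0.
have -> : Ex P (fun w => gap n.+1 i w ^+ 2) = (1 - alpha * r n) ^+ 2 * Ex P (fun w => gap n i w ^+ 2)
    + r n ^+ 2 * Ex P (fun w => mu w ^+ 2).
  transitivity (Ex P (fun w => ((1 - alpha * r n) ^+ 2 * gap n i w ^+ 2 + r n ^+ 2 * mu w ^+ 2)
     + (2 * (1 - alpha * r n) * r n) * (gap n i w * mu w))).
    by congr (Ex P _); apply/funext => w; rewrite E; ring.
  rewrite ExD; [|by apply: bmfD; apply: bmfZ; exact: bmfX|by apply: bmfZ; exact: bmfM].
  rewrite ExZ; last exact: bmfM.
  rewrite E0 mulr0 addr0 ExD; [|by apply: bmfZ; exact: bmfX..].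
  by rewrite !ExZ//; exact: bmfX.
have h0 : 0 <= Ex P (fun w => gap n i w ^+ 2) by apply: Ex_ge0 => w; exact: sqr_ge0.
have h1 : Ex P (fun w => mu w ^+ 2) <= 4 by apply: Ex_le_cst => //; exact: bmfX.
apply: lerD.
  apply: ler_wpM2r => //; rewrite expr2 ler_piMl//; nra.
by rewrite mulrC ler_wpM2r// sqr_ge0.
Qed.

End model.

(** * Martingales with controlled steps *)

Section taylor.
Context {R : realType}.
Implicit Types x y : R.

(** Integrates a power bound once by the mean value theorem. Giving up the factor [1 / n.+1] lets
    the successive remainders of sine and cosine all keep the constant 1. *)
Lemma iter_MVT_bound (f g : R -> R) (K : R) n : f 0 = 0 ->
  (forall x : R, is_derive x 1 f (g x)) -> (forall x, `|g x| <= K * `|x| ^+ n) -> forall x, `|f x| <= K * `|x| ^+ n.+1.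
Proof.
move=> f0 fg hg x.
have K0 : 0 <= K by have := le_trans (normr_ge0 _) (hg 1); rewrite normr1 expr1n mulr1.
have cf : continuous f by move=> y; apply: differentiable_continuous; exact/derivable1_diffP.
have bound c : `|c| <= `|x| -> `|g c| * `|x| <= K * `|x| ^+ n.+1.
  move=> cx; rewrite exprSr mulrA ler_wpM2r// (le_trans (hg c))// ler_wpM2l//.
  by apply: lerXn2r; rewrite ?nnegrE.
have [x0|x0|->] := ltgtP x 0.
- have [c] := MVT x0 (fun x _ => fg x) (continuous_subspaceT cf).
  rewrite in_itv/= => /andP[xc c0] E.
  have -> : f x = g c * x by move: E; rewrite f0; lra.
  by rewrite normrM; apply: bound; rewrite !ltr0_norm//; lra.
- have [c] := MVT x0 (fun x _ => fg x) (continuous_subspaceT cf).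
  rewrite in_itv/= => /andP[xc c0] E.
  have -> : f x = g c * x by move: E; rewrite f0; lra.
  by rewrite normrM; apply: bound; rewrite !gtr0_norm//; lra.
- by rewrite f0 normr0 expr0n mulr0.
Qed.

Lemma norm_sin_le x : `|sin x| <= `|x|.
Proof.
rewrite -[leRHS]mul1r -[`|x|]expr1; apply: (@iter_MVT_bound sin cos 1 0).
- exact: sin0.
- by move=> y; rewrite expr0 mulr1 ler_norml cos_geN1 cos_le1.
Qed.

Lemma cos_taylor1 x : `|cos x - 1| <= `|x| ^+ 2.
Proof.
rewrite -[leRHS]mul1r; apply: (@iter_MVT_bound (fun x => cos x - 1) (fun x => - sin x) 1 1).
- by rewrite cos0 subrr.
- move=> y; apply: is_derive_eq. by rewrite oppr0 addr0.
- by move=> y; rewrite normrN expr1 mul1r; exact: norm_sin_le.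
Qed.

Lemma sin_taylor x : `|sin x - x| <= `|x| ^+ 3.
Proof.
rewrite -[leRHS]mul1r; apply: (@iter_MVT_bound (fun x => sin x - x) (fun x => cos x - 1) 1 2).
- by rewrite sin0 subrr.
- by move=> y; rewrite mul1r; exact: cos_taylor1.
Qed.

Lemma cos_taylor x : `|cos x - 1 + x ^+ 2 / 2| <= `|x| ^+ 4.
Proof.
rewrite -[leRHS]mul1r; apply: (@iter_MVT_bound (fun x => cos x - 1 + x ^+ 2 / 2) (fun x => - sin x + x) 1 3).
- by rewrite cos0 subrr expr0n mul0r addr0.
- move=> y; apply: is_derive_eq.
  by rewrite !scaler0 /GRing.scale /=; lra.
- by move=> y; rewrite mul1r addrC -normrN opprB; exact: sin_taylor.
Qed.

Lemma cos_add_taylor y x : `|cos (y + x) - (cos y - x * sin y - x ^+ 2 / 2 * cos y)| <= `|x| ^+ 3 + `|x| ^+ 4.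
Proof.
rewrite cosD.
have -> : cos y * cos x - sin y * sin x - (cos y - x * sin y - x ^+ 2 / 2 * cos y) =
   - (sin y * (sin x - x)) + cos y * (cos x - 1 + x ^+ 2 / 2) by lra.
apply: le_trans (ler_normD _ _) _; rewrite normrN !normrM.
apply: lerD.
  rewrite (le_trans (ler_wpM2l _ (sin_taylor x)))// ler_piMl ?exprn_ge0//.
  by rewrite ler_norml sin_geN1 sin_le1.
rewrite (le_trans (ler_wpM2l _ (cos_taylor x)))// ler_piMl ?exprn_ge0//.
by rewrite ler_norml cos_geN1 cos_le1.
Qed.

Lemma expRN_taylor x : 0 <= x -> `|expR (- x) - (1 - x)| <= x ^+ 2.
Proof.
move=> x0.
have h1 : 1 - x <= expR (- x) by have := expR_ge1Dx (- x); lra.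
rewrite ger0_norm ?subr_ge0//.
have h2 : 1 + x <= expR x := expR_ge1Dx x.
have h3 : expR (- x) <= (1 + x)^-1.
  by rewrite expRN lef_pV2 ?posrE ?expR_gt0//; lra.
(* From [(1 + x) (1 - x + x ^ 2) = 1 + x ^ 3 >= 1]. *)
have h4 : (1 + x)^-1 <= 1 - x + x ^+ 2.
  rewrite -[leLHS]div1r ler_pdivrMr; last lra.
  have : 0 <= x ^+ 3 by exact: exprn_ge0.
  nra.
lra.
Qed.

End taylor.

(** The fluctuation analysis sees the model through this interface. Conditioning means testing
    against bounded variables [G] of the past; [r n] bounds the step and [r n ^ 2 * cv n] is its
    conditional variance. *)
Record controlled_martingale {R : realType} {d : measure_display} {Om : measurableType d}
  (P : probability Om R) (hg : nat -> set (set Om)) (M cv : nat -> Om -> R) (r : nat -> R) : Prop := {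
  cm_sub : forall n (X : Om -> R), @bmf R _ (g_sigma_algebraType (hg n)) X -> bmf X;
  cm_mono : forall n m (X : Om -> R), (n <= m)%N ->
    @bmf R _ (g_sigma_algebraType (hg n)) X -> @bmf R _ (g_sigma_algebraType (hg m)) X;
  cm_M : forall n, @bmf R _ (g_sigma_algebraType (hg n)) (M n);
  cm_cv : forall n, @bmf R _ (g_sigma_algebraType (hg n)) (cv n);
  cm_cv0 : forall n w, 0 <= cv n w;
  cm_cv1 : forall n w, cv n w <= 1;
  cm_r0 : forall n, 0 <= r n;
  cm_step : forall n w, `|M n.+1 w - M n w| <= r n;
  cm_mart : forall n (G : Om -> R), @bmf R _ (g_sigma_algebraType (hg n)) G ->
    Ex P (fun w => G w * (M n.+1 w - M n w)) = 0;
  cm_cvar : forall n (G : Om -> R), @bmf R _ (g_sigma_algebraType (hg n)) G ->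
    Ex P (fun w => G w * (M n.+1 w - M n w) ^+ 2) = r n ^+ 2 * Ex P (fun w => G w * cv n w) }.

Section martingale.
Context {R : realType} {d : measure_display} {Om : measurableType d}.
Context (P : probability Om R) (hg : nat -> set (set Om)).
Context (M cv : nat -> Om -> R) (r : nat -> R).
Local Notation H n := (g_sigma_algebraType (hg n)).
Hypothesis HH : controlled_martingale P hg M cv r.
Let Hsub := cm_sub HH.
Let Hmono := cm_mono HH.
Let HM := cm_M HH.
Let Hcv := cm_cv HH.
Let cv_ge0 := cm_cv0 HH.
Let cv_le1 := cm_cv1 HH.
Let r_ge0 := cm_r0 HH.
Let Mstep := cm_step HH.
Let Mmart := cm_mart HH.
Let Mcvar := cm_cvar HH.

(** A martingale transform with deterministic weights; [qsum] bounds its variance. Varying weights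
    serve for linear combinations of marginals and for the weighted maximal inequality near time
    0. *)
Definition wsum (b : nat -> R) (m K : nat) (w : Om) : R :=
  \sum_(m <= k < K) b k * (M k.+1 w - M k w).

Definition qsum (b : nat -> R) (m K : nat) : R := \sum_(m <= k < K) (b k * r k) ^+ 2.

Lemma bmf_M n m : (n <= m)%N -> @bmf R _ (H m) (M n).
Proof. by move=> nm; apply: Hmono nm _; exact: HM. Qed.

Lemma bmf_wsum b m K : @bmf R _ (H K) (wsum b m K).
Proof.
rewrite /wsum; elim: K => [|K ih].
  by under eq_fun do rewrite big_geq//; exact: bmf_cst.
have [mK|mK] := leqP m K; last first.
  by under eq_fun do rewrite big_geq//; exact: bmf_cst.
under eq_fun do rewrite big_nat_recr//=.
apply: bmfD; first exact: Hmono ih.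
by apply: bmfZ; apply: bmfB; exact: bmf_M.
Qed.

Lemma wsumS b m K w : (m <= K)%N -> wsum b m K.+1 w = wsum b m K w + b K * (M K.+1 w - M K w).
Proof. by move=> mK; rewrite /wsum big_nat_recr. Qed.

Lemma wsum_nil b m w : wsum b m m w = 0.
Proof. by rewrite /wsum big_geq. Qed.

Lemma qsumS b m K : (m <= K)%N -> qsum b m K.+1 = qsum b m K + (b K * r K) ^+ 2.
Proof. by move=> mK; rewrite /qsum big_nat_recr. Qed.

Lemma qsum_ge0 b m K : 0 <= qsum b m K.
Proof. by rewrite /qsum sumr_ge0// => k _; exact: sqr_ge0. Qed.

Lemma wsum1 m K w : (m <= K)%N -> wsum (fun=> 1) m K w = M K w - M m w.
Proof.
by move=> mK; rewrite /wsum; under eq_bigr do rewrite mul1r; rewrite telescope_sumr.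
Qed.

Lemma step_norm (b : R) k w : `|b * (M k.+1 w - M k w)| <= `|b| * r k.
Proof. by rewrite normrM ler_wpM2l. Qed.

Lemma Ex_xi2_le k (G : Om -> R) : @bmf R _ (H k) G -> (forall w, 0 <= G w) ->
  Ex P (fun w => G w * (M k.+1 w - M k w) ^+ 2) <= r k ^+ 2 * Ex P G.
Proof.
move=> hG G0; rewrite Mcvar// ler_wpM2l ?sqr_ge0//.
apply: le_Ex; [by apply: bmfM; [exact: Hsub hG|exact: Hsub (Hcv k)]|exact: Hsub hG|].
by move=> w; rewrite ler_piMr.
Qed.

Lemma Ex_wsum2 b m K : (m <= K)%N -> Ex P (fun w => wsum b m K w ^+ 2) <= qsum b m K.
Proof.
elim: K => [|K ih mK].
  rewrite leqn0 => /eqP ->; under eq_fun do rewrite wsum_nil expr0n.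
  by rewrite Ex_cst qsum_ge0.
have [mK'|mK'] := leqP m K; last first.
  have -> : m = K.+1 by apply/eqP; rewrite eqn_leq mK.
  by under eq_fun do rewrite wsum_nil expr0n; rewrite Ex_cst qsum_ge0.
have hS := bmf_wsum b m K; have bS := Hsub hS.
have bX : bmf (fun w => M K.+1 w - M K w).
  by apply: (@Hsub K.+1); apply: bmfB; exact: bmf_M.
rewrite qsumS//.
have -> : Ex P (fun w => wsum b m K.+1 w ^+ 2) = Ex P (fun w => wsum b m K w ^+ 2) +
   b K ^+ 2 * Ex P (fun w => 1 * (M K.+1 w - M K w) ^+ 2).
  transitivity (Ex P (fun w => (wsum b m K w ^+ 2 + b K ^+ 2 * (1 * (M K.+1 w - M K w) ^+ 2)) +
     (2 * b K) * (wsum b m K w * (M K.+1 w - M K w)))).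
    by congr (Ex P _); apply/funext => w; rewrite wsumS//; ring.
  rewrite ExD; [|by apply: bmfD; [exact: bmfX|apply: bmfZ; apply: bmfZ; exact: bmfX]|by apply: bmfZ; exact: bmfM].
  rewrite ExD; [|exact: bmfX|by apply: bmfZ; apply: bmfZ; exact: bmfX].
  rewrite ExZ; last by apply: bmfZ; exact: bmfX.
  by rewrite [X in _ + X]ExZ ?Mmart ?mulr0 ?addr0//; exact: bmfM.
apply: lerD; first exact: ih.
rewrite exprMn ler_wpM2l ?sqr_ge0//.
have := @Ex_xi2_le K (fun=> 1) (bmf_cst _) (fun=> ler01).
by rewrite Ex_cst mulr1.
Qed.

(** By [4 S y ^ 3 <= 2 S ^ 2 y ^ 2 + 2 y ^ 4], one step adds at most [8 rho S ^ 2 + 3 rho ^ 2] in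
    mean, and 11 leaves ample room in [(q + rho) ^ 2]. Tightness needs this moment: a block of
    length [1 / m] then fails with probability of order [1 / m ^ 2], summable over a multiple of [m]
    blocks, where the second moment would only give [1 / m]. *)
Lemma Ex_wsum4 b m K : (m <= K)%N -> Ex P (fun w => wsum b m K w ^+ 4) <= 11 * qsum b m K ^+ 2.
Proof.
elim: K => [|K ih mK].
  rewrite leqn0 => /eqP ->; under eq_fun do rewrite wsum_nil expr0n.
  by rewrite Ex_cst mulr_ge0// sqr_ge0.
have [mK'|mK'] := leqP m K; last first.
  have -> : m = K.+1 by apply/eqP; rewrite eqn_leq mK.
  by under eq_fun do rewrite wsum_nil expr0n; rewrite Ex_cst mulr_ge0// sqr_ge0.
have hS := bmf_wsum b m K; have bS := Hsub hS.
set rho := (b K * r K) ^+ 2.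
have bX : bmf (fun w => M K.+1 w - M K w).
  by apply: (@Hsub K.+1); apply: bmfB; exact: bmf_M.
rewrite qsumS// -/rho.
have rho0 : 0 <= rho by exact: sqr_ge0.
apply: (@le_trans _ _ (Ex P (fun w => (wsum b m K w ^+ 4 + 4 * b K * (wsum b m K w ^+ 3 * (M K.+1 w - M K w)))
   + (8 * rho * wsum b m K w ^+ 2 + 3 * rho ^+ 2)))).
  have b1 : bmf (wsum b m K.+1) := Hsub (bmf_wsum b m K.+1).
  apply: le_Ex.
  - exact: bmfX.
  - apply: bmfD; first apply: bmfD; first exact: bmfX.
      by apply: bmfZ; apply: bmfM => //; exact: bmfX.
    by apply: bmfD; [apply: bmfZ; exact: bmfX|exact: bmf_cst].
  move=> w; rewrite wsumS//; set S := wsum b m K w.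
  have := @step_norm (b K) K w; set x := M K.+1 w - M K w => hx.
  have hy2 : (b K * x) ^+ 2 <= rho.
    rewrite /rho -[(b K * x) ^+ 2](real_normK (num_real _)) -[(b K * r K) ^+ 2](real_normK (num_real _)).
    by apply: lerXn2r; rewrite ?nnegrE ?normr_ge0// (normrM (b K) (r K)) (ger0_norm (r_ge0 K)).
  have -> : 4 * b K * (S ^+ 3 * x) = 4 * S ^+ 3 * (b K * x) by ring.
  move: hy2; set y := b K * x => hy2.
  have h0 : 0 <= S ^+ 2 := sqr_ge0 S.
  have h1 : 0 <= y ^+ 2 := sqr_ge0 y.
  have h3 : 4 * S * y ^+ 3 <= 2 * S ^+ 2 * y ^+ 2 + 2 * y ^+ 4.
    have : 0 <= 2 * y ^+ 2 * (S - y) ^+ 2 by rewrite mulr_ge0 ?sqr_ge0// mulr_ge0.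
    nra.
  have h4 : (S + y) ^+ 4 = S ^+ 4 + 4 * S ^+ 3 * y + 6 * S ^+ 2 * y ^+ 2 + 4 * S * y ^+ 3 + y ^+ 4 by ring.
  have h5 : S ^+ 2 * y ^+ 2 <= S ^+ 2 * rho by rewrite ler_wpM2l.
  have h6 : y ^+ 4 <= rho ^+ 2 by rewrite (exprM y 2 2); apply: lerXn2r.
  rewrite h4; lra.
rewrite ExD; last first.
- by apply: bmfD; [apply: bmfZ; exact: bmfX|exact: bmf_cst].
- by apply: bmfD; [exact: bmfX|apply: bmfZ; apply: bmfM => //; exact: bmfX].
rewrite ExD; [|exact: bmfX|by apply: bmfZ; apply: bmfM => //; exact: bmfX].
rewrite ExZ; last by apply: bmfM => //; exact: bmfX.
rewrite Mmart; last exact: bmfX.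
rewrite mulr0 addr0 ExD; [|by apply: bmfZ; exact: bmfX|exact: bmf_cst].
rewrite ExZ ?Ex_cst; last exact: bmfX.
have := ih mK'; have := Ex_wsum2 b mK'; have := qsum_ge0 b m K.
set q := qsum b m K => q0 h2 h4.
have : 8 * rho * Ex P (fun w => wsum b m K w ^+ 2) <= 8 * rho * q.
  by rewrite ler_wpM2l// mulr_ge0.
nra.
Qed.

(** Submartingale property of the fourth power, from [(S + y) ^ 4 - S ^ 4 - 4 S ^ 3 y = y ^ 2 (2 S ^
    2 + (2 S + y) ^ 2)]. *)
Lemma Ex_wsum4_mono b m K (G : Om -> R) : (m <= K)%N -> @bmf R _ (H K) G -> (forall w, 0 <= G w) ->
  Ex P (fun w => G w * wsum b m K w ^+ 4) <= Ex P (fun w => G w * wsum b m K.+1 w ^+ 4).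
Proof.
move=> mK hG G0; have bG := Hsub hG.
have hS := bmf_wsum b m K; have bS := Hsub hS.
have b1 : bmf (wsum b m K.+1) := Hsub (bmf_wsum b m K.+1).
have bX : bmf (fun w => M K.+1 w - M K w).
  by apply: (@Hsub K.+1); apply: bmfB; exact: bmf_M.
have b3 : bmf (fun w => G w * wsum b m K w ^+ 3) by apply: bmfM => //; exact: bmfX.
have E0 : Ex P (fun w => (4 * b K) * ((G w * wsum b m K w ^+ 3) * (M K.+1 w - M K w))) = 0.
  rewrite ExZ; last exact: bmfM.
  by rewrite Mmart ?mulr0//; apply: bmfM => //; exact: bmfX.
rewrite -[leLHS]addr0 -E0 -ExD; [|by apply: bmfM => //; exact: bmfX|by apply: bmfZ; exact: bmfM].
apply: le_Ex.
- by apply: bmfD; [apply: bmfM => //; exact: bmfX|by apply: bmfZ; exact: bmfM].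
- by apply: bmfM => //; exact: bmfX.
move=> w; rewrite wsumS//; set S := wsum b m K w; set x := M K.+1 w - M K w.
have -> : 4 * b K * (G w * S ^+ 3 * x) = G w * (4 * S ^+ 3 * (b K * x)) by ring.
rewrite -mulrDr ler_wpM2l//; set y := b K * x.
have -> : (S + y) ^+ 4 = S ^+ 4 + 4 * S ^+ 3 * y + y ^+ 2 * (2 * S ^+ 2 + (2 * S + y) ^+ 2) by ring.
by rewrite lerDl mulr_ge0 ?sqr_ge0// addr_ge0 ?sqr_ge0// mulr_ge0 ?sqr_ge0.
Qed.

(** Doob's maximal inequality, with the products [J] (indicators of having stayed below [l]) in
    place of a stopping time. The exceptional event is exhibited, because it later absorbs
    statements about uncountably many times. *)
Lemma maximal4 b m K (l : R) : (m <= K)%N -> 0 < l ->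
  exists A : set Om, [/\ measurable A,
    (forall w, (exists2 k, (m <= k <= K)%N & l <= `|wsum b m k w|) -> A w) &
    fine (P A) <= 11 * qsum b m K ^+ 2 / l ^+ 4].
Proof.
move=> mK l0.
pose B k : set Om := [set w | `|wsum b m k w| < l].
have hB k : @bmf R _ (H k) (\1_(B k)).
  apply: bmf_indic; have [mw _] := bmf_wsum b m k.
  rewrite (_ : B k = setT `&` wsum b m k @^-1` `]-l, l[%classic); first exact: mw.
  by apply/seteqP; split => w; rewrite /B /= in_itv/= ltr_norml// => -[].
pose J K w := \prod_(m <= k < K) \1_(B k) w : R.
have hJ k : @bmf R _ (H k) (J k.+1).
  rewrite /J; under eq_fun do rewrite big_nat.
  apply: bmf_prod => i /andP[_ ik]; exact: Hmono (hB i).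
have J01 k w : 0 <= J k w <= 1.
  apply/andP; split; first by apply: prodr_ge0 => i _; rewrite indicE.
  by apply: numdomain.Num.Theory.prodr_ile1 => i _; rewrite indicE; case: (_ \in _); rewrite /= ?lexx ?ler01 ?andbT.
have JS k w : (m <= k)%N -> J k.+1 w = J k w * \1_(B k) w.
  by move=> mk; rewrite /J big_nat_recr.
have l4 : 0 < l ^+ 4 by exact: exprn_gt0.
have hout k w : (1 - \1_(B k) w) * l ^+ 4 <= (1 - \1_(B k) w) * wsum b m k w ^+ 4.
  rewrite indicE; case: (boolP (w \in B k)) => wB; first by rewrite subrr !mul0r.
  rewrite subr0 !mul1r -[wsum _ _ _ _ ^+ 4]ger0_norm; last by rewrite (exprM _ 2 2) sqr_ge0.
  rewrite normrX; apply: lerXn2r; rewrite ?nnegrE// ?(ltW l0)// leNgt.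
  by apply/negP => h; move/negP: wB; apply; rewrite inE.
have bS k : bmf (wsum b m k) := Hsub (bmf_wsum b m k).
have bJ k : bmf (J k.+1) := Hsub (hJ k).
have h1J k : @bmf R _ (H k) (fun w => 1 - J k.+1 w) by apply: bmfB => //; exact: bmf_cst.
have b1J k : bmf (fun w => 1 - J k.+1 w) := Hsub (h1J k).
(* [1 - J k.+1] marks the paths that have left by time [k] and is known at time [k]: earlier exits
   are carried over by the submartingale property, an exit at the current time is bounded by
   [hout]. *)
have main k : (m <= k)%N -> l ^+ 4 * Ex P (fun w => 1 - J k.+1 w) <=
    Ex P (fun w => (1 - J k.+1 w) * wsum b m k w ^+ 4).
  elim: k => [|k ih].
    rewrite leqn0 => /eqP m0; rewrite -ExZ//; apply: le_Ex; [exact: bmfZ|by apply: bmfM => //; exact: bmfX|].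
    by move=> w; rewrite JS ?m0// /J m0 big_geq// mul1r mulrC; have := hout 0%N w; rewrite m0.
  rewrite leq_eqVlt => /predU1P[mk|mk].
    rewrite -ExZ//; apply: le_Ex; [exact: bmfZ|by apply: bmfM => //; exact: bmfX|].
    by move=> w; rewrite JS ?mk// /J -mk big_geq// mul1r mulrC; have := hout m w.
  rewrite ltnS in mk.
  have bU : bmf (fun w => J k.+1 w * (1 - \1_(B k.+1) w)).
    by apply: bmfM => //; apply: bmfB; [exact: bmf_cst|exact: Hsub (hB k.+1)].
  have E X : bmf X -> Ex P (fun w => (1 - J k.+2 w) * X w) = Ex P (fun w => (1 - J k.+1 w) * X w) +
      Ex P (fun w => J k.+1 w * (1 - \1_(B k.+1) w) * X w).
    move=> bX; rewrite -ExD; [|exact: bmfM..].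
    by congr (Ex P _); apply/funext => w; rewrite (@JS k.+1 w (leqW mk)); ring.
  have E1 : Ex P (fun w => 1 - J k.+2 w) = Ex P (fun w => 1 - J k.+1 w) +
      Ex P (fun w => J k.+1 w * (1 - \1_(B k.+1) w)).
    rewrite -ExD//; congr (Ex P _); apply/funext => w.
    by rewrite (@JS k.+1 w (leqW mk)); ring.
  rewrite E1 (E (fun w => wsum b m k.+1 w ^+ 4)); last exact: bmfX.
  rewrite mulrDr; apply: lerD.
    apply: le_trans (ih mk) _; apply: Ex_wsum4_mono => // w.
    by have /andP[] := J01 k.+1 w; lra.
  rewrite -ExZ//; apply: le_Ex; [exact: bmfZ|by apply: bmfM => //; exact: bmfX|].
  move=> w; rewrite mulrCA -mulrA ler_wpM2l//; first by have /andP[] := J01 k.+1 w.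
  by rewrite mulrC; exact: hout.
exists [set w | J K.+1 w = 0]; split.
- have [mJ _] := bJ K; rewrite -[X in measurable X]setTI.
  by apply: (mJ measurableT [set 0]); exact: measurable_set1.
- move=> w [k /andP[mk kK] lk] /=; rewrite /J (big_cat_nat _ (n := k)) //=; last exact: leqW.
  rewrite [X in _ * X]big_ltn// indicE memNset ?mul0r ?mulr0//= /B /=.
  by apply/negP; rewrite -leNgt.
rewrite ler_pdivlMr// mulrC.
apply: le_trans (_ : l ^+ 4 * Ex P (fun w => 1 - J K.+1 w) <= _).
  rewrite ler_wpM2l ?(ltW l4)//.
  rewrite -[leRHS]divr1; apply: Ex_markov => //.
  - have [mJ _] := bJ K; rewrite -[X in measurable X]setTI.
    by apply: (mJ measurableT [set 0]); exact: measurable_set1.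
  - by move=> w; have /andP[] := J01 K.+1 w; lra.
  - by move=> w /= ->; rewrite subr0.
apply: le_trans (main K mK) _; apply: le_trans (Ex_wsum4 b mK).
apply: le_Ex; [by apply: bmfM => //; exact: bmfX|exact: bmfX|].
move=> w; rewrite ler_piMl//; first by rewrite (exprM _ 2 2) sqr_ge0.
by have /andP[] := J01 K.+1 w; lra.
Qed.

Lemma clt_step b k (G y v : Om -> R) (CG dl e : R) :
  @bmf R _ (H k) G -> @bmf R _ (H k) y -> @bmf R _ (H k) v ->
  (forall w, 0 <= v w <= 1) -> (forall w, `|G w| <= CG) ->
  Ex P (fun w => `|cv k w - v w|) <= dl -> `|b k| * r k <= e -> e <= 1 ->
  `|Ex P (fun w => G w * cos (y w + b k * (M k.+1 w - M k w))) -
    Ex P (fun w => G w * (expR (- (v w * (b k * r k) ^+ 2 / 2)) * cos (y w)))|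
  <= CG * ((b k * r k) ^+ 2 * (dl + 3 * e)).
Proof.
move=> hG hy hv v01 GC hdl he e1.
have CG0 : 0 <= CG := le_trans (normr_ge0 _) (GC point).
set rho := (b k * r k) ^+ 2.
have rho0 : 0 <= rho := sqr_ge0 _.
have e0 : 0 <= e by apply: le_trans he; rewrite mulr_ge0.
have rhoe : rho <= e ^+ 2.
  rewrite /rho -[(b k * r k) ^+ 2](real_normK (num_real _)) normrM (ger0_norm (r_ge0 k)).
  by apply: lerXn2r; rewrite ?nnegrE// mulr_ge0.
pose x w := M k.+1 w - M k w.
have hx : @bmf R _ (H k.+1) x by apply: bmfB; exact: bmf_M.
have bx := Hsub hx.
have hC : @bmf R _ (H k) (fun w => cos (y w)) by apply: bmf_cos; case: hy.
have hS : @bmf R _ (H k) (fun w => sin (y w)) by apply: bmf_sin; case: hy.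
have bG := Hsub hG; have bC := Hsub hC; have bS := Hsub hS.
have bv := Hsub hv; have by_ := Hsub hy; have bcv := Hsub (Hcv k).
have bE : bmf (fun w => expR (- (v w * rho / 2))).
  apply: (@bmf_bounded _ _ _ _ 0 1).
    apply: measurableT_comp => //; apply: measurableT_comp => //.
    by apply: measurable_funM => //; apply: measurable_funM => //; case: bv.
  move=> w; rewrite expR_ge0/= -[leRHS]expR0 ler_expR oppr_le0.
  by have /andP[? ?] := v01 w; rewrite divr_ge0// mulr_ge0.
have byx : bmf (fun w => cos (y w + b k * x w)).
  by apply: bmf_cos; apply: measurable_funD; [case: by_|apply: measurable_funM => //; case: bx].
pose T w := G w * (cos (y w) - (b k * x w) * sin (y w) - (b k * x w) ^+ 2 / 2 * cos (y w)).
have bT : bmf T.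
  apply: bmfM => //; apply: bmfB; first apply: bmfB => //.
    by apply: bmfM => //; exact: bmfZ.
  apply: bmfM => //; under eq_fun do rewrite mulrC; apply: bmfZ; apply: bmfX; exact: bmfZ.
(* Conditional centring removes the linear term, and the square becomes the conditional variance. *)
have ET : Ex P T = Ex P (fun w => G w * ((1 - rho * cv k w / 2) * cos (y w))).
  transitivity (Ex P (fun w => (G w * cos (y w) - b k * ((G w * sin (y w)) * x w)) -
      (b k ^+ 2 / 2) * ((G w * cos (y w)) * x w ^+ 2))).
    by congr (Ex P _); apply/funext => w; rewrite /T; field.
  rewrite ExB; last first.
  - by apply: bmfZ; apply: bmfM; [exact: bmfM|exact: bmfX].
  - by apply: bmfB; [exact: bmfM|apply: bmfZ; apply: bmfM => //; exact: bmfM].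
  rewrite ExB; [|exact: bmfM|by apply: bmfZ; apply: bmfM => //; exact: bmfM].
  rewrite ExZ; last by apply: bmfM => //; exact: bmfM.
  rewrite Mmart ?mulr0 ?subr0; last exact: bmfM.
  rewrite ExZ; last by apply: bmfM; [exact: bmfM|exact: bmfX].
  rewrite Mcvar; last exact: bmfM.
  rewrite mulrA -ExZ; last by apply: bmfM => //; exact: bmfM.
  rewrite -ExB; [|exact: bmfM|by apply: bmfZ; apply: bmfM => //; exact: bmfM].
  by congr (Ex P _); apply/funext => w; rewrite /rho; field.
set A := Ex P (fun w => G w * cos _); set B := Ex P (fun w => G w * (expR _ * _)).
have -> : A - B = (A - Ex P T) + (Ex P T - B) by ring.
apply: le_trans (ler_normD _ _) _.
have h1 : `|A - Ex P T| <= CG * (rho * (2 * e)).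
  apply: Ex_dist => //; first exact: bmfM.
  move=> w; rewrite /T -mulrBr normrM; apply: ler_pM => //.
  apply: le_trans (cos_add_taylor _ _) _.
  have hxb : `|b k * x w| <= `|b k| * r k := step_norm _ _ _.
  have h2 : `|b k * x w| ^+ 2 <= rho.
    rewrite /rho -[(b k * r k) ^+ 2](real_normK (num_real _)) [`|b k * r k|]normrM (ger0_norm (r_ge0 k)).
    by apply: lerXn2r; rewrite ?nnegrE// mulr_ge0.
  have h3 : `|b k * x w| <= e := le_trans hxb he.
  move: (normr_ge0 (b k * x w)) h2 h3; set u := `|b k * x w| => u0 h2 h3.
  have h4 : u ^+ 3 <= rho * e by rewrite exprSr; apply: ler_pM => //; exact: sqr_ge0.
  have h5 : u ^+ 4 <= rho * e.
    rewrite (exprD u 2 2); apply: ler_pM; rewrite ?sqr_ge0//.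
    by apply: le_trans (_ : e ^+ 2 <= _); [apply: lerXn2r; rewrite ?nnegrE|rewrite expr2 ler_piMl].
  lra.
have h2 : `|Ex P T - B| <= CG * (rho * (dl + e)).
  rewrite ET -ExB; last first.
  - by apply: bmfM => //; exact: bmfM.
  - apply: bmfM => //; apply: bmfM => //; apply: bmfB; first exact: bmf_cst.
    by apply: bmfZr; exact: bmfZ.
  apply: (@le_trans _ _ (Ex P (fun w => CG * (rho * `|cv k w - v w| + rho * e)))).
    apply: Ex_norm_le.
    - apply: bmfB; last by apply: bmfM => //; exact: bmfM.
      apply: bmfM => //; apply: bmfM => //; apply: bmfB; first exact: bmf_cst.
      by apply: bmfZr; exact: bmfZ.
    - apply: bmfZ; apply: bmfD; last exact: bmf_cst.
      by apply: bmfZ; apply: bmf_norm; exact: bmfB.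
    move=> w; rewrite -mulrBr normrM; apply: ler_pM => //.
    rewrite -mulrBl normrM -[leRHS]mulr1; apply: ler_pM => //; last by rewrite ler_norml cos_geN1 cos_le1.
    have /andP[v0 v1] := v01 w.
    have u0 : 0 <= v w * rho / 2 by rewrite divr_ge0// mulr_ge0.
    have hE := expRN_taylor u0.
    have -> : 1 - rho * cv k w / 2 - expR (- (v w * rho / 2)) =
      - (expR (- (v w * rho / 2)) - (1 - v w * rho / 2)) + (rho / 2) * (v w - cv k w) by field.
    apply: le_trans (ler_normD _ _) _; rewrite normrN normrM [`|v w - _|]distrC (ger0_norm (_ : 0 <= rho / 2)); last by rewrite divr_ge0.
    rewrite [leLHS]addrC; apply: lerD.
      by rewrite ler_wpM2r//; lra.
    apply: le_trans hE _.
    have : v w * rho / 2 <= rho by nra.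
    have hr1 : rho <= e by apply: le_trans rhoe _; rewrite expr2 ler_piMl.
    move=> h; apply: le_trans (_ : rho ^+ 2 <= _); first by apply: lerXn2r; rewrite ?nnegrE.
    by rewrite expr2 ler_wpM2l.
  have bn : bmf (fun w => `|cv k w - v w|) by apply: bmf_norm; exact: bmfB.
  rewrite ExZ; last by apply: bmfD; [exact: bmfZ|exact: bmf_cst].
  rewrite ExD ?Ex_cst ?ExZ//; [|exact: bmfZ|exact: bmf_cst].
  by rewrite -mulrDr ler_wpM2l// ler_wpM2l// lerD2r.
apply: le_trans (lerD h1 h2) _; rewrite -mulrDr -mulrDr ler_wpM2l// ler_wpM2l//; lra.
Qed.

(** Telescoping over the hybrids [Psi k], where the steps before [k] are those of the martingale and
    the later ones already Gaussian. As [v] is known at time [m], the remaining Gaussian factor is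
    an admissible past weight in every exchange. *)
Lemma clt_bound b m K (G phi v : Om -> R) (CG dl e : R) : (m <= K)%N ->
  @bmf R _ (H m) G -> @bmf R _ (H m) phi -> @bmf R _ (H m) v ->
  (forall w, 0 <= v w <= 1) -> (forall w, `|G w| <= CG) ->
  (forall k, (m <= k < K)%N -> Ex P (fun w => `|cv k w - v w|) <= dl) ->
  (forall k, (m <= k < K)%N -> `|b k| * r k <= e) -> e <= 1 ->
  `|Ex P (fun w => G w * cos (phi w + wsum b m K w)) -
    Ex P (fun w => G w * (expR (- (v w * qsum b m K / 2)) * cos (phi w)))|
  <= CG * (qsum b m K * (dl + 3 * e)).
Proof.
move=> mK hG hphi hv v01 GC hdl he e1.
pose Psi k := Ex P (fun w => G w * expR (- (v w * qsum b k K / 2)) * cos (phi w + wsum b m k w)).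
have hE k : @bmf R _ (H m) (fun w => expR (- (v w * qsum b k K / 2))).
  apply: (@bmf_bounded _ _ _ _ 0 1).
    apply: measurableT_comp => //; apply: measurableT_comp => //.
    by apply: measurable_funM => //; apply: measurable_funM => //; case: hv.
  move=> w; rewrite expR_ge0/= -[leRHS]expR0 ler_expR oppr_le0.
  by have /andP[? ?] := v01 w; rewrite divr_ge0// mulr_ge0// qsum_ge0.
have hE1 k w : `|expR (- (v w * qsum b k K / 2))| <= 1.
  rewrite ger0_norm ?expR_ge0// -[leRHS]expR0 ler_expR oppr_le0.
  by have /andP[? ?] := v01 w; rewrite divr_ge0// mulr_ge0// qsum_ge0.
have main k : (m <= k)%N -> (k <= K)%N -> `|Psi k - Psi m| <= CG * (qsum b m k * (dl + 3 * e)).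
  elim: k => [|k ih].
    rewrite leqn0 => /eqP m0 _; rewrite -m0 subrr normr0.
    by rewrite /qsum big_geq// mul0r mulr0.
  rewrite leq_eqVlt => /predU1P[<- _|].
    by rewrite subrr normr0 /qsum big_geq// mul0r mulr0.
  rewrite ltnS => mk kK.
  have -> : Psi k.+1 - Psi m = (Psi k.+1 - Psi k) + (Psi k - Psi m) by ring.
  apply: le_trans (ler_normD _ _) _.
  rewrite qsumS// mulrDl mulrDr addrC; apply: lerD; first exact/ih/ltnW.
  have := @clt_step b k (fun w => G w * expR (- (v w * qsum b k.+1 K / 2)))
    (fun w => phi w + wsum b m k w) v CG dl e.
  have -> : Psi k.+1 = Ex P (fun w => G w * expR (- (v w * qsum b k.+1 K / 2)) *
     cos (phi w + wsum b m k w + b k * (M k.+1 w - M k w))).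
    by congr (Ex P _); apply/funext => w; rewrite wsumS// addrA.
  have -> : Psi k = Ex P (fun w => G w * expR (- (v w * qsum b k.+1 K / 2)) *
     (expR (- (v w * (b k * r k) ^+ 2 / 2)) * cos (phi w + wsum b m k w))).
    congr (Ex P _); apply/funext => w; rewrite !mulrA; congr (_ * _); rewrite -!mulrA; congr (_ * _).
    by rewrite -expRD; congr expR; rewrite /qsum (big_ltn kK); field.
  apply => //.
  - by apply: bmfM; [exact: Hmono hG|exact: Hmono (hE _)].
  - by apply: bmfD; [exact: Hmono hphi|exact: bmf_wsum].
  - exact: Hmono hv.
  - by move=> w; rewrite normrM -[leRHS]mulr1; apply: ler_pM.
  - by apply: hdl; rewrite mk.
  - by apply: he; rewrite mk.
have := main K mK (leqnn _).
have -> : Psi K = Ex P (fun w => G w * cos (phi w + wsum b m K w)).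
  congr (Ex P _); apply/funext => w.
  by rewrite [X in v w * X]/qsum big_geq// mulr0 mul0r oppr0 expR0 mulr1.
have -> // : Psi m = Ex P (fun w => G w * (expR (- (v w * qsum b m K / 2)) * cos (phi w))).
by congr (Ex P _); apply/funext => w; rewrite wsum_nil addr0 mulrA.
Qed.

End martingale.

(** * Asymptotics of the step sizes *)

Lemma cvgn_le_near {R : realType} (u : nat -> R) (l b : R) : u n @[n --> \oo] --> l ->
  (\forall n \near \oo, u n <= b) -> l <= b.
Proof.
move=> ul h; rewrite -(cvg_lim _ ul)//; apply: limr_le => //.
by apply/cvg_ex; exists l.
Qed.

Lemma cvgn_ge_near {R : realType} (u : nat -> R) (l b : R) : u n @[n --> \oo] --> l ->
  (\forall n \near \oo, b <= u n) -> b <= l.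
Proof.
move=> ul h; rewrite -(cvg_lim _ ul)//; apply: limr_ge => //.
by apply/cvg_ex; exists l.
Qed.

Lemma cvgn_near_eq {R : realType} (u v : nat -> R) (l : R) :
  (\forall n \near \oo, u n = v n) -> v n @[n --> \oo] --> l -> u n @[n --> \oo] --> l.
Proof.
move=> h vl; apply/cvgrPdist_le => e e0; move/cvgrPdist_le : vl => /(_ e e0) h1.
by near=> n; rewrite (near h n)//; near: n.
Unshelve. all: by end_near. Qed.

Section powR_facts.
Context {R : realType}.
Implicit Types x y a p : R.

Lemma powR_MVT x y a : 0 < x -> x < y ->
  exists2 z, x < z < y & y `^ a - x `^ a = a * z `^ (a - 1) * (y - x).
Proof.
move=> x0 xy.
have hd (z : R) : 0 < z -> is_derive z 1 (fun x : R => x `^ a) (a * z `^ (a - 1)) by move=> z0; exact: is_derive1_powR.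
have hd' (z : R) : z \in `]x, y[ -> is_derive z 1 (fun x : R => x `^ a) (a * z `^ (a - 1)).
  by rewrite in_itv/= => /andP[xz _]; apply: hd; exact: lt_trans xz.
have hc : {within `[x, y], continuous (fun x : R => x `^ a)}.
  apply: derivable_within_continuous => z; rewrite in_itv/= => /andP[xz _].
  by have [] := hd z (lt_le_trans x0 xz).
by have [z + E] := MVT xy hd' hc; rewrite in_itv/= => hz; exists z.
Qed.

Lemma powR_le2 x y p : 0 <= p -> 0 <= x -> x <= y -> x `^ p <= y `^ p.
Proof.
move=> p0 x0 xy; apply: (@ge0_ler_powR _ p p0 x y) => //; rewrite nnegrE//.
exact: le_trans xy.
Qed.

Lemma powR_le0 x y a : 0 < x -> x <= y -> a <= 0 -> y `^ a <= x `^ a.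
Proof.
move=> x0 xy a0; have y0 := lt_le_trans x0 xy.
have E z : z `^ a = (z `^ (- a))^-1 by rewrite -powRN opprK.
rewrite !E lef_pV2 ?posrE ?powR_gt0//.
by apply: powR_le2; rewrite ?oppr_ge0// ltW.
Qed.

Lemma powR_diff_neg x p : 0 < x -> 0 < p ->
  p * (x + 1) `^ (- p - 1) <= x `^ (- p) - (x + 1) `^ (- p) <= p * x `^ (- p - 1).
Proof.
move=> x0 p0; have xx1 : x < x + 1 by lra.
have [z /andP[xz zx] E] := powR_MVT (- p) x0 xx1.
have -> : x `^ (- p) - (x + 1) `^ (- p) = p * z `^ (- p - 1).
  by rewrite -[LHS]opprB E; ring.
by apply/andP; split; rewrite ler_wpM2l ?(ltW p0)// powR_le0//; lra.
Qed.

Lemma powR_diff_pos (k : nat) p : 0 < p <= 1 ->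
  p * k.+1%:R `^ (p - 1) <= k.+1%:R `^ p - (k%:R : R) `^ p.
Proof.
move=> /andP[p0 p1]; case: k => [|k].
  by rewrite powR0 ?gt_eqF// !powR1 subr0; lra.
have k0 : (0 : R) < k.+1%:R by rewrite ltr0n.
have kk : (k.+1%:R : R) < k.+2%:R by rewrite ltr_nat.
have [z /andP[xz zx] ->] := powR_MVT p k0 kk.
have -> : (k.+2%:R - k.+1%:R : R) = 1 by rewrite -natrB// subSnn.
rewrite mulr1 ler_wpM2l ?(ltW p0)// powR_le0//; lra.
Qed.

Lemma cvg_powR_pos (u : nat -> R) (l p : R) : 0 < l -> u n @[n --> \oo] --> l ->
  u n `^ p @[n --> \oo] --> l `^ p.
Proof.
move=> l0 ul.
have hc : {for l, continuous (fun x : R => x `^ p)}.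
  apply: differentiable_continuous; apply/derivable1_diffP.
  by apply: derivable_powR; rewrite in_itv/= l0.
exact: (cvg_comp u (fun x : R => x `^ p) ul hc).
Qed.

Lemma cvg_nat_powRN p : 0 < p -> (n%:R : R) `^ (- p) @[n --> \oo] --> 0.
Proof.
move=> p0; apply/cvgrPdist_le => e e0; near=> n.
have n0 : (0 : R) < n%:R by rewrite ltr0n; near: n; exact: nbhs_infty_gt.
rewrite sub0r normrN ger0_norm ?powR_ge0// powRN.
rewrite -[leRHS]invrK lef_pV2 ?posrE ?powR_gt0 ?invr_gt0//.
have h : e^-1 `^ p^-1 <= n%:R by near: n; exact: nbhs_infty_ger.
have := powR_le2 (ltW p0) (powR_ge0 _ _) h.
by rewrite -powRrM mulVf ?gt_eqF// powRr1// invr_ge0 ltW.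
Unshelve. all: by end_near. Qed.

Lemma truncn_mul_cvg (t : R) : 0 <= t -> (truncn (n%:R * t))%:R / n%:R @[n --> \oo] --> t.
Proof.
move=> t0; apply/cvgrPdist_le => e e0; near=> n.
have n0 : (0 : R) < n%:R by rewrite ltr0n; near: n; exact: nbhs_infty_gt.
have nt0 : 0 <= n%:R * t by rewrite mulr_ge0.
have /andP[h1 h2] := truncn_itv nt0.
rewrite -natr1 in h2.
have -> : t - (truncn (n%:R * t))%:R / n%:R = (n%:R * t - (truncn (n%:R * t))%:R) / n%:R.
  by field; rewrite gt_eqF.
rewrite normrM normfV (gtr0_norm n0) ler_pdivrMr// ger0_norm ?subr_ge0//.
apply: (@le_trans _ _ 1); first by lra.
rewrite mulrC -ler_pdivrMr// div1r; near: n; exact: nbhs_infty_ger.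
Unshelve. all: by end_near. Qed.

Lemma truncn_mul_infty (t : R) (A : nat) : 0 < t -> \forall n \near \oo, (A <= truncn (n%:R * t))%N.
Proof.
move=> t0; near=> n.
rewrite truncn_ge_nat ?mulr_ge0 ?(ltW t0)// -ler_pdivrMr//; near: n; exact: nbhs_infty_ger.
Unshelve. all: by end_near. Qed.

End powR_facts.

Section step_sizes.
Context {R : realType} (r : nat -> R) (g c : R).
Hypothesis r01 : forall n, 0 <= r n < 1.
Hypothesis g_range : 2^-1 < g <= 1.
Hypothesis c_gt0 : 0 < c.
Hypothesis r_cvg : n%:R `^ g * r n @[n --> \oo] --> c.
(** [r_k ^ 2] is asymptotic to [c ^ 2 k ^ (- p - 1)], so its tail sums behave like
    [(c ^ 2 / p) m ^ (- p)], with [0 < p <= 1]. *)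
Let p := 2 * g - 1.

Lemma p_range : 0 < p <= 1.
Proof. by rewrite /p; move: g_range => /andP[? ?]; apply/andP; split; lra. Qed.
Let p0 : 0 < p. Proof. by have /andP[] := p_range. Qed.
Let p1 : p <= 1. Proof. by have /andP[] := p_range. Qed.

Lemma r2_cvg : n%:R `^ (p + 1) * r n ^+ 2 @[n --> \oo] --> c ^+ 2.
Proof.
have -> : (fun n : nat => n%:R `^ (p + 1) * r n ^+ 2) = (fun n => (n%:R `^ g * r n) * (n%:R `^ g * r n)).
  apply/funext => n; have -> : p + 1 = g * 2%:R by rewrite /p; lra.
  by rewrite powRrM powR_mulrn ?powR_ge0//; ring.
by rewrite expr2; exact: cvgM.
Qed.

Lemma r2_bound : exists2 C : R, 0 < C & forall k, r k ^+ 2 <= C * k.+1%:R `^ (- p - 1).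
Proof.
have q0 : 0 < p := p0; have q1 : p <= 1 := p1.
have /cvgrPdist_le /(_ 1 ltr01) [K0 _ hK] := r2_cvg.
(* The second term pays for the indices [k <= K0], where only [r k ^ 2 <= 1] is known; the 4 is
   [2 ^ 2], from [k + 1 <= 2 k] and [p + 1 <= 2]. *)
exists (4 * (c ^+ 2 + 1) + K0.+1%:R `^ (p + 1)).
  have := powR_ge0 (K0.+1%:R : R) (p + 1); have := sqr_ge0 c; lra.
have E x : 0 < x -> x `^ (- p - 1) = (x `^ (p + 1))^-1 :> R.
  by move=> x0; rewrite -powRN; congr (_ `^ _); lra.
move=> k; have k1 : (0 : R) < k.+1%:R by rewrite ltr0n.
have [kK|kK] := leqP K0.+1 k; last first.
  have /andP[r0 r1] := r01 k.
  have h1 : 1 <= K0.+1%:R `^ (p + 1) * k.+1%:R `^ (- p - 1).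
    rewrite E// ler_pdivlMr ?powR_gt0// mul1r; apply: powR_le2; [lra|exact: ltW|by rewrite ler_nat].
  have h2 : r k ^+ 2 <= 1 by rewrite expr_le1// ltW.
  have h3 : 0 <= 4 * (c ^+ 2 + 1) * k.+1%:R `^ (- p - 1).
    by rewrite mulr_ge0 ?powR_ge0// mulr_ge0// addr_ge0// sqr_ge0.
  by rewrite mulrDl; lra.
have k0 : (0 : R) < k%:R by rewrite ltr0n; exact: leq_trans kK.
have := hK k (ltnW kK); rewrite /= distrC => h.
have {}h : k%:R `^ (p + 1) * r k ^+ 2 <= c ^+ 2 + 1.
  by have := le_trans (ler_norm _) h; lra.
have h1 : r k ^+ 2 <= (c ^+ 2 + 1) * k%:R `^ (- p - 1).
  by rewrite E// ler_pdivlMr ?powR_gt0// mulrC.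
have h2 : k%:R `^ (- p - 1) <= 4 * k.+1%:R `^ (- p - 1).
  rewrite !E// ler_pdivlMr ?powR_gt0// mulrC ler_pdivrMr ?powR_gt0//.
  apply: (@le_trans _ _ ((2 * k%:R) `^ (p + 1))).
    apply: powR_le2; [lra|exact: ltW|].
    by rewrite -natrM ler_nat; lia.
  rewrite powRM ?(ltW k0)// ler_wpM2r ?powR_ge0//.
  apply: (@le_trans _ _ (2 `^ 2%:R)); first by apply: ler_powR; lra.
  by rewrite powR_mulrn//; lra.
apply: le_trans h1 _; rewrite mulrDl.
have := powR_ge0 (K0.+1%:R : R) (p + 1); have := powR_ge0 (k.+1%:R : R) (- p - 1).
have := sqr_ge0 c => c20 a0 b0.
have : (c ^+ 2 + 1) * k%:R `^ (- p - 1) <= (c ^+ 2 + 1) * (4 * k.+1%:R `^ (- p - 1)).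
  by rewrite ler_wpM2l//; lra.
have : 0 <= K0.+1%:R `^ (p + 1) * k.+1%:R `^ (- p - 1) by exact: mulr_ge0.
lra.
Qed.

Definition psum (L : nat) : R := \sum_(0 <= k < L) r k ^+ 2.

Lemma psumB m L : (m <= L)%N -> psum L - psum m = \sum_(m <= k < L) r k ^+ 2.
Proof.
by move=> mL; rewrite /psum (big_cat_nat _ (n := m))//= addrAC subrr add0r.
Qed.

(** The comparison with differences of [k ^ (- p)] must avoid [k = 0], so [key] starts at [m.+1];
    the index is restored by [m + 2 <= 2 (m + 1)], at the price of a factor 2, and the first term is
    bounded separately. *)
Lemma psum_bound : exists2 C : R, 0 < C & forall m L, (m <= L)%N ->
  psum L - psum m <= C * m.+1%:R `^ (- p).
Proof.
have q0 : 0 < p := p0; have q1 : p <= 1 := p1.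
have [C C0 hC] := r2_bound.
have key m L : (m.+1 <= L)%N -> psum L - psum m.+1 <= C / p * m.+1%:R `^ (- p).
  move=> mL; rewrite psumB//.
  apply: (@le_trans _ _ (\sum_(m.+1 <= k < L) (C / p * (k%:R `^ (- p) - k.+1%:R `^ (- p))))).
    rewrite big_nat [leRHS]big_nat; apply: ler_sum => k /andP[mk kL].
    apply: le_trans (hC k) _.
    have k0 : (0 : R) < k%:R by rewrite ltr0n; exact: leq_trans mk.
    have /andP[h _] := powR_diff_neg k0 p0.
    rewrite natr1 in h.
    by rewrite -mulrA ler_pM2l// mulrC ler_pdivlMr// mulrC.
  rewrite -mulr_sumr ler_wpM2l ?divr_ge0 ?(ltW C0) ?(ltW p0)//.
  have -> : \sum_(m.+1 <= k < L) (k%:R `^ (- p) - k.+1%:R `^ (- p)) = m.+1%:R `^ (- p) - (L%:R : R) `^ (- p).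
    rewrite -[RHS]opprB -(@telescope_sumr _ m.+1 L (fun k => (k%:R : R) `^ (- p)) mL) -sumrN; apply: eq_bigr => k _; lra.
  by have := powR_ge0 (L%:R : R) (- p); lra.
have Cp0 : 0 < C / p by exact: divr_gt0.
exists (C + 2 * (C / p)); first by lra.
case=> [|m] L mL.
  rewrite powR1 mulr1; case: L mL => [|L] _; first by rewrite subrr; lra.
  have := key 0%N L.+1 isT; rewrite powR1 mulr1.
  have : psum 1 - psum 0 <= C.
    rewrite psumB// big_nat1; apply: le_trans (hC 0%N) _; by rewrite powR1 mulr1.
  lra.
apply: le_trans (key m L mL) _.
have m0 : (0 : R) < m.+1%:R by rewrite ltr0n.
have m1 : (0 : R) < m.+2%:R by rewrite ltr0n.
have h : m.+1%:R `^ (- p) <= 2 * (m.+2%:R : R) `^ (- p).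
  rewrite !powRN ler_pdivlMr ?powR_gt0// mulrC ler_pdivrMr ?powR_gt0//.
  apply: (@le_trans _ _ ((2 * m.+1%:R) `^ p)).
    apply: powR_le2; [exact: ltW|exact: ltW|].
    by rewrite -natrM ler_nat; lia.
  rewrite powRM ?(ltW m0)// ler_wpM2r ?powR_ge0//.
  by apply: ler1_powR; lra.
have : C / p * m.+1%:R `^ (- p) <= C / p * (2 * m.+2%:R `^ (- p)) by rewrite ler_pM2l.
have : 0 <= C * m.+2%:R `^ (- p) by rewrite mulr_ge0 ?powR_ge0// ltW.
rewrite mulrDl; lra.
Qed.

Lemma psum_nd : nondecreasing_seq psum.
Proof.
move=> m n mn; rewrite -subr_ge0 psumB// sumr_ge0// => k _; exact: sqr_ge0.
Qed.

Lemma is_cvg_psum : cvgn psum.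
Proof.
apply: nondecreasing_is_cvgn; first exact: psum_nd.
have [C C0 hC] := psum_bound.
exists C => _ [n _ <-]; have := hC 0%N n (leq0n _).
by rewrite powR1 mulr1 {2}/psum big_geq// subr0.
Qed.

Definition rtail (m : nat) : R := limn psum - psum m.

Lemma rtail_cvg m : psum L - psum m @[L --> \oo] --> rtail m.
Proof. by apply: cvgB; [exact: is_cvg_psum|exact: cvg_cst]. Qed.

Lemma rtail_sum m L : (m <= L)%N -> \sum_(m <= k < L) r k ^+ 2 = rtail m - rtail L.
Proof. by move=> mL; rewrite -psumB// /rtail; lra. Qed.

Lemma rtail_ge0 m : 0 <= rtail m.
Proof.
by rewrite /rtail subr_ge0; apply: nondecreasing_cvgn_le; [exact: psum_nd|exact: is_cvg_psum].
Qed.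

Lemma rtail_bound : exists2 C : R, 0 < C & forall m, rtail m <= C * m.+1%:R `^ (- p).
Proof.
have [C C0 hC] := psum_bound; exists C => // m.
apply: (cvgn_le_near (@rtail_cvg m)); near=> L; apply: hC; near: L; exact: nbhs_infty_ge.
Unshelve. all: by end_near. Qed.

Lemma rtail_cvg0 : rtail m @[m --> \oo] --> 0.
Proof.
rewrite -[X in _ --> X](subrr (limn psum)).
by apply: cvgB; [exact: cvg_cst|exact: is_cvg_psum].
Qed.

(** Up to a factor close to 1, [r_k ^ 2] is [c ^ 2 / p] times a difference of consecutive
    [k ^ (- p)], and these telescope. The upper bound uses the preceding difference, hence it
    concerns [rtail K.+1]. *)
Lemma rtail_asymp : K%:R `^ p * rtail K @[K --> \oo] --> c ^+ 2 / p.
Proof.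
have q0 : 0 < p := p0; have q1 : p <= 1 := p1.
apply/cvgrPdist_le => e e0.
(* An error [d] in the constant costs [d / p = e / 2]; the term [r K ^ 2] missing from the upper
   bound costs at most [d <= e / 2]. *)
pose d := p * e / 2.
have d0 : 0 < d by rewrite /d divr_gt0// mulr_gt0.
have c20 := sqr_ge0 c.
have /cvgrPdist_le /(_ d d0) [K0 _ hK] := r2_cvg.
have E (x : R) : 0 < x -> x `^ (- p - 1) = (x `^ (p + 1))^-1.
  by move=> x0; rewrite -powRN; congr (_ `^ _); lra.
have rb k : (K0 < k)%N -> (c ^+ 2 - d) * k%:R `^ (- p - 1) <= r k ^+ 2 <= (c ^+ 2 + d) * k%:R `^ (- p - 1).
  move=> kK; have k0 : (0 : R) < k%:R by rewrite ltr0n; exact: leq_trans kK.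
  have := hK k (ltnW kK); rewrite /= ler_norml => /andP[h1 h2].
  by rewrite E// ler_pdivrMr ?ler_pdivlMr ?powR_gt0// ![r k ^+ 2 * _]mulrC; apply/andP; split; lra.
have tele m L : (m <= L)%N -> \sum_(m <= k < L) (k%:R `^ (- p) - k.+1%:R `^ (- p)) = m%:R `^ (- p) - (L%:R : R) `^ (- p).
  move=> mL; rewrite -[RHS]opprB -(@telescope_sumr _ m L (fun k => (k%:R : R) `^ (- p)) mL) -sumrN.
  by apply: eq_bigr => k _; lra.
have lo K : (K0 < K)%N -> (c ^+ 2 - d) / p * K%:R `^ (- p) <= rtail K.
  move=> KK.
  have h : (c ^+ 2 - d) / p * (K%:R `^ (- p) - L%:R `^ (- p)) @[L --> \oo] --> (c ^+ 2 - d) / p * (K%:R `^ (- p) - 0).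
    by apply: cvgM; [exact: cvg_cst|apply: cvgB; [exact: cvg_cst|exact: cvg_nat_powRN]].
  rewrite subr0 in h.
  have [cd|cd] := leP (c ^+ 2 - d) 0.
    apply: le_trans (rtail_ge0 K); rewrite mulr_le0_ge0 ?powR_ge0//.
    by rewrite mulr_le0_ge0// invr_ge0 ltW.
  apply: (cvgn_le_near h); near=> L.
  have KL : (K <= L)%N by near: L; exact: nbhs_infty_ge.
  apply: (@le_trans _ _ (psum L - psum K)); last first.
    by have := rtail_ge0 L; rewrite /rtail; lra.
  rewrite psumB// -(tele _ _ KL) mulr_sumr big_nat [leRHS]big_nat; apply: ler_sum => k /andP[kK kL].
  have kK0 := leq_trans KK kK.
  have k0 : (0 : R) < k%:R by rewrite ltr0n; exact: leq_trans kK0.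
  have /andP[h1 _] := rb k kK0.
  have /andP[_ h2] := powR_diff_neg k0 q0.
  rewrite natr1 in h2.
  apply: le_trans h1; rewrite -mulrA ler_pM2l// mulrC ler_pdivrMr// mulrC//.
have up K : (K0 < K)%N -> rtail K.+1 <= (c ^+ 2 + d) / p * K%:R `^ (- p).
  move=> KK; apply: (cvgn_le_near (@rtail_cvg K.+1)); near=> L.
  have KL : (K.+1 <= L)%N by near: L; exact: nbhs_infty_ge.
  have cdp : 0 <= (c ^+ 2 + d) / p by rewrite divr_ge0//; lra.
  apply: (@le_trans _ _ ((c ^+ 2 + d) / p * (K%:R `^ (- p) - L.-1%:R `^ (- p)))); last first.
    by rewrite ler_wpM2l// lerBlDr lerDl powR_ge0.
  have KL' : (K <= L.-1)%N by lia.
  rewrite psumB// -(tele _ _ KL') -{1}(prednK (leq_trans (ltn0Sn K) KL)) big_add1/= mulr_sumr.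
  rewrite big_nat [leRHS]big_nat; apply: ler_sum => k /andP[kK kL].
  have kK0 := leq_trans KK kK.
  have k0 : (0 : R) < k%:R by rewrite ltr0n; exact: leq_trans kK0.
  have /andP[_ h1] := rb k.+1 (leqW kK0).
  have /andP[h2 _] := powR_diff_neg k0 q0.
  rewrite natr1 in h2.
  apply: le_trans h1 _; rewrite -mulrA ler_pM2l; last lra.
  by rewrite mulrC ler_pdivlMr// mulrC.
near=> K.
have KK : (K0 < K)%N by near: K; exact: nbhs_infty_gt.
have k0 : (0 : R) < K%:R by rewrite ltr0n; exact: leq_trans KK.
have pk := powR_gt0 p k0.
have h1 := lo K KK; have h2 := up K KK.
have hr : rtail K = rtail K.+1 + r K ^+ 2.
  by rewrite /rtail /psum [in RHS]big_nat_recr//=; lra.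
have /andP[_ h3] := rb K KK.
have h4 : (c ^+ 2 + d) * K%:R `^ (- p - 1) <= d * K%:R `^ (- p).
  rewrite powRD; last by apply/implyP => _; rewrite gt_eqF.
  rewrite powR_inv1 ?(ltW k0)// mulrCA mulrC ler_wpM2r ?powR_ge0//.
  rewrite ler_pdivrMr// mulrC -ler_pdivrMr//; near: K; exact: nbhs_infty_ger.
have hN : K%:R `^ p * K%:R `^ (- p) = 1 :> R by rewrite powRN mulfV// gt_eqF.
have h5 : rtail K <= ((c ^+ 2 + d) / p + d) * K%:R `^ (- p) by rewrite mulrDl hr; lra.
have h6 : K%:R `^ p * rtail K <= (c ^+ 2 + d) / p + d.
  have := ler_wpM2l (ltW pk) h5; by rewrite mulrCA hN mulr1.
have h7 : (c ^+ 2 - d) / p <= K%:R `^ p * rtail K.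
  have := ler_wpM2l (ltW pk) h1; by rewrite mulrCA hN mulr1.
have hd : d / p = e / 2 by rewrite /d; field; rewrite gt_eqF.
have hd2 : d <= e / 2 by rewrite /d; nra.
rewrite ler_norml; move: h6 h7; rewrite !mulrDl mulNr hd => h6 h7.
by apply/andP; split; lra.
Unshelve. all: by end_near. Qed.

Lemma rtail_trunc (t : R) : 0 < t ->
  n%:R `^ p * rtail (truncn (n%:R * t)) @[n --> \oo] --> c ^+ 2 / p * t `^ (- p).
Proof.
move=> t0.
have h1 : ((truncn (n%:R * t))%:R / n%:R) `^ (- p) @[n --> \oo] --> t `^ (- p).
  by apply: cvg_powR_pos => //; apply: truncn_mul_cvg; exact: ltW.
have h2 : (truncn (n%:R * t))%:R `^ p * rtail (truncn (n%:R * t)) @[n --> \oo] --> c ^+ 2 / p.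
  apply/cvgrPdist_le => e e0; have /cvgrPdist_le /(_ e e0) [A _ hA] := rtail_asymp.
  by apply: filterS (truncn_mul_infty A t0) => n /hA.
have h3 := cvgM h2 h1.
apply: cvgn_near_eq; last exact: h3.
near=> n.
have n0 : (0 : R) < n%:R by rewrite ltr0n; near: n; exact: nbhs_infty_gt.
have tn0 : (0 : R) < (truncn (n%:R * t))%:R.
  by rewrite ltr0n; near: n; exact: truncn_mul_infty.
rewrite /= powRM ?invr_ge0 ?ltW// powRN -[n%:R^-1]powR_inv1 ?(ltW n0)// -powRrM mulN1r opprK.
by field; rewrite gt_eqF// powR_gt0.
Unshelve. all: by end_near. Qed.

(** Time [n * n] serves as infinity: the variance left after it is negligible at scale
    [n ^ (- p)]. *)
Lemma rtail_square : n%:R `^ p * rtail (n * n) @[n --> \oo] --> 0.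
Proof.
have [C C0 hC] := rtail_bound.
have h : C * n%:R `^ (- p) @[n --> \oo] --> C * 0 by apply: cvgM; [exact: cvg_cst|exact: cvg_nat_powRN].
rewrite mulr0 in h.
apply: (squeeze_cvgr _ (@cvg_cst _ 0 _ \oo _) h); near=> n.
have n0 : (0 : R) < n%:R by rewrite ltr0n; near: n; exact: nbhs_infty_gt.
have pn := powR_gt0 p n0.
rewrite mulr_ge0 ?rtail_ge0 ?powR_ge0//=.
apply: le_trans (ler_wpM2l (ltW pn) (hC _)) _.
rewrite mulrCA ler_pM2l// !powRN ler_pdivrMr ?powR_gt0 ?ltr0n//.
rewrite mulrC ler_pdivlMr// -powRM ?(ltW n0)//; apply: powR_le2; rewrite ?(ltW p0) ?mulr_ge0//.
by rewrite -natrM ler_nat.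
Unshelve. all: by end_near. Qed.

(** The weights turn the summands into [k.+1 ^ (p - 1)], compared with differences of [k ^ p]. This
    is the variance budget of the maximal inequality near [t = 0]. *)
Lemma weighted_sum_bound : exists2 C : R, 0 < C & forall K,
  \sum_(0 <= k < K) (k.+1%:R `^ p * r k) ^+ 2 <= C * K%:R `^ p.
Proof.
have q0 : 0 < p := p0; have q1 : p <= 1 := p1.
have [C C0 hC] := r2_bound; exists (C / p); first by rewrite divr_gt0.
move=> K.
apply: (@le_trans _ _ (\sum_(0 <= k < K) (C / p * (k.+1%:R `^ p - k%:R `^ p)))).
  apply: ler_sum => k _.
  have k0 : (0 : R) < k.+1%:R by rewrite ltr0n.
  have h := @powR_diff_pos R k p p_range.
  rewrite exprMn; apply: le_trans (ler_wpM2l _ (hC k)) _; first exact: sqr_ge0.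
  have E : (k.+1%:R `^ p) ^+ 2 * k.+1%:R `^ (- p - 1) = k.+1%:R `^ (p - 1) :> R.
    rewrite -powR_mulrn ?powR_ge0// -powRrM -powRD; last by apply/implyP => _; rewrite gt_eqF.
    by congr (_ `^ _); lra.
  by rewrite mulrCA E -mulrA ler_pM2l// [leRHS]mulrC ler_pdivlMr// mulrC.
rewrite -mulr_sumr (@telescope_sumr _ 0%N K (fun k => (k%:R : R) `^ p))// powR0 ?gt_eqF// subr0//.
Qed.

(** Past a fixed fraction of [n], one rescaled step has variance of order [1 / n]. This gives both
    the smallness of single steps in the central limit theorem and the variance of a block of the
    grid. *)
Lemma rstep_trunc (t : R) : 0 < t -> exists2 C : R, 0 < C &
  forall n k, (0 < n)%N -> (truncn (n%:R * t) <= k)%N -> n%:R `^ p * r k ^+ 2 <= C / n%:R.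
Proof.
move=> t0; have q0 : 0 < p := p0.
have [C C0 hC] := r2_bound; exists (C * t `^ (- p - 1)); first by rewrite mulr_gt0 ?powR_gt0.
move=> n k n0 hk; have nR : (0 : R) < n%:R by rewrite ltr0n.
have hnt : n%:R * t <= k.+1%:R.
  have := truncnS_gt (n%:R * t) => /ltW h; apply: le_trans h _; by rewrite ler_nat.
apply: le_trans (ler_wpM2l (powR_ge0 _ _) (hC k)) _.
have h : k.+1%:R `^ (- p - 1) <= (n%:R * t) `^ (- p - 1) by apply: powR_le0 => //; [exact: mulr_gt0|lra].
rewrite mulrCA -!mulrA ler_pM2l//; apply: le_trans (ler_wpM2l (powR_ge0 _ _) h) _.
rewrite powRM ?(ltW nR) ?(ltW t0)// mulrA -powRD; last by apply/implyP => _; rewrite gt_eqF.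
have -> : p + (- p - 1) = - 1 by lra.
by rewrite powR_inv1 ?(ltW nR)// mulrC.
Qed.

(** As [g <= 1], eventually [r_k >= c / (2 k)], so by the divergence of the harmonic series bounded
    sums of [r_k x_k] forbid [x_k >= e] for all large [k]. *)
Lemma rsum_dvg (x : nat -> R) (A : R) : (forall L, \sum_(0 <= k < L) r k * x k <= A) ->
  (forall k, 0 <= x k) -> forall e : R, 0 < e -> forall m, exists2 k, (m <= k)%N & x k < e.
Proof.
move=> hA x0 e e0 m; apply: contrapT => hn.
have xe k : (m <= k)%N -> e <= x k.
  by move=> mk; rewrite leNgt; apply/negP => xk; apply: hn; exists k.
have c2 : 0 < c / 2 by rewrite divr_gt0.
have /cvgrPdist_le /(_ _ c2) [K0 _ hK] := r_cvg.
have /andP[_ g1] := g_range.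
pose m' := (maxn m K0).+1.
have rk k : (m' <= k)%N -> c / 2 / k%:R <= r k.
  move=> mk; have k1 : (1 : R) <= k%:R by rewrite ler1n; exact: leq_trans mk.
  have k0 : (0 : R) < k%:R by exact: lt_le_trans k1.
  have K0k : (K0 <= k)%N by apply: leq_trans mk; rewrite /m' leqW// leq_maxr.
  have := hK k K0k; rewrite /= ler_norml => /andP[_ h].
  have h1 : c / 2 <= k%:R `^ g * r k by lra.
  rewrite ler_pdivrMr//; apply: le_trans h1 _; rewrite mulrC ler_wpM2l//; first by have /andP[] := r01 k.
  exact: ler1_powR.
have hs L : (m' <= L)%N -> c / 2 * e * \sum_(m' <= k < L) (k%:R)^-1 <= A.
  move=> mL; apply: le_trans (hA L).
  rewrite mulr_sumr [leRHS](big_cat_nat _ (n := m'))//=.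
  apply: (@le_trans _ _ (\sum_(m' <= i < L) r i * x i)); last first.
    by rewrite lerDr sumr_ge0// => k _; rewrite mulr_ge0//; have /andP[] := r01 k.
  rewrite big_nat [leRHS]big_nat; apply: ler_sum => k /andP[mk kL].
  have -> : c / 2 * e * k%:R^-1 = (c / 2 / k%:R) * e by ring.
  apply: ler_pM; rewrite ?(ltW e0)//; first by rewrite divr_ge0// ltW.
  - exact: rk.
  - by apply: xe; apply: leq_trans mk; rewrite /m' leqW// leq_maxl.
have := @dvg_harmonic R; apply.
have ndh : nondecreasing_seq (series (@harmonic R)).
  by apply/nondecreasing_seqP => n; rewrite /series/= big_nat_recr//= lerDl /harmonic/= invr_ge0.
apply: nondecreasing_is_cvgn => //.
exists (A / (c / 2 * e) + series harmonic m') => _ [L _ <-].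
have ce : 0 < c / 2 * e by rewrite mulr_gt0.
have [mL|mL] := leqP m' L; last first.
  apply: (@le_trans _ _ (series harmonic m')); first exact/ndh/ltnW.
  rewrite lerDr divr_ge0// ?(ltW ce)//; apply: le_trans (hA 0%N); by rewrite big_geq.
rewrite [series harmonic L]/series/= (big_cat_nat _ (n := m'))//= addrC lerD2r.
rewrite ler_pdivlMr// mulrC; apply: le_trans (hs L.+1 (leqW mL)).
rewrite ler_pM2l// (@le_trans _ _ (\sum_(m'.+1 <= k < L.+1) k%:R^-1))//.
  by rewrite [leRHS]big_add1.
rewrite [leRHS]big_ltn ?ltnS//; by rewrite lerDr invr_ge0.
Qed.

End step_sizes.

(** * Fluctuations around the limit *)

Section limit.
Context {R : realType} {d : measure_display} {Om : measurableType d}.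
Context (P : probability Om R) (hg : nat -> set (set Om)).
Context (M cv : nat -> Om -> R) (r : nat -> R) (N : nat) (g c : R) (ML : Om -> R).
Local Notation H n := (g_sigma_algebraType (hg n)).
Hypothesis HH : controlled_martingale P hg M cv r.
Hypothesis N_gt0 : (0 < N)%N.
Hypothesis r01 : forall n, 0 <= r n < 1.
Hypothesis g_range : 2^-1 < g <= 1.
Hypothesis c_gt0 : 0 < c.
Hypothesis r_cvg : n%:R `^ g * r n @[n --> \oo] --> c.
Hypothesis M01 : forall n w, 0 <= M n w <= 1.
Hypothesis ML01 : forall w, 0 <= ML w <= 1.
Hypothesis mML : measurable_fun setT ML.
Hypothesis cvgML : {ae P, forall w, M n w @[n --> \oo] --> ML w}.
Definition vproc (x : R) : R := x * (1 - x) / N%:R.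
Hypothesis Hcvv : Ex P (fun w => `|cv n w - vproc (M n w)|) @[n --> \oo] --> 0.
Let p := 2 * g - 1.
Local Notation tl := (rtail r).

Let p0 : 0 < p. Proof. by have /andP[] := p_range g_range. Qed.
Let N1 : (1 : R) <= N%:R. Proof. by rewrite ler1n. Qed.
Let N0 : (0 : R) < N%:R. Proof. by rewrite ltr0n. Qed.

Lemma bmf_mart n : bmf (M n). Proof. exact: (cm_sub HH) (cm_M HH n). Qed.

Lemma bmfML : bmf ML. Proof. exact: bmf_bounded mML ML01. Qed.

Lemma vproc01 x : 0 <= x <= 1 -> 0 <= vproc x <= 1.
Proof.
move=> /andP[x0 x1]; rewrite /vproc divr_ge0 ?(ltW N0) ?mulr_ge0 ?subr_ge0//=.
by rewrite ler_pdivrMr// mul1r; apply: le_trans N1; nra.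
Qed.

Lemma vproc_lip x y : 0 <= x <= 1 -> 0 <= y <= 1 -> `|vproc x - vproc y| <= `|x - y|.
Proof.
move=> /andP[x0 x1] /andP[y0 y1].
have -> : vproc x - vproc y = (x - y) * ((1 - x - y) / N%:R) by rewrite /vproc; ring.
rewrite normrM ler_piMr// normrM normfV (gtr0_norm N0) ler_pdivrMr// mul1r.
by apply: le_trans N1; rewrite ler_norml; apply/andP; split; lra.
Qed.

Lemma hist_vproc n : @bmf R _ (H n) (fun w => vproc (M n w)).
Proof.
apply: bmfZr; apply: bmfM; first exact: (cm_M HH).
by apply: bmfB; [exact: bmf_cst|exact: (cm_M HH)].
Qed.

Lemma Ex_M2 m K : (m <= K)%N -> Ex P (fun w => (M K w - M m w) ^+ 2) <= tl m.
Proof.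
move=> mK; have := Ex_wsum2 HH (fun=> 1) mK.
under eq_fun do rewrite wsum1//.
move=> h; apply: le_trans h _; rewrite /qsum; under eq_bigr do rewrite mul1r.
rewrite rtail_sum//; have := rtail_ge0 r01 g_range c_gt0 r_cvg K; lra.
Qed.

Lemma Ex_ML2 m : Ex P (fun w => (ML w - M m w) ^+ 2) <= tl m.
Proof.
have hc : Ex P (fun w => (M K w - M m w) ^+ 2) @[K --> \oo] --> Ex P (fun w => (ML w - M m w) ^+ 2).
  apply: (@Ex_cvg _ _ _ _ _ _ 1).
  - by move=> K; case: (bmfX 2 (bmfB (bmf_mart K) (bmf_mart m))).
  - by case: (bmfX 2 (bmfB bmfML (bmf_mart m))).
  - move=> K w; have /andP[? ?] := M01 K w; have /andP[? ?] := M01 m w.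
    rewrite ger0_norm ?sqr_ge0//; nra.
  - apply: filterS cvgML => w hw.
    by rewrite !expr2; apply: cvgM; apply: cvgB => //; exact: cvg_cst.
apply: (cvgn_le_near hc); near=> K; apply: Ex_M2; near: K; exact: nbhs_infty_ge.
Unshelve. all: by end_near. Qed.

Lemma Ex_normM m K (e : R) : (m <= K)%N -> 0 < e -> Ex P (fun w => `|M K w - M m w|) <= e + tl m / e.
Proof.
move=> mK e0; have h := Ex_cauchy_schwarz1 P (bmfB (bmf_mart K) (bmf_mart m)) e0.
apply: le_trans h _; rewrite lerD2l ler_pM2r ?invr_gt0//; exact: Ex_M2.
Qed.

Lemma Ex_normML m (e : R) : 0 < e -> Ex P (fun w => `|ML w - M m w|) <= e + tl m / e.
Proof.
move=> e0; have h := Ex_cauchy_schwarz1 P (bmfB bmfML (bmf_mart m)) e0.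
apply: le_trans h _; rewrite lerD2l ler_pM2r ?invr_gt0//; exact: Ex_ML2.
Qed.

Let tl0 : tl m @[m --> \oo] --> 0.
Proof. exact: rtail_cvg0 r01 g_range c_gt0 r_cvg. Qed.

(** [vproc] is 1-Lipschitz on [0, 1] and [M] moves little in mean after a late time [m]: one frozen
    variance serves for all [k >= m]. *)
Lemma cvar_close (e : R) : 0 < e -> \forall m \near \oo, forall k, (m <= k)%N ->
  Ex P (fun w => `|cv k w - vproc (M m w)|) <= e.
Proof.
move=> e0.
have e3 : 0 < e / 3 by rewrite divr_gt0.
have [K _ hK] := (cvgrPdist_le _ _).1 Hcvv _ e3.
have e32 : 0 < (e / 3) ^+ 2 by rewrite exprn_gt0.
have [L _ hL] := (cvgrPdist_le _ _).1 tl0 _ e32.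
near=> m => k mk.
have Km : (K <= m)%N by near: m; exact: nbhs_infty_ge.
have Lm : (L <= m)%N by near: m; exact: nbhs_infty_ge.
have := hK k (leq_trans Km mk); rewrite /= sub0r normrN ger0_norm; last by apply: Ex_ge0.
move=> h1; have := hL m Lm; rewrite /= sub0r normrN => /(le_trans (ler_norm _)) h2.
have bv n : bmf (fun w => vproc (M n w)) := cm_sub HH (hist_vproc n).
have bc n : bmf (cv n) := cm_sub HH (cm_cv HH n).
apply: (@le_trans _ _ (Ex P (fun w => `|cv k w - vproc (M k w)| + `|M k w - M m w|))).
  apply: le_Ex; first by apply: bmf_norm; exact: bmfB.
    by apply: bmfD; apply: bmf_norm; apply: bmfB => //; exact: bmf_mart.
  move=> w; apply: le_trans (ler_distD (vproc (M k w)) _ _) _; rewrite lerD2l.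
  exact: vproc_lip.
rewrite ExD; [|by apply: bmf_norm; exact: bmfB|by apply: bmf_norm; apply: bmfB; exact: bmf_mart].
have h3 := Ex_normM mk e3.
have : tl m / (e / 3) <= e / 3 by rewrite ler_pdivrMr// -expr2.
lra.
Unshelve. all: by end_near. Qed.

(** What a use has to provide: starting times tending to infinity, a bounded total variance, and a
    largest weighted step tending to 0. *)
Lemma clt_limit (b : nat -> nat -> R) (m K : nat -> nat) (G phi : nat -> Om -> R) (CG Q : R)
    (e_ : nat -> R) :
  (forall A : nat, \forall n \near \oo, (A <= m n)%N) ->
  (\forall n \near \oo, (m n <= K n)%N) ->
  (forall n, @bmf R _ (H (m n)) (G n)) -> (forall n, @bmf R _ (H (m n)) (phi n)) ->
  (forall n w, `|G n w| <= CG) ->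
  (\forall n \near \oo, qsum r (b n) (m n) (K n) <= Q) ->
  (\forall n \near \oo, forall k, (m n <= k)%N -> `|b n k| * r k <= e_ n) ->
  e_ n @[n --> \oo] --> 0 ->
  Ex P (fun w => G n w * cos (phi n w + wsum M (b n) (m n) (K n) w)) -
  Ex P (fun w => G n w * (expR (- (vproc (M (m n) w) * qsum r (b n) (m n) (K n) / 2)) * cos (phi n w)))
  @[n --> \oo] --> 0.
Proof.
move=> minf mK hG hphi GC hQ he ecvg.
have CG0 : 0 <= CG := le_trans (normr_ge0 _) (GC 0%N point).
apply/cvgrPdist_le => e e0.
have C0 : 0 < CG * (`|Q| + 1) * 4 + 1.
  have := normr_ge0 Q => ?; have : 0 <= CG * (`|Q| + 1) by rewrite mulr_ge0//; lra.
  lra.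
pose d0 := minr 1 (e / (CG * (`|Q| + 1) * 4 + 1)).
have d00 : 0 < d0 by rewrite lt_min ltr01 divr_gt0.
have [A _ hA] := cvar_close d00.
have /cvgrPdist_le /(_ _ d00) hd := ecvg.
near=> n.
have mKn : (m n <= K n)%N by near: n.
have An : (A <= m n)%N by near: n; exact: minf.
have hen : forall k, (m n <= k)%N -> `|b n k| * r k <= e_ n by near: n.
have h1 : `|0 - e_ n| <= d0 by near: n.
have h2 : e_ n <= d0 by move: h1; rewrite sub0r normrN; exact: le_trans (ler_norm _).
have hQn : qsum r (b n) (m n) (K n) <= Q by near: n.
rewrite sub0r normrN.
have := @clt_bound _ _ _ P hg M cv r HH (b n) (m n) (K n) (G n) (phi n) (fun w => vproc (M (m n) w)) CG d0 d0 mKn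
  (hG n) (hphi n) (hist_vproc _) (fun w => vproc01 (M01 _ w)) (GC n).
move=> h; apply: le_trans (h _ _ _) _.
- by move=> k /andP[mk _]; apply: (hA (m n)).
- by move=> k /andP[mk _]; apply: le_trans h2; exact: hen.
- by rewrite ge_min lexx.
have q0 := qsum_ge0 r (b n) (m n) (K n).
have qQ : qsum r (b n) (m n) (K n) <= `|Q| + 1.
  by have := le_trans hQn (ler_norm Q); lra.
have d1 : d0 <= e / (CG * (`|Q| + 1) * 4 + 1) by rewrite ge_min lexx orbT.
apply: (@le_trans _ _ (CG * ((`|Q| + 1) * (4 * d0)))).
  rewrite ler_wpM2l//; have -> : d0 + 3 * d0 = 4 * d0 by ring.
  by rewrite ler_wpM2r// mulr_ge0// ltW.
move: d1; rewrite ler_pdivlMr// => d1; nra.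
Unshelve. all: by end_near. Qed.

Definition gfun (x : R) := x * (1 - x).

(** The reason for the weight [gfun]: the Gaussian factor does not decay where the variance
    degenerates, but multiplied by [x], here the value of [Z_m (1 - Z_m)], it is at most [1 / q]
    uniformly. *)
Lemma expR_mulN_le (x q : R) : 0 <= x -> 0 < q -> x * expR (- (x * q)) <= q^-1.
Proof.
move=> x0 q0; rewrite expRN ler_pdivrMr ?expR_gt0// mulrC ler_pdivlMr//.
by have := expR_ge1Dx (x * q); lra.
Qed.

Lemma gfun_lip x y : 0 <= x <= 1 -> 0 <= y <= 1 -> `|gfun x - gfun y| <= `|x - y|.
Proof.
move=> /andP[x0 x1] /andP[y0 y1].
have -> : gfun x - gfun y = (x - y) * (1 - x - y) by rewrite /gfun; ring.
by rewrite normrM ler_piMr// ler_norml; apply/andP; split; lra.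
Qed.

Lemma norm_cosB (x y : R) : `|cos x - cos y| <= `|x - y|.
Proof.
have [xy|xy|->] := ltgtP x y; last by rewrite !subrr.
- have [z _] := MVT xy (fun z _ => is_derive_cos z) (continuous_subspaceT (@continuous_cos R)).
  rewrite -normrN opprB => ->; rewrite normrM [`|x - y|]distrC ler_piMl// normrN.
  by rewrite ler_norml sin_geN1 sin_le1.
- have [z _] := MVT xy (fun z _ => is_derive_cos z) (continuous_subspaceT (@continuous_cos R)).
  move=> ->; rewrite normrM ler_piMl// normrN.
  by rewrite ler_norml sin_geN1 sin_le1.
Qed.

Lemma eq_ler (x y : R) : x = y -> x <= y. Proof. by move=> ->. Qed.

Lemma wsum_cst (a : R) m K w : (m <= K)%N -> wsum M (fun=> a) m K w = a * (M K w - M m w).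
Proof.
by move=> mK; rewrite -(wsum1 M w mK) /wsum mulr_sumr; apply: eq_bigr => k _; rewrite mul1r.
Qed.

Lemma qsum_cst (a : R) m K : (m <= K)%N -> qsum r (fun=> a) m K = a ^+ 2 * (tl m - tl K).
Proof.
move=> mK; rewrite -rtail_sum// /qsum mulr_sumr; apply: eq_bigr => k _; exact: exprMn.
Qed.

(* The mass that [Z (1 - Z) dP] gives to points has a Fourier transform vanishing
   at infinity: at frequency [j], freeze the process at a time [m ~ (j / lam)^(2/p)]
   so that the remaining fluctuation has conditional variance of order [lam^2]. *)
Lemma fourier_decay (z : R) : Ex P (fun w => gfun (ML w) * cos (j%:R * (ML w - z))) @[j --> \oo] --> 0.
Proof.
have q0 : 0 < p := p0; have NN := N0.
have bgML : bmf (fun w => gfun (ML w)).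
  by apply: bmfM; [|apply: bmfB; [exact: bmf_cst|]]; exact: bmfML.
have hgM n : @bmf R _ (H n) (fun w => gfun (M n w)).
  by apply: bmfM; [|apply: bmfB; [exact: bmf_cst|]]; exact: (cm_M HH).
have g01 x : 0 <= x <= 1 -> 0 <= gfun x <= 1 by move=> /andP[? ?]; rewrite /gfun; apply/andP; split; nra.
have c2 : 0 < c ^+ 2 by rewrite exprn_gt0.
apply/cvgrPdist_le => e e0.
(* Chosen so that [lam2 * (c ^ 2 / p) / 4 = 8 N / e]; the Gaussian factor then makes the last term
   at most [e / 4]. *)
have [lam2 lam20 lam2E] : exists2 x, 0 < x & x = 32 * N%:R * p / (c ^+ 2 * e).
  by eexists; last reflexivity; rewrite divr_gt0 ?mulr_gt0.
pose lam := Num.sqrt lam2.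
have lam0 : 0 < lam by rewrite sqrtr_gt0.
have lamE : lam ^+ 2 = lam2 by rewrite sqr_sqrtr// ltW.
pose T (j : nat) : R := (j%:R / lam) `^ (2 / p).
pose m j := truncn (T j).
have Tp j : T j `^ p = (j%:R / lam) ^+ 2.
  rewrite /T -powRrM divfK ?gt_eqF// powR_mulrn// divr_ge0// ltW//.
have T0 j : (0 < j)%N -> 0 < T j by move=> j0; rewrite powR_gt0// divr_gt0// ltr0n.
have T_ge0 j : 0 <= T j by exact: powR_ge0.
have mT j : T j < (m j).+1%:R by exact: truncnS_gt.
have mT' j : (m j)%:R <= T j by have /andP[] := truncn_itv (T_ge0 j).
have minf A : \forall j \near \oo, (A <= m j)%N.
  near=> j; rewrite /m truncn_ge_nat//.
  have h : lam * A%:R `^ (p / 2) <= j%:R by near: j; exact: nbhs_infty_ger.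
  have h1 : (A%:R : R) `^ (p / 2) <= j%:R / lam by rewrite ler_pdivlMr// mulrC.
  have := powR_le2 (_ : 0 <= 2 / p) (powR_ge0 _ _) h1; rewrite divr_ge0 ?(ltW q0)// => /(_ isT).
  have pp : p / 2 * (2 / p) = 1 by field; rewrite gt_eqF.
  by rewrite -powRrM pp powRr1.
(* So late a horizon that, even multiplied by the frequency [j], replacing [ML] by [M (K j)] costs
   at most [2 / (j + 1)]. *)
have /choice [K hK] : forall j : nat, exists K, (m j <= K)%N /\ tl K <= j.+1%:R^-1 ^+ 4.
  move=> j; have hj : (0 : R) < j.+1%:R^-1 ^+ 4 by rewrite exprn_gt0// invr_gt0 ltr0n.
  have [A _ hA] := (cvgrPdist_le _ _).1 tl0 _ hj.
  exists (maxn (m j) A); split; first exact: leq_maxl.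
  by have := hA _ (leq_maxr (m j) A); rewrite /= sub0r normrN; exact: le_trans (ler_norm _).
have [C C0 hC] := rtail_bound r01 g_range c_gt0 r_cvg.
have [C' C'0 hC'] := r2_bound r01 g_range c_gt0 r_cvg.
rewrite -/p in hC hC'.
have j2 j : (j%:R : R) ^+ 2 = lam2 * T j `^ p.
  by rewrite Tp expr_div_n lamE mulrC divfK// gt_eqF.
have up j : (0 < j)%N -> j%:R ^+ 2 * tl (m j) <= C * lam2.
  move=> j0; rewrite j2.
  apply: (@le_trans _ _ (lam2 * T j `^ p * (C * T j `^ (- p)))).
    rewrite ler_wpM2l ?mulr_ge0 ?powR_ge0 ?(ltW lam20)//.
    apply: le_trans (hC _) _; rewrite ler_pM2l//; apply: powR_le0; [exact: T0|exact: ltW|lra].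
  by rewrite powRN; apply: eq_ler; field; rewrite gt_eqF// powR_gt0 ?T0.
(* Bound for a single step: by [r2_bound], [(j r_k) ^ 2] is at most [C' lam2 / T j], of order
   [j ^ (- 2 / p)]. *)
pose e_ j : R := Num.sqrt (C' * lam2) * (j%:R / lam) `^ (- p^-1).
have e_2 j : (0 < j)%N -> e_ j ^+ 2 = C' * lam2 / T j.
  move=> j0; rewrite exprMn sqr_sqrtr ?mulr_ge0 ?(ltW C'0) ?(ltW lam20)//; congr (_ * _).
  rewrite -powR_mulrn ?powR_ge0// -powRrM /T -powRN; congr (_ `^ _); field; by rewrite gt_eqF.
have hstep : \forall j \near \oo, forall k, (m j <= k)%N -> `|j%:R : R| * r k <= e_ j.
  near=> j => k mk.
  have j0 : (0 < j)%N by near: j; exact: nbhs_infty_gt.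
  have /andP[r0 _] := r01 k.
  rewrite ger0_norm// -(@ler_pXn2r _ 2) ?nnegrE ?mulr_ge0 ?powR_ge0 ?sqrtr_ge0//.
  rewrite e_2// exprMn j2.
  apply: (@le_trans _ _ (lam2 * T j `^ p * (C' * T j `^ (- p - 1)))).
    rewrite ler_wpM2l ?mulr_ge0 ?powR_ge0 ?(ltW lam20)//.
    apply: le_trans (hC' _) _; rewrite ler_pM2l//; apply: powR_le0; [exact: T0| |lra].
    by apply: ltW; apply: lt_le_trans (mT j) _; rewrite ler_nat.
  have -> : T j `^ (- p - 1) = (T j `^ p)^-1 / T j.
    rewrite powRD ?powRN ?powRr1//; apply/implyP => _; rewrite gt_eqF// T0//.
  have Tj := T0 j j0; have Tjp := powR_gt0 p Tj.
  by apply: eq_ler; field; rewrite !gt_eqF.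
have e_cvg : e_ j @[j --> \oo] --> 0.
  have h := @cvg_nat_powRN R p^-1 (_ : 0 < p^-1); rewrite invr_gt0 in h.
  have h1 : Num.sqrt (C' * lam2) * lam `^ p^-1 * j%:R `^ (- p^-1) @[j --> \oo] --> Num.sqrt (C' * lam2) * lam `^ p^-1 * 0.
    by apply: cvgM; [exact: cvg_cst|exact: h].
  rewrite mulr0 in h1; apply: cvgn_near_eq; last exact: h1.
  apply: nearW => j; rewrite /e_ -mulrA; congr (_ * _).
  have lamV : lam^-1 `^ (- p^-1) = lam `^ p^-1.
    by rewrite -[lam^-1]powR_inv1 ?(ltW lam0)// -powRrM mulN1r opprK.
  by rewrite powRM ?invr_ge0 ?(ltW lam0)// lamV mulrC.
have hclt := @clt_limit (fun j _ => j%:R) m K (fun j w => gfun (M (m j) w))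
  (fun j w => j%:R * (M (m j) w - z)) 1 (C * lam2) e_ minf _ _ _ _ _ hstep e_cvg.
have {}hclt : Ex P (fun w => gfun (M (m j) w) * cos (j%:R * (M (K j) w - z))) -
  Ex P (fun w => gfun (M (m j) w) * (expR (- (vproc (M (m j) w) * (j%:R ^+ 2 * (tl (m j) - tl (K j))) / 2)) *
     cos (j%:R * (M (m j) w - z)))) @[j --> \oo] --> 0.
  apply: cvgn_near_eq; last first.
    apply: hclt.
    - by apply: nearW => j; have [] := hK j.
    - by move=> j; exact: hgM.
    - by move=> j; apply: bmfZ; apply: bmfB; [exact: (cm_M HH)|exact: bmf_cst].
    - by move=> j w; have /andP[? ?] := g01 _ (M01 (m j) w); rewrite ger0_norm.
    - near=> j; rewrite qsum_cst; last by have [] := hK j.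
      apply: le_trans (up j _); last by near: j; exact: nbhs_infty_gt.
      rewrite ler_wpM2l ?sqr_ge0//.
      by have := rtail_ge0 r01 g_range c_gt0 r_cvg (K j); lra.
  apply: nearW => j /=; congr (_ - _); congr (Ex P _); apply/funext => w.
    congr (_ * cos _); rewrite wsum_cst; last by have [] := hK j.
    by ring.
  by rewrite qsum_cst//; have [] := hK j.
have e4 : 0 < e / 4 by rewrite divr_gt0.
have [A3 _ hA3] := (cvgrPdist_le _ _).1 hclt _ e4.
have cp4 : 0 < c ^+ 2 / p / 2 by rewrite !divr_gt0.
have [A1 _ hA1] := (cvgrPdist_le _ _).1 (rtail_asymp r01 g_range c_gt0 r_cvg) _ cp4.
have e8 : 0 < e / 8 by rewrite divr_gt0.
have e82 : 0 < (e / 8) ^+ 2 by rewrite exprn_gt0.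
have [A2 _ hA2] := (cvgrPdist_le _ _).1 tl0 _ e82.
have hB0 : 0 < lam2 * (c ^+ 2 / p) / 4 by rewrite divr_gt0// mulr_gt0// divr_gt0.
near=> j.
have j0 : (0 < j)%N by near: j; exact: nbhs_infty_gt.
have jR : (0 : R) < j%:R by rewrite ltr0n.
have [mK tlK] := hK j.
rewrite sub0r normrN.
set E1 := Ex P _.
set E2 := Ex P (fun w => gfun (M (m j) w) * cos (j%:R * (M (K j) w - z))).
set E3 := Ex P (fun w => gfun (M (m j) w) * (expR (- (vproc (M (m j) w) * (j%:R ^+ 2 * (tl (m j) - tl (K j))) / 2)) *
     cos (j%:R * (M (m j) w - z)))).
have s1 : 0 < j.+1%:R^-1 :> R by rewrite invr_gt0 ltr0n.
have h12 : `|E1 - E2| <= e / 4 + 2 * j.+1%:R^-1.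
  have bK : bmf (fun w => `|ML w - M (K j) w|) by apply: bmf_norm; apply: bmfB; [exact: bmfML|exact: bmf_mart].
  have bm : bmf (fun w => `|ML w - M (m j) w|) by apply: bmf_norm; apply: bmfB; [exact: bmfML|exact: bmf_mart].
  have bc (X : Om -> R) : bmf X -> bmf (fun w => cos (j%:R * (X w - z))).
    move=> hX; apply: bmf_cos.
    by case: (bmfZ j%:R (bmfB hX (bmf_cst z))).
  rewrite -ExB; [|by apply: bmfM => //; exact/bc/bmfML|by apply: bmfM; [exact: (cm_sub HH) (hgM _)|exact/bc/bmf_mart]].
  apply: (@le_trans _ _ (Ex P (fun w => `|ML w - M (m j) w| + j%:R * `|ML w - M (K j) w|))).
    apply: Ex_norm_le.
    - by apply: bmfB; apply: bmfM => //; [exact/bc/bmfML|exact: (cm_sub HH) (hgM _)|exact/bc/bmf_mart].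
    - by apply: bmfD => //; exact: bmfZ.
    move=> w.
    set a := gfun (ML w); set b := gfun _; set ca := cos _; set cb := cos _.
    have -> : a * ca - b * cb = (a - b) * ca + b * (ca - cb) by ring.
    apply: le_trans (ler_normD _ _) _; rewrite (normrM (a - b)) (normrM b); apply: lerD.
      rewrite -[leRHS]mulr1; apply: ler_pM => //; first exact: gfun_lip.
      by rewrite ler_norml cos_geN1 cos_le1.
    have /andP[b0 b1] := g01 _ (M01 (m j) w).
    rewrite -[leRHS]mul1r; apply: ler_pM => //; first by rewrite ger0_norm.
    apply: le_trans (norm_cosB _ _) _.
    have -> : j%:R * (ML w - z) - j%:R * (M (K j) w - z) = j%:R * (ML w - M (K j) w) by ring.
    by rewrite normrM ger0_norm.
  rewrite ExD//; last exact: bmfZ.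
  rewrite ExZ//; apply: lerD.
    have := @Ex_normML (m j) _ e8; have := hA2 (m j).
    rewrite /= sub0r normrN => /(_ _)/(le_trans (ler_norm _)) h h'.
    apply: le_trans h' _; have : tl (m j) / (e / 8) <= e / 8.
      by rewrite ler_pdivrMr// -expr2; apply: h; near: j; exact: minf.
    lra.
  have s2 : 0 < j.+1%:R^-1 ^+ 2 :> R by rewrite exprn_gt0.
  have h := @Ex_normML (K j) _ s2.
  have h' : tl (K j) / j.+1%:R^-1 ^+ 2 <= j.+1%:R^-1 ^+ 2 by rewrite ler_pdivrMr// -exprD.
  apply: (@le_trans _ _ (j%:R * (2 * j.+1%:R^-1 ^+ 2))); first by rewrite ler_pM2l// (le_trans h)// mulr_natl mulr2n lerD2l.
  rewrite mulrCA ler_pM2l// expr2 mulrA ler_piMl ?(ltW s1)//.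
  by rewrite ler_pdivrMr ?ltr0n// mul1r ler_nat.
have h23 : `|E2 - E3| <= e / 4.
  have A3j : (A3 <= j)%N by near: j; exact: nbhs_infty_ge.
  by have := hA3 j A3j; rewrite /= sub0r normrN.
have h3 : `|E3| <= e / 4.
  set q := j%:R ^+ 2 * (tl (m j) - tl (K j)).
  (* The tail at [m j] gives at least half of the asymptotic value [lam2 * (c ^ 2 / p)]; a quarter
     is given up for what lies beyond [K j]. *)
  have hq : lam2 * (c ^+ 2 / p) / 4 <= q.
    have hm : c ^+ 2 / p / 2 <= (m j)%:R `^ p * tl (m j).
      have A1m : (A1 <= m j)%N by near: j; exact: minf.
      have := hA1 (m j) A1m; rewrite /= ler_norml => /andP[_].
      by rewrite -/p; lra.
    have t0 := rtail_ge0 r01 g_range c_gt0 r_cvg (m j).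
    have h1 : lam2 * (c ^+ 2 / p / 2) <= j%:R ^+ 2 * tl (m j).
      rewrite j2 -[leRHS]mulrA ler_pM2l//; apply: le_trans hm _; rewrite ler_wpM2r//.
      by apply: powR_le2 => //; exact: ltW.
    have h2 : j%:R ^+ 2 * tl (K j) <= lam2 * (c ^+ 2 / p) / 4.
      apply: (@le_trans _ _ (j.+1%:R^-1)).
        apply: (@le_trans _ _ (j.+1%:R ^+ 2 * j.+1%:R^-1 ^+ 4)).
          by apply: ler_pM => //; rewrite ?sqr_ge0 ?(rtail_ge0 r01 g_range c_gt0 r_cvg)// lerXn2r ?nnegrE ?ler0n// ler_nat.
        have -> : (j.+1%:R ^+ 2 * j.+1%:R^-1 ^+ 4 = j.+1%:R^-1 * j.+1%:R^-1 :> R).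
          have X (x : R) : x != 0 -> x ^+ 2 * x^-1 ^+ 4 = x^-1 * x^-1 by move=> x0; field.
          by apply: X; rewrite pnatr_eq0.
        by rewrite ler_piMl ?(ltW s1)// invf_le1 ?ler1n// ltr0n.
      near: j; exact: near_natSinv_le.
    rewrite /q mulrBr; move: h1 h2; set A := lam2 * _; set B := lam2 * _ / 4.
    have -> : A = B + B by rewrite /A /B; field; rewrite gt_eqF.
    lra.
  have hq0 : 0 < q by apply: lt_le_trans hq; rewrite divr_gt0// mulr_gt0// divr_gt0.
  apply: Ex_norm_bound.
    apply: bmfM; first exact: (cm_sub HH) (hgM _).
    apply: bmfM; last by apply: bmf_cos; case: (bmfZ j%:R (bmfB (bmf_mart (m j)) (bmf_cst z))).
    apply: (@bmf_bounded _ _ _ _ 0 1).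
      apply: measurableT_comp => //; apply: measurableT_comp => //.
      by apply: measurable_funM => //; apply: measurable_funM => //; case: (cm_sub HH (hist_vproc (m j))).
    move=> w; rewrite expR_ge0/= -[leRHS]expR0 ler_expR oppr_le0.
    by have /andP[? ?] := vproc01 (M01 (m j) w); rewrite divr_ge0// mulr_ge0// ltW.
  move=> w; have /andP[x0 x1] := g01 _ (M01 (m j) w).
  rewrite (normrM (gfun _)) (normrM (expR _)) (ger0_norm x0) (ger0_norm (expR_ge0 _)) mulrA -[leRHS]mulr1.
  apply: ler_pM => //; [by rewrite mulr_ge0// expR_ge0| |by rewrite ler_norml cos_geN1 cos_le1].
  have qN : 0 < q / (2 * N%:R) by rewrite divr_gt0// mulr_gt0.
  have := expR_mulN_le x0 qN.
  have -> : gfun (M (m j) w) * (q / (2 * N%:R)) = vproc (M (m j) w) * q / 2.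
    by rewrite /vproc /gfun; field; rewrite gt_eqF.
  move/le_trans; apply; rewrite invf_div ler_pdivrMr//.
  have hqe : 8 * N%:R / e <= q.
    apply: le_trans hq; rewrite lam2E; apply: eq_ler; field; rewrite !gt_eqF//.
  move: hqe; rewrite ler_pdivrMr// => hqe; lra.
have : `|E1| <= `|E1 - E2| + `|E2 - E3| + `|E3|.
  rewrite -{1}(_ : (E1 - E2) + (E2 - E3) + E3 = E1); last by ring.
  by apply: le_trans (ler_normD _ _) _; rewrite lerD2r; exact: ler_normD.
have : j.+1%:R^-1 <= e / 8 by near: j; exact: near_natSinv_le.
move: h12 h23 h3; move: `|E1 - E2| `|E2 - E3| `|E3| `|E1| (j.+1%:R^-1 : R) => x1 x2 x3 x4 s.
lra.
Unshelve. all: by end_near. Qed.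
End limit.

(** * Atoms of the limit *)

Section no_atoms.
Context {R : realType}.

Lemma dirichlet_sum (x : R) L :
  2 * sin (x / 2) * \sum_(0 <= j < L) cos (j%:R * x) = sin (L%:R * x - x / 2) + sin (x / 2).
Proof.
elim: L => [|L ih]; first by rewrite big_geq// mulr0 mul0r sub0r sinN addNr.
rewrite big_nat_recr//= mulrDr ih.
have -> : L.+1%:R * x - x / 2 = L%:R * x + x / 2 by rewrite -natr1; lra.
by rewrite sinB sinD; ring.
Qed.

(** The Dirichlet sum is bounded by [1 / |sin (x / 2)|]; the condition [|x| <= 1], true for
    differences of points of [0, 1], excludes the zeros of [sin (x / 2)] other than 0. *)
Lemma cos_mean_cvg (x : R) : `|x| <= 1 ->
  L.+1%:R^-1 * \sum_(0 <= j < L.+1) cos (j%:R * x) @[L --> \oo] --> ((x == 0)%:R : R).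
Proof.
move=> x1; have [->|x0] := eqVneq x 0.
  apply: cvgn_near_eq; last exact: cvg_cst.
  apply: nearW => L; under eq_bigr do rewrite mulr0 cos0.
  by rewrite big_const_nat subn0 iter_addr_0 mulVf// pnatr_eq0.
have s0 : sin (x / 2) != 0.
  have h (y : R) : 0 < y -> y <= 1 -> 0 < sin (y / 2).
    move=> y0 y1; apply: sin_gt0_pi; have := @pi_ge2 R; lra.
  case/lt_total/orP: x0 => hx.
    have := h (- x); rewrite mulNr sinN oppr_gt0 => /(_ hx).
    by rewrite -ler0_norm ?(ltW hx)// => /(_ x1); rewrite oppr_gt0 => /lt_eqF ->.
  by have := h x hx; rewrite -{1}(gtr0_norm hx) => /(_ x1) /gt_eqF ->.
have sb : 0 < `|sin (x / 2)| by rewrite normr_gt0.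
apply/cvgrPdist_le => e e0; near=> L.
rewrite /= sub0r normrN normrM ger0_norm ?invr_ge0//.
have hS : `|\sum_(0 <= j < L.+1) cos (j%:R * x)| <= `|sin (x / 2)|^-1.
  have : `|2 * sin (x / 2) * \sum_(0 <= j < L.+1) cos (j%:R * x)| <= 2.
    rewrite dirichlet_sum (le_trans (ler_normD _ _))// -[leRHS]/(1 + 1).
    by apply: lerD; rewrite ler_norml sin_geN1 sin_le1.
  rewrite !normrM ger0_norm// -mulrA -ler_pdivlMl// mulVf// => h.
  by rewrite -[leRHS]mul1r ler_pdivlMr// mulrC.
apply: le_trans (ler_wpM2l _ hS) _; first by rewrite invr_ge0.
rewrite ler_pdivrMr//; near: L; apply: near_natSinv_le; exact: mulr_gt0.
Unshelve. all: by end_near. Qed.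

(** With the phase centred at [z] the cosine alone suffices: its Cesaro means tend to the indicator
    of [ML = z]. The limit of the expectations is [gfun z] times the mass at [z], and [gfun z] is
    nonzero. *)
Lemma fourier_no_atom {d} {Om : measurableType d} (P : probability Om R) (ML : Om -> R) (z : R) :
  measurable_fun setT ML -> (forall w, 0 <= ML w <= 1) -> 0 < z < 1 ->
  Ex P (fun w => gfun (ML w) * cos (j%:R * (ML w - z))) @[j --> \oo] --> 0 ->
  P (ML @^-1` [set z]) = 0%E.
Proof.
move=> mML ML01 /andP[z0 z1] hF.
have bML : bmf ML := bmf_bounded mML ML01.
have bg : bmf (fun w => gfun (ML w)).
  by apply: bmfM => //; apply: bmfB => //; exact: bmf_cst.
have bc j : bmf (fun w => cos (j%:R * (ML w - z))).
  by apply: bmf_cos; case: (bmfZ j%:R (bmfB bML (bmf_cst z))).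
have mz : measurable (ML @^-1` [set z]).
  by rewrite -[X in measurable X]setTI; apply: mML => //; exact: measurable_set1.
have h1 := cesaro hF.
have E L : arithmetic_mean (fun j : nat => Ex P (fun w => gfun (ML w) * cos (j%:R * (ML w - z)))) L =
    Ex P (fun w => gfun (ML w) * (L.+1%:R^-1 * \sum_(0 <= j < L.+1) cos (j%:R * (ML w - z)))).
  rewrite /arithmetic_mean /series/= -Ex_sum; last by move=> j _; exact: bmfM.
  rewrite -ExZ; last by apply: bmf_sum => j _; exact: bmfM.
  congr (Ex P _); apply/funext => w; rewrite -mulr_sumr; ring.
have bS L : bmf (fun w => gfun (ML w) * (L.+1%:R^-1 * \sum_(0 <= j < L.+1) cos (j%:R * (ML w - z)))).
  by apply: bmfM => //; apply: bmfZ; exact: bmf_sum.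
have h2 : Ex P (fun w => gfun (ML w) * (L.+1%:R^-1 * \sum_(0 <= j < L.+1) cos (j%:R * (ML w - z)))) @[L --> \oo] -->
    Ex P (fun w => gfun z * \1_(ML @^-1` [set z]) w).
  apply: (@Ex_cvg _ _ _ P _ _ 1).
  - by move=> L; case: (bS L).
  - by case: (bmfZ (gfun z) (bmf_indic (R := R) mz)).
  - move=> L w; have /andP[? ?] := ML01 w; rewrite normrM -[leRHS]mulr1; apply: ler_pM => //.
      by rewrite ger0_norm /gfun; nra.
    rewrite normrM ger0_norm ?invr_ge0// mulrC ler_pdivrMr ?ltr0n// mul1r.
    apply: le_trans (ler_norm_sum _ _ _) _.
    apply: (@le_trans _ _ (\sum_(0 <= j < L.+1) 1)).
      by apply: ler_sum => j _; rewrite ler_norml cos_geN1 cos_le1.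
    by rewrite big_const_nat subn0 iter_addr_0.
  - apply: aeW => w; have /andP[? ?] := ML01 w.
    have hx : `|ML w - z| <= 1 by rewrite ler_norml; apply/andP; split; lra.
    have := cos_mean_cvg hx => h.
    rewrite indicE; have -> : gfun z * (w \in ML @^-1` [set z])%:R = gfun (ML w) * (ML w - z == 0)%:R.
      have [Ez|nz] := eqVneq (ML w) z.
        by rewrite mem_set//= Ez subrr eqxx.
      by rewrite subr_eq0 (negbTE nz) memNset ?mulr0//=; exact/eqP.
    by apply: cvgM => //; exact: cvg_cst.
have h3 : Ex P (fun w => gfun (ML w) * (L.+1%:R^-1 * \sum_(0 <= j < L.+1) cos (j%:R * (ML w - z)))) @[L --> \oo] --> 0.
  apply: cvgn_near_eq; last exact: h1.
  by apply: nearW => L; rewrite -E.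
have : Ex P (fun w => gfun z * \1_(ML @^-1` [set z]) w) = 0 by exact: (cvg_unique _ h2 h3).
rewrite ExZ; last exact: bmf_indic.
have gz0 : gfun z != 0 by rewrite /gfun mulf_neq0 ?subr_eq0 ?gt_eqF.
rewrite Ex_indic// => /eqP; rewrite mulf_eq0 (negbTE gz0) /= => /eqP.
by move=> h; rewrite -[LHS]fineK ?h// fin_num_measure.
Qed.

End no_atoms.

(** * Non-degeneracy of the limit *)

Section positivity.
Context {R : realType} {d : measure_display} {Om : measurableType d}.
Context (P : probability Om R) (hg : nat -> set (set Om)).
Context (M cv : nat -> Om -> R) (r : nat -> R) (g c : R) (ML : Om -> R).
Hypothesis HH : controlled_martingale P hg M cv r.
Hypothesis r01 : forall n, 0 <= r n < 1.
Hypothesis g_range : 2^-1 < g <= 1.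
Hypothesis c_gt0 : 0 < c.
Hypothesis r_cvg : n%:R `^ g * r n @[n --> \oo] --> c.
Hypothesis M01 : forall n w, 0 <= M n w <= 1.
Hypothesis ML01 : forall w, 0 <= ML w <= 1.
Hypothesis mML : measurable_fun setT ML.
Hypothesis cvgML : {ae P, forall w, M n w @[n --> \oo] --> ML w}.
Hypothesis cv_gfun : forall n w, cv n w <= gfun (M n w).
Hypothesis gfun0 : 0 < Ex P (fun w => gfun (M 0 w)).

Let bM n : bmf (M n). Proof. exact: (cm_sub HH) (cm_M HH n). Qed.
Let bgM n : bmf (fun w => gfun (M n w)).
Proof. by apply: bmfM => //; apply: bmfB => //; exact: bmf_cst. Qed.

Lemma gfun_step n : Ex P (fun w => gfun (M n.+1 w)) =
  Ex P (fun w => gfun (M n w)) - r n ^+ 2 * Ex P (cv n).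
Proof.
have bx : bmf (fun w => M n.+1 w - M n w) by exact: bmfB.
have hG : @bmf R _ (g_sigma_algebraType (hg n)) (fun w => 1 - 2 * M n w).
  by apply: bmfB; [exact: bmf_cst|apply: bmfZ; exact: (cm_M HH)].
have bG := cm_sub HH hG.
transitivity (Ex P (fun w => gfun (M n w) + (1 - 2 * M n w) * (M n.+1 w - M n w)
   - 1 * (M n.+1 w - M n w) ^+ 2)).
  by congr (Ex P _); apply/funext => w; rewrite /gfun; ring.
rewrite ExB; [|by apply: bmfD => //; exact: bmfM|by apply: bmfZ; exact: bmfX].
rewrite ExD//; last exact: bmfM.
rewrite (cm_mart HH hG) addr0 (cm_cvar HH (bmf_cst _)).
congr (_ - _ * _); congr (Ex P _); apply/funext => w; exact: mul1r.
Qed.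

(** The infinite product is avoided: up to a time [m] finitely many positive factors keep [e]
    positive, and once the tail sum of [r_n ^ 2] is at most 1/2 the nonincreasing sequence [e] loses
    at most half of [e m]. *)
Lemma gfun_ML_gt0 : 0 < Ex P (fun w => gfun (ML w)).
Proof.
pose e n := Ex P (fun w => gfun (M n w)).
have e_ge n : 0 <= e n.
  by apply: Ex_ge0 => w; have /andP[? ?] := M01 n w; rewrite /gfun; nra.
have cv0 n : 0 <= Ex P (cv n) by apply: Ex_ge0; exact: (cm_cv0 HH).
have cve n : Ex P (cv n) <= e n by apply: le_Ex => //; exact: (cm_sub HH) (cm_cv HH n).
have r2 n : 0 <= r n ^+ 2 := sqr_ge0 _.
have step n : e n - r n ^+ 2 * e n <= e n.+1.
  by rewrite /e gfun_step lerD2l lerN2 ler_wpM2l.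
have e_nd m n : (m <= n)%N -> e n <= e m.
  elim: n => [|n ih]; first by rewrite leqn0 => /eqP ->.
  rewrite leq_eqVlt => /predU1P[->//|]; rewrite ltnS => /ih; apply: le_trans.
  by rewrite /e gfun_step gerBl mulr_ge0.
have e_gt n : 0 < e n.
  elim: n => [|n ih]; first exact: gfun0.
  apply: lt_le_trans (step n); have /andP[? ?] := r01 n.
  by rewrite -[X in X - _]mul1r -mulrBl mulr_gt0// subr_gt0 expr_lt1.
have half : 0 < (2^-1 : R) by rewrite invr_gt0.
have [m _ hm] := (cvgrPdist_le _ _).1 (rtail_cvg0 r01 g_range c_gt0 r_cvg) _ half.
have tm : rtail r m <= 2^-1.
  by have := hm m (leqnn m); rewrite /= sub0r normrN; exact: le_trans (ler_norm _).
have lower n : (m <= n)%N -> e m * (1 - (rtail r m - rtail r n)) <= e n.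
  elim: n => [|n ih].
    by rewrite leqn0 => /eqP ->; rewrite subrr subr0 mulr1.
  rewrite leq_eqVlt => /predU1P[->|]; first by rewrite subrr subr0 mulr1.
  rewrite ltnS => mn; apply: le_trans (step n).
  have hr : rtail r n = rtail r n.+1 + r n ^+ 2.
    by rewrite /rtail /psum [in RHS]big_nat_recr//=; lra.
  have := ih mn; have := ler_wpM2l (r2 n) (e_nd m n mn); rewrite hr; nra.
have hc : e n @[n --> \oo] --> Ex P (fun w => gfun (ML w)).
  apply: (@Ex_cvg _ _ _ P _ _ 1).
  - by move=> n; case: (bgM n).
  - have bML := bmf_bounded mML ML01.
    by case: (bmfM bML (bmfB (bmf_cst 1) bML)).
  - by move=> n w; have /andP[? ?] := M01 n w; rewrite ger0_norm /gfun; nra.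
  - apply: filterS cvgML => w hw; apply: cvgM => //; apply: cvgB => //; exact: cvg_cst.
apply: (@lt_le_trans _ _ (e m / 2)); first by rewrite divr_gt0.
apply: (cvgn_ge_near hc); near=> n.
have mn : (m <= n)%N by near: n; exact: nbhs_infty_ge.
apply: le_trans (lower n mn); have := rtail_ge0 r01 g_range c_gt0 r_cvg n.
have := e_gt m; nra.
Unshelve. all: by end_near. Qed.

End positivity.

(** * Finite-dimensional marginals *)

Lemma cvgn_sum {R : realType} (J : Type) (s : seq J) (u : J -> nat -> R) (l : J -> R) :
  (forall i, u i n @[n --> \oo] --> l i) ->
  \sum_(i <- s) u i n @[n --> \oo] --> \sum_(i <- s) l i.
Proof.
move=> h; elim: s => [|i s ih].
  by rewrite big_nil; under eq_fun do rewrite big_nil; exact: cvg_cst.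
by rewrite big_cons; under eq_fun do rewrite big_cons; exact: cvgD.
Qed.

Section fdd.
Context {R : realType} {d : measure_display} {Om : measurableType d}.
Context (P : probability Om R) (hg : nat -> set (set Om)).
Context (M cv : nat -> Om -> R) (r : nat -> R) (N : nat) (g c : R) (ML : Om -> R).
Local Notation H n := (g_sigma_algebraType (hg n)).
Hypothesis HH : controlled_martingale P hg M cv r.
Hypothesis N_gt0 : (0 < N)%N.
Hypothesis r01 : forall n, 0 <= r n < 1.
Hypothesis g_range : 2^-1 < g <= 1.
Hypothesis c_gt0 : 0 < c.
Hypothesis r_cvg : n%:R `^ g * r n @[n --> \oo] --> c.
Hypothesis M01 : forall n w, 0 <= M n w <= 1.
Hypothesis ML01 : forall w, 0 <= ML w <= 1.
Hypothesis mML : measurable_fun setT ML.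
Hypothesis cvgML : {ae P, forall w, M n w @[n --> \oo] --> ML w}.
Hypothesis Hcvv : Ex P (fun w => `|cv n w - vproc N (M n w)|) @[n --> \oo] --> 0.
Let p := 2 * g - 1.
Local Notation tl := (rtail r).

Let p0 : 0 < p. Proof. by have /andP[] := p_range g_range. Qed.
Let N1 : (1 : R) <= N%:R. Proof. by rewrite ler1n. Qed.
Let N0 : (0 : R) < N%:R. Proof. by rewrite ltr0n. Qed.

Definition amp (n : nat) : R := n%:R `^ (g - 2^-1).

Lemma amp_ge0 n : 0 <= amp n. Proof. exact: powR_ge0. Qed.

Lemma amp2 n : amp n ^+ 2 = n%:R `^ p.
Proof. by rewrite /amp -powR_mulrn ?powR_ge0// -powRrM; congr (_ `^ _); rewrite /p; lra. Qed.

Definition proc (n : nat) (t : R) (w : Om) : R :=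
  t `^ p * amp n * (M (truncn (n%:R * t)) w - ML w).

Let bM n : bmf (M n). Proof. exact: (cm_sub HH) (cm_M HH n). Qed.
Let bML : bmf ML. Proof. exact: bmf_bounded mML ML01. Qed.

Lemma bmf_proc n t : bmf (proc n t).
Proof. by apply: bmfZ; exact: bmfB. Qed.

Lemma Ex_proc2 n t : Ex P (fun w => proc n t w ^+ 2) <= (t `^ p) ^+ 2 * (n%:R `^ p * tl (truncn (n%:R * t))).
Proof.
rewrite mulrA -amp2 -exprMn; set a := t `^ p * amp n.
have -> : Ex P (fun w => proc n t w ^+ 2) = a ^+ 2 * Ex P (fun w => (ML w - M (truncn (n%:R * t)) w) ^+ 2).
  rewrite -ExZ; last by apply: bmfX; exact: bmfB.
  by congr (Ex P _); apply/funext => w; rewrite /proc -/a; ring.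
by rewrite ler_wpM2l ?sqr_ge0// (Ex_ML2 HH r01 g_range c_gt0 r_cvg).
Qed.

Lemma sum_shift (f : nat -> R) m k0 K : (m <= k0)%N -> (k0 <= K)%N ->
  \sum_(m <= k < K) (k0 <= k)%N%:R * f k = \sum_(k0 <= k < K) f k.
Proof.
move=> mk kK; rewrite (big_cat_nat _ (n := k0))//= big_nat big1 ?add0r.
  by rewrite big_nat [RHS]big_nat; apply: eq_bigr => k /andP[-> _]; rewrite mul1r.
by move=> k /andP[_ kk]; rewrite leqNgt kk mul0r.
Qed.

Section weights.
Context (q : nat) (t th : nat -> R).
Hypothesis t_gt0 : forall i, (i < q)%N -> 0 < t i.

Let u i := th i * t i `^ p.
Let ki n i := truncn (n%:R * t i).
(** A combination of the [M K - M (ki n i)] is a single martingale transform: the increment after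
    time [k] is counted by every [i] with [ki n i <= k]. *)
Let b n k := amp n * \sum_(i < q) u i * (ki n i <= k)%N%:R.

Lemma wsum_weights n m K w : (forall i, (i < q)%N -> (m <= ki n i <= K)%N) ->
  wsum M (b n) m K w = amp n * \sum_(i < q) u i * (M K w - M (ki n i) w).
Proof.
move=> h; rewrite /wsum /b.
transitivity (amp n * \sum_(m <= k < K) \sum_(i < q) u i * ((ki n i <= k)%N%:R * (M k.+1 w - M k w))).
  rewrite mulr_sumr; apply: eq_bigr => k _; rewrite -mulrA; congr (_ * _).
  by rewrite mulr_suml; apply: eq_bigr => i _; rewrite mulrA.
congr (_ * _); rewrite exchange_big/=; apply: eq_bigr => i _; rewrite -mulr_sumr; congr (_ * _).
have /andP[h1 h2] := h i (ltn_ord i).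
by rewrite (sum_shift (fun k => M k.+1 w - M k w))// telescope_sumr.
Qed.

Lemma qsum_weights n m K : (forall i, (i < q)%N -> (m <= ki n i <= K)%N) ->
  qsum r (b n) m K = \sum_(i < q) \sum_(j < q) u i * u j *
    (n%:R `^ p * tl (maxn (ki n i) (ki n j)) - n%:R `^ p * tl K).
Proof.
move=> h; rewrite /qsum /b.
transitivity (\sum_(m <= k < K) \sum_(i < q) \sum_(j < q) u i * u j *
    (n%:R `^ p * ((maxn (ki n i) (ki n j) <= k)%N%:R * r k ^+ 2))).
  apply: eq_bigr => k _; rewrite !exprMn amp2 [X in _ * X * _]expr2 big_distrlr/= mulr_sumr mulr_suml.
  apply: eq_bigr => i _; rewrite mulr_sumr mulr_suml; apply: eq_bigr => j _.
  by rewrite geq_max -mulnb natrM; ring.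
rewrite exchange_big/=; apply: eq_bigr => i _; rewrite exchange_big/=; apply: eq_bigr => j _.
rewrite -mulr_sumr; congr (_ * _); rewrite -mulr_sumr -mulrBr; congr (_ * _).
have /andP[h1 h2] := h i (ltn_ord i); have /andP[h3 h4] := h j (ltn_ord j).
rewrite (sum_shift (fun k => r k ^+ 2)) ?rtail_sum// ?leq_max ?geq_max ?h1 ?h2 ?h4//.
Qed.

(** [c ^ 2 / p] times the variance of [\sum_i th i * B (t i ^ p)] for a Brownian motion [B]. It
    arises from tails because [(s t) ^ p * max (s, t) ^ (- p) = min (s, t) ^ p]. *)
Definition qform : R := c ^+ 2 / p * \sum_(i < q) \sum_(j < q) th i * th j * (minr (t i) (t j)) `^ p.

Lemma qsum_cvg (m : nat -> nat) : (\forall n \near \oo, forall i, (i < q)%N -> (m n <= ki n i <= n * n)%N) ->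
  qsum r (b n) (m n) (n * n) @[n --> \oo] --> qform.
Proof.
move=> hm.
have hs : \sum_(i < q) \sum_(j < q) u i * u j *
    (n%:R `^ p * tl (maxn (ki n i) (ki n j)) - n%:R `^ p * tl (n * n)) @[n --> \oo] -->
    \sum_(i < q) \sum_(j < q) u i * u j * (c ^+ 2 / p * (maxr (t i) (t j)) `^ (- p) - 0).
  apply: cvgn_sum => i; apply: cvgn_sum => j.
  apply: cvgM; first exact: cvg_cst.
  apply: cvgB; last exact: (rtail_square r01 g_range c_gt0 r_cvg).
  have ti := t_gt0 (ltn_ord i); have tj := t_gt0 (ltn_ord j).
  have tm : 0 < maxr (t i) (t j) by rewrite lt_max ti.
  apply: cvgn_near_eq; last exact: (rtail_trunc r01 g_range c_gt0 r_cvg tm).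
  apply: nearW => n; congr (_ * tl _); rewrite /ki; case: (leP (t i) (t j)) => hij.
    apply/maxn_idPr; apply: le_truncn; by rewrite ler_wpM2l.
  by apply/maxn_idPl; apply: le_truncn; rewrite ler_wpM2l// ltW.
have -> : qform = \sum_(i < q) \sum_(j < q) u i * u j * (c ^+ 2 / p * (maxr (t i) (t j)) `^ (- p) - 0).
  rewrite /qform mulr_sumr; apply: eq_bigr => i _; rewrite mulr_sumr; apply: eq_bigr => j _.
  have ti := t_gt0 (ltn_ord i); have tj := t_gt0 (ltn_ord j).
  have pi_ := powR_gt0 p ti; have pj := powR_gt0 p tj.
  rewrite subr0 /u; case: (leP (t i) (t j)) => hij; rewrite powRN; field; rewrite ?gt_eqF//.
apply: cvgn_near_eq; last exact: hs.
by near=> n; rewrite (@qsum_weights n)//; near: n.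
Unshelve. all: by end_near. Qed.

Lemma near_all_lt (Q : nat -> nat -> Prop) : (forall i, (i < q)%N -> \forall n \near \oo, Q i n) ->
  \forall n \near \oo, forall i, (i < q)%N -> Q i n.
Proof.
elim: q => [|q' ih] h; first by apply: nearW => n i.
have h1 := ih (fun i iq => h i (ltnW iq)); have h2 := h q' (ltnSn _).
near=> n => i; rewrite ltnS leq_eqVlt => /predU1P[->|iq]; first by near: n.
have : forall i, (i < q')%N -> Q i n by near: n.
exact.
Unshelve. all: by end_near. Qed.

(** Three limits are added: the limit [ML] inside [proc] is replaced by [M (n * n)], the central
    limit theorem is applied, and the variance frozen at time [m n] tends to [vproc N (ML w)], which
    yields a Gaussian mixture. *)
Lemma fdd_cos (phi : R) :
  Ex P (fun w => cos (phi + \sum_(i < q) th i * proc n (t i) w)) @[n --> \oo] -->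
  Ex P (fun w => expR (- (vproc N (ML w) * qform / 2)) * cos phi).
Proof.
have q0 : 0 < p := p0.
(* The variance is frozen at time [n * t0], which must precede all the times [n * t i]. *)
have [t0 t00 t0le] : exists2 t0, 0 < t0 & forall i, (i < q)%N -> t0 <= t i.
  elim: q t_gt0 => [|q' ih] h; first by exists 1.
  have [t0 t00 t0le] := ih (fun i iq => h i (ltnW iq)).
  exists (minr t0 (t q')); first by rewrite lt_min t00 h.
  move=> i; rewrite ltnS leq_eqVlt ge_min => /predU1P[->|/t0le ->//]; by rewrite lexx orbT.
pose m n := truncn (n%:R * t0).
have hm : \forall n \near \oo, forall i, (i < q)%N -> (m n <= ki n i <= n * n)%N.
  apply: near_all_lt => i iq; near=> n.
  rewrite /m /ki le_truncn ?ler_wpM2l ?t0le//=.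
  rewrite -(@leq_pmul2r 1)// !muln1 -ltnS -(ltr_nat R).
  have ti := t_gt0 iq.
  have nt0 : 0 <= n%:R * t i by rewrite mulr_ge0// ltW.
  have /andP[h1 _] := truncn_itv nt0.
  apply: le_lt_trans h1 _; apply: (@le_lt_trans _ _ (n * n)%:R); last by rewrite ltr_nat.
  rewrite natrM ler_wpM2l//; near: n; exact: nbhs_infty_ger.
have minf A : \forall n \near \oo, (A <= m n)%N by exact: truncn_mul_infty.
pose W := \sum_(i < q) `|u i|.
have W0 : 0 <= W by exact: sumr_ge0.
have [C C0 hC] := rstep_trunc r01 g_range c_gt0 r_cvg t00.
rewrite -/p in hC.
pose e_ (n : nat) := W * (Num.sqrt C * n%:R `^ (- 2^-1)).
have e_cvg : e_ n @[n --> \oo] --> 0.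
  have h : (n%:R : R) `^ (- 2^-1) @[n --> \oo] --> 0 by apply: cvg_nat_powRN; rewrite invr_gt0.
  rewrite -[X in _ --> X](mulr0 W); apply: cvgM; first exact: cvg_cst.
  by rewrite -[X in _ --> X](mulr0 (Num.sqrt C)); apply: cvgM => //; exact: cvg_cst.
have hb n k : `|b n k| <= amp n * W.
  rewrite /b normrM (ger0_norm (amp_ge0 n)) ler_wpM2l ?amp_ge0//.
  apply: le_trans (ler_norm_sum _ _ _) _; apply: ler_sum => i _.
  by rewrite normrM; case: (_ <= _)%N; rewrite ?normr1 ?mulr1// normr0 mulr0.
have hstep : \forall n \near \oo, forall k, (m n <= k)%N -> `|b n k| * r k <= e_ n.
  near=> n => k mk; have /andP[r0 _] := r01 k.
  have n0 : (0 < n)%N by near: n; exact: nbhs_infty_gt.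
  apply: le_trans (ler_wpM2r r0 (hb n k)) _.
  rewrite /e_ mulrAC mulrC ler_wpM2l//.
  rewrite -(@ler_pXn2r _ 2) ?nnegrE ?mulr_ge0 ?amp_ge0 ?sqrtr_ge0 ?powR_ge0//.
  rewrite exprMn amp2 exprMn sqr_sqrtr ?(ltW C0)// -[X in _ <= _ * X]powR_mulrn ?powR_ge0// -powRrM.
  have -> : - 2^-1 * 2%:R = - 1 :> R by lra.
  by rewrite powR_inv1//; apply: hC.
have hq := qsum_cvg hm.
have hQ : \forall n \near \oo, qsum r (b n) (m n) (n * n) <= qform + 1.
  move/cvgrPdist_le : (hq) => /(_ 1 ltr01); apply: filterS => n.
  by rewrite ler_norml => /andP[h _]; lra.
have hmK : \forall n \near \oo, (m n <= n * n)%N.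
  near=> n; rewrite -(@leq_pmul2r 1)// !muln1 -ltnS -(ltr_nat R).
  have nt0 : 0 <= n%:R * t0 by rewrite mulr_ge0// ltW.
  have /andP[h1 _] := truncn_itv nt0.
  apply: le_lt_trans h1 _; apply: (@le_lt_trans _ _ (n * n)%:R); last by rewrite ltr_nat.
  rewrite natrM ler_wpM2l//; near: n; exact: nbhs_infty_ger.
(* The phase is [- phi] because [proc] is minus a sum of future increments; the parity of the cosine
   restores the sign. *)
have hclt := @clt_limit _ _ _ P hg M cv r N g c HH N_gt0 r01 g_range c_gt0 r_cvg M01 Hcvv
  b m (fun n => n * n)%N (fun _ _ => 1) (fun _ _ => - phi) 1 (qform + 1) e_ minf hmK
  (fun n => bmf_cst _) (fun n => bmf_cst _) (fun n w => eq_ler (normr1 _)) hQ hstep e_cvg.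
have bE (y : Om -> R) (Q : R) : bmf y -> (forall w, 0 <= y w <= 1) -> 0 <= Q ->
    bmf (fun w => expR (- (vproc N (y w) * Q / 2)) * cos phi).
  move=> hy y01 Q0; apply: bmfZr; apply: (@bmf_bounded _ _ _ _ 0 1).
    apply: measurableT_comp => //; apply: measurableT_comp => //.
    apply: measurable_funM => //; apply: measurable_funM => //.
    by case: (bmfZr N%:R^-1 (bmfM hy (bmfB (bmf_cst 1) hy))).
  move=> w; rewrite expR_ge0/= -[leRHS]expR0 ler_expR oppr_le0.
  by have /andP[? ?] := vproc01 N_gt0 (y01 w); rewrite divr_ge0// mulr_ge0.
have qf0 : 0 <= qform by apply: (cvgn_ge_near hq); apply: nearW => n; exact: qsum_ge0.
have h2 : Ex P (fun w => expR (- (vproc N (M (m n) w) * qsum r (b n) (m n) (n * n) / 2)) * cos phi) @[n --> \oo] -->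
    Ex P (fun w => expR (- (vproc N (ML w) * qform / 2)) * cos phi).
  apply: (@Ex_cvg _ _ _ P _ _ 1).
  - by move=> n; case: (bE (M (m n)) _ (bM _) (M01 _) (qsum_ge0 r (b n) (m n) (n * n))).
  - by case: (bE ML _ bML ML01 qf0).
  - move=> n w; rewrite normrM -[leRHS]mulr1; apply: ler_pM => //; last by rewrite ler_norml cos_geN1 cos_le1.
    rewrite ger0_norm ?expR_ge0// -[leRHS]expR0 ler_expR oppr_le0.
    by have /andP[? ?] := vproc01 N_gt0 (M01 (m n) w); rewrite divr_ge0// mulr_ge0// qsum_ge0.
  - apply: filterS cvgML => w hw.
    have hMm : M (m n) w @[n --> \oo] --> ML w.
      apply/cvgrPdist_le => e e0; have [A _ hA] := (cvgrPdist_le _ _).1 hw _ e0.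
      by apply: filterS (minf A) => n /hA.
    apply: cvgM; last exact: cvg_cst.
    apply: continuous_cvg; first exact: continuous_expR.
    apply: cvgN; apply: cvgM; last exact: cvg_cst.
    apply: cvgM => //; apply: cvgM; last exact: cvg_cst.
    by apply: cvgM => //; apply: cvgB => //; exact: cvg_cst.
have h3 : Ex P (fun w => cos (phi + \sum_(i < q) th i * proc n (t i) w)) -
    Ex P (fun w => 1 * cos (- phi + wsum M (b n) (m n) (n * n) w)) @[n --> \oo] --> 0.
  apply/cvgrPdist_le => e e0.
  pose e2 := e / 2 / (W + 1).
  have W1 : 0 < W + 1 by lra.
  have e20 : 0 < e2 by rewrite !divr_gt0.
  have e22 : 0 < e2 ^+ 2 by rewrite exprn_gt0.
  have [A _ hA] := (cvgrPdist_le _ _).1 (rtail_square r01 g_range c_gt0 r_cvg) _ e22.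
  near=> n.
  have hmn : forall i, (i < q)%N -> (m n <= ki n i <= n * n)%N by near: n.
  have An : (A <= n)%N by near: n; exact: nbhs_infty_ge.
  have := hA n An; rewrite /= sub0r normrN -/p => /(le_trans (ler_norm _)) hAn.
  have bD : bmf (fun w => amp n * (ML w - M (n * n) w)) by apply: bmfZ; exact: bmfB.
  have bX : bmf (fun w => cos (phi + \sum_(i < q) th i * proc n (t i) w)).
    apply: bmf_cos; apply: measurable_funD => //.
    have : bmf (fun w => \sum_(i < q) th i * proc n (t i) w) by apply: bmf_sum => i _; apply: bmfZ; exact: bmf_proc.
    by case.
  have bw : bmf (fun w => 1 * cos (- phi + wsum M (b n) (m n) (n * n) w)).
    apply: bmfZ; apply: bmf_cos; apply: measurable_funD => //.
    by case: (cm_sub HH (bmf_wsum HH (b n) (m n) (n * n))).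
  rewrite sub0r normrN -ExB//.
  apply: (@le_trans _ _ (Ex P (fun w => W * `|amp n * (ML w - M (n * n) w)|))).
    apply: Ex_norm_le; [exact: bmfB|by apply: bmfZ; exact: bmf_norm|].
    move=> w; rewrite mul1r (wsum_weights w hmn) -[cos (- phi + _)]cosN.
    apply: le_trans (norm_cosB _ _) _.
    have -> : phi + \sum_(i < q) th i * proc n (t i) w - - (- phi + amp n * \sum_(i < q) u i * (M (n * n) w - M (ki n i) w)) =
        - (\sum_(i < q) u i * (amp n * (ML w - M (n * n) w))).
      rewrite opprK addrACA subrr add0r mulr_sumr -sumrN -big_split/=.
      by apply: eq_bigr => i _; rewrite /proc /u -/(ki n i); ring.
    rewrite normrN -mulr_suml normrM ler_wpM2r//; exact: ler_norm_sum.
  rewrite ExZ; last exact: bmf_norm.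
  have h := Ex_cauchy_schwarz1 P bD e20.
  have h' : Ex P (fun w => (amp n * (ML w - M (n * n) w)) ^+ 2) <= n%:R `^ p * tl (n * n).
    have -> : Ex P (fun w => (amp n * (ML w - M (n * n) w)) ^+ 2) = amp n ^+ 2 * Ex P (fun w => (ML w - M (n * n) w) ^+ 2).
      rewrite -ExZ; last by apply: bmfX; exact: bmfB.
      by congr (Ex P _); apply/funext => w; rewrite exprMn.
    by rewrite amp2 ler_wpM2l ?powR_ge0// (Ex_ML2 HH r01 g_range c_gt0 r_cvg).
  have h4 : Ex P (fun w => `|amp n * (ML w - M (n * n) w)|) <= 2 * e2.
    apply: le_trans h _; rewrite mulr_natl mulr2n lerD2l ler_pdivrMr// -expr2.
    exact: le_trans h' hAn.
  apply: le_trans (ler_wpM2l W0 h4) _.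
  apply: (@le_trans _ _ ((W + 1) * (2 * e2))); first by apply: ler_wpM2r; [rewrite mulr_ge0// ltW|lra].
  by apply: eq_ler; rewrite /e2; field; rewrite gt_eqF.
have h4 := cvgD h3 (cvgD hclt h2).
rewrite !add0r in h4.
apply: cvgn_near_eq; last exact: h4.
apply: nearW => n /=; rewrite ?fctE /=.
have -> : Ex P (fun w => 1 * (expR (- (vproc N (M (m n) w) * qsum r (b n) (m n) (n * n) / 2)) * cos (- phi))) =
  Ex P (fun w => expR (- (vproc N (M (m n) w) * qsum r (b n) (m n) (n * n) / 2)) * cos phi).
  by congr (Ex P _); apply/funext => w; rewrite mul1r cosN.
by rewrite subrK subrK.
Unshelve. all: by end_near. Qed.

End weights.
End fdd.

(** * Gaussian integrals *)

Section normal_fourier.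
Context {R : realType} (s : R).
Hypothesis s_gt0 : 0 < s.
Local Notation mu := (@lebesgue_measure R).
Local Notation f := (normal_pdf 0 s).

Let s0 : s != 0. Proof. by rewrite gt_eqF. Qed.

Lemma normal_pdf0E x : f x = normal_peak s * expR (- x ^+ 2 / (s ^+ 2 *+ 2)).
Proof. by rewrite normal_pdfE// /normal_fun subr0. Qed.

Lemma is_derive_normal_pdf (x : R) : is_derive x 1 f (- (x / s ^+ 2) * f x).
Proof.
have -> : f = (fun x => normal_peak s *: expR (x ^+ 2 * - (s ^+ 2 *+ 2)^-1)).
  by apply/funext => y; rewrite normal_pdf0E mulNr mulrN.
apply: is_derive_eq; rewrite /GRing.scale/=.
have ss : s ^+ 2 *+ 2 = 2 * s ^+ 2 by rewrite mulr_natl.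
set E := expR _; rewrite ss; field; exact: s0.
Qed.

(** A normal density with twice the deviation absorbs the factor [|x|]; this gives integrability of
    [x f x] and vanishing boundary terms. With [x ^ 2 = 4 s ^ 2 y] the two exponentials are
    [exp (- 2 y)] and [exp (- y / 2)]. *)
Lemma norm_mul_pdf_le (x : R) : `|x| * f x <=
  (1 + 4 * s ^+ 2) * normal_peak s / normal_peak (2 * s) * normal_pdf 0 (2 * s) x.
Proof.
have s2 : 2 * s != 0 by rewrite mulf_neq0.
have pk := normal_peak_gt0 s2; have pk' := normal_peak_gt0 s0.
rewrite normal_pdf0E normal_pdfE// /normal_fun subr0.
rewrite [leRHS]mulrA divfK ?gt_eqF//.
have s20 : 0 < s ^+ 2 by rewrite exprn_gt0.
have [y y0 hx2] : exists2 y, 0 <= y & x ^+ 2 = 4 * s ^+ 2 * y.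
  exists (x ^+ 2 / (s ^+ 2 * 4)); first by rewrite divr_ge0 ?sqr_ge0// mulr_ge0// ltW.
  by field; exact: s0.
have ss1 (a : R) : a *+ 2 = 2 * a by rewrite mulr_natl.
have E1 : - x ^+ 2 / (s ^+ 2 *+ 2) = - (2 * y) by rewrite hx2 ss1; field; exact: s0.
have E2 : - x ^+ 2 / ((2 * s) ^+ 2 *+ 2) = - (y / 2) by rewrite hx2 ss1; field; exact: s0.
rewrite E1 E2.
have hx : `|x| <= (1 + 4 * s ^+ 2) * expR y.
  have hx1 : `|x| <= 1 + x ^+ 2.
    rewrite -[x ^+ 2](real_normK (num_real _)); have := normr_ge0 x; nra.
  apply: le_trans hx1 _; rewrite hx2.
  have D0 : 0 < 1 + 4 * s ^+ 2 by lra.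
  apply: (@le_trans _ _ ((1 + 4 * s ^+ 2) * (1 + y))); last by rewrite ler_pM2l// expR_ge1Dx.
  rewrite mulrDl mul1r mulrDr mulr1; lra.
have h2 : expR (- (2 * y)) <= expR (- (y / 2)) / expR y.
  by rewrite -expRN -expRD ler_expR; lra.
have ey := expR_gt0 y.
apply: (@le_trans _ _ (`|x| * (normal_peak s * (expR (- (y / 2)) / expR y)))).
  by rewrite ler_wpM2l// ler_pM2l.
have -> : `|x| * (normal_peak s * (expR (- (y / 2)) / expR y)) =
   (`|x| / expR y) * (normal_peak s * expR (- (y / 2))) by ring.
rewrite -[leRHS]mulrA; apply: ler_wpM2r; first by rewrite mulr_ge0 ?expR_ge0 ?(ltW pk').
by rewrite ler_pdivrMr.
Qed.

Lemma integrable_bounded_pdf (G : R -> R) (K : R) : measurable_fun setT G -> (forall x, `|G x| <= K) ->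
  mu.-integrable setT (EFin \o (fun x => G x * f x)).
Proof.
move=> mG hG.
have h : mu.-integrable setT (EFin \o (fun x => K * f x)).
  rewrite (_ : _ \o _ = (fun x => K%:E * (f x)%:E)%E); last by apply/funext => x; rewrite /= EFinM.
  by apply: integrableZl => //; exact: integrable_normal_pdf.
apply: le_integrable h => //.
  apply/measurable_EFinP; apply: measurable_funM => //; exact: measurable_normal_pdf.
move=> x _ /=; rewrite lee_fin !normrM; apply: ler_wpM2r => //.
apply: le_trans (hG x) _; exact: ler_norm.
Qed.

Lemma integrable_mul_pdf (G : R -> R) (K : R) : measurable_fun setT G -> (forall x, `|G x| <= K * `|x|) ->
  mu.-integrable setT (EFin \o (fun x => G x * f x)).
Proof.
move=> mG hG; have K0 : 0 <= K by have := le_trans (normr_ge0 _) (hG 1); rewrite normr1 mulr1.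
pose D := (1 + 4 * s ^+ 2) * normal_peak s / normal_peak (2 * s).
have h : mu.-integrable setT (EFin \o (fun x => K * D * normal_pdf 0 (2 * s) x)).
  rewrite (_ : _ \o _ = (fun x => (K * D)%:E * (normal_pdf 0 (2 * s) x)%:E)%E); last by apply/funext => x; rewrite /= EFinM.
  by apply: integrableZl => //; exact: integrable_normal_pdf.
apply: le_integrable h => //.
  apply/measurable_EFinP; apply: measurable_funM => //; exact: measurable_normal_pdf.
move=> x _ /=; rewrite lee_fin normrM (ger0_norm (normal_pdf_ge0 _ _ _)).
apply: le_trans (ler_norm _).
apply: le_trans (ler_wpM2r (normal_pdf_ge0 _ _ _) (hG x)) _.
rewrite -[leLHS]mulrA -[leRHS]mulrA ler_wpM2l//; exact: norm_mul_pdf_le.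
Qed.

(** Mean of [G] under the centred normal law of standard deviation [s], as a Lebesgue integral so
    that calculus applies. *)
Definition NE (G : R -> R) : R := \int[mu]_x (G x * f x).

Lemma measurable_affine (th phi : R) : measurable_fun setT (fun x : R => th * x + phi).
Proof. by apply: measurable_funD => //; exact: measurable_funM. Qed.

Let msin th phi : measurable_fun setT (fun x : R => sin (th * x + phi)).
Proof. by case: (bmf_sin (measurable_affine th phi)). Qed.
Let mcos th phi : measurable_fun setT (fun x : R => cos (th * x + phi)).
Proof. by case: (bmf_cos (measurable_affine th phi)). Qed.

(* Gaussian integration by parts: the derivative of [sin (th x + phi) f x] integrates to 0. *)
Lemma normal_by_parts (th phi : R) :
  NE (fun x => x * sin (th * x + phi)) = s ^+ 2 * th * NE (fun x => cos (th * x + phi)).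
Proof.
have s2 : 0 < s ^+ 2 by rewrite exprn_gt0.
pose F x := sin (th * x + phi) * f x.
pose F' x := (th * cos (th * x + phi) - (x / s ^+ 2) * sin (th * x + phi)) * f x.
have dF (x : R) : is_derive x 1 F (F' x).
  have h := is_derive_normal_pdf x.
  have h1 : is_derive x 1 (fun x : R => sin (th *: x + phi)) (th * cos (th * x + phi)).
    by apply: is_derive_eq; rewrite scaler1 addr0 /GRing.scale/=; ring.
  have h2 := is_deriveM h1 h.
  by apply: (is_derive_eq h2); rewrite /F' /GRing.scale/=; ring.
have i1 : mu.-integrable setT (EFin \o (fun x => cos (th * x + phi) * f x)).
  by apply: (@integrable_bounded_pdf _ 1) => // x; rewrite ler_norml cos_geN1 cos_le1.
have i2 : mu.-integrable setT (EFin \o (fun x => x * sin (th * x + phi) * f x)).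
  apply: (@integrable_mul_pdf _ 1); first exact: measurable_funM.
  by move=> x; rewrite normrM mulrC ler_wpM2r// ler_norml sin_geN1 sin_le1.
have i1' : mu.-integrable setT (EFin \o (fun x => th * (cos (th * x + phi) * f x))).
  rewrite (_ : _ \o _ = (fun x => th%:E * (cos (th * x + phi) * f x)%:E)%E); last by apply/funext => x; rewrite /= -EFinM.
  exact: integrableZl.
have i2' : mu.-integrable setT (EFin \o (fun x => (s ^+ 2)^-1 * (x * sin (th * x + phi) * f x))).
  rewrite (_ : _ \o _ = (fun x => ((s ^+ 2)^-1)%:E * (x * sin (th * x + phi) * f x)%:E)%E); last by apply/funext => x; rewrite /= -EFinM.
  exact: integrableZl.
have iF' : mu.-integrable setT (EFin \o F').
  have h := integrableB measurableT i1' i2'.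
  by apply: eq_integrable h => // x _ /=; rewrite -EFinB /F'; congr EFin; ring.
have cF' : continuous F'.
  move=> x; apply: cvgM; last exact: continuous_normal_pdf.
  apply: cvgB.
    apply: cvgM; first exact: cvg_cst.
    apply: continuous_cvg; first exact: continuous_cos.
    apply: cvgD; last exact: cvg_cst.
    by apply: cvgM; [exact: cvg_cst|exact: cvg_id].
  apply: cvgM; first by apply: cvgM; [exact: cvg_id|exact: cvg_cst].
  apply: continuous_cvg; first exact: continuous_sin.
  apply: cvgD; last exact: cvg_cst.
  by apply: cvgM; [exact: cvg_cst|exact: cvg_id].
have cF : continuous F by move=> x; apply: differentiable_continuous; apply/derivable1_diffP; case: (dF x).
(* Dominated convergence from [[- n - 1, n + 1]], where the integral is a difference of boundary
   values, each at most [K / (n + 1)]. *)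
have h0 : \int[mu]_x F' x = 0.
  have mF' : measurable_fun setT (EFin \o F') by case/integrableP: iF'.
  have mI (n : nat) : measurable_fun setT (fun x => ((F' \_ `[- n.+1%:R, n.+1%:R]) x)%:E).
    apply/measurable_EFinP; apply/(measurable_restrictT _ _).1 => //.
    by apply: measurable_funTS; exact/measurable_EFinP.
  have hp : {ae mu, forall x, setT x -> ((F' \_ `[- n.+1%:R, n.+1%:R]) x)%:E @[n --> \oo] --> (F' x)%:E}.
    apply: aeW => /= x _; apply: cvg_EFin; first exact: nearW.
    apply: cvgn_near_eq; last exact: cvg_cst.
    near=> n; rewrite /patch ifT// inE/= in_itv/= -ler_norml.
    apply: (@le_trans _ _ n%:R); last by rewrite ler_nat.
    near: n; exact: nbhs_infty_ger.
  have hi : mu.-integrable setT (fun x => `|F' x|%:E).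
    exact: (integrable_abse iF').
  have hd : {ae mu, forall x n, setT x -> (`|((F' \_ `[- n.+1%:R, n.+1%:R]) x)%:E| <= `|F' x|%:E)%E}.
    apply: aeW => /= x n _; rewrite lee_fin /patch; case: ifP => // _; by rewrite normr0.
  have [_ _ hc] := @dominated_convergence _ _ _ mu setT measurableT _ _ _ mI mF' hp hi hd.
  have hn (n : nat) : (\int[mu]_x ((F' \_ `[- n.+1%:R, n.+1%:R]) x)%:E = (F n.+1%:R - F (- n.+1%:R))%:E)%E.
    have nn : - n.+1%:R < n.+1%:R :> R by have : (0 : R) < n.+1%:R := ltr0Sn _ n; lra.
    transitivity (\int[mu]_(x in [set` `[(- n.+1%:R : R), (n.+1%:R : R)]%R]) (F' x)%:E)%E.
      by rewrite [RHS]integral_mkcond; apply: eq_integral => x _; rewrite restrict_EFin.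
    rewrite (@continuous_FTC2 _ F' F)//.
    - exact: continuous_subspaceT.
    - split; first by move=> x _; case: (dF x).
      + by apply: cvg_at_right_filter; exact: cF.
      + by apply: cvg_at_left_filter; exact: cF.
    - by move=> x _; rewrite derive1E; case: (dF x).
  have hF0 : F n.+1%:R - F (- n.+1%:R) @[n --> \oo] --> 0.
    pose K := (1 + 4 * s ^+ 2) * normal_peak s / normal_peak (2 * s) * normal_peak (2 * s).
    have s20 : 2 * s != 0 by rewrite mulf_neq0.
    have D0 : 0 <= (1 + 4 * s ^+ 2) * normal_peak s / normal_peak (2 * s).
      by rewrite divr_ge0 ?normal_peak_ge0// mulr_ge0 ?normal_peak_ge0//; lra.
    have K0 : 0 <= K by rewrite mulr_ge0 ?normal_peak_ge0.
    have hK x : `|x| * `|F x| <= K.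
      rewrite /F normrM (ger0_norm (normal_pdf_ge0 _ _ _)).
      apply: (@le_trans _ _ (`|x| * f x)).
        rewrite ler_wpM2l// ler_piMl ?normal_pdf_ge0//.
        by rewrite ler_norml sin_geN1 sin_le1.
      apply: le_trans (norm_mul_pdf_le x) _; rewrite ler_wpM2l//; exact: normal_pdf_ub.
    apply/cvgrPdist_le => e e0; near=> n.
    have n0 : (0 : R) < n.+1%:R by rewrite ltr0n.
    have h1 := hK n.+1%:R; have h2 := hK (- n.+1%:R).
    rewrite normrN in h2; rewrite gtr0_norm// in h1 h2.
    rewrite sub0r normrN (le_trans (ler_normB _ _))//.
    have h3 : n.+1%:R^-1 <= e / (2 * (K + 1)).
      by near: n; apply: near_natSinv_le; rewrite divr_gt0// mulr_gt0//; lra.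
    rewrite -(ler_pM2l n0) mulrDr; apply: le_trans (lerD h1 h2) _.
    have K1 : 0 < 2 * (K + 1) by rewrite mulr_gt0//; lra.
    move: h3; rewrite -[leLHS]div1r ler_pdivrMr// mulrAC ler_pdivlMr// mul1r [_ * n.+1%:R]mulrC.
    by move=> h3; lra.
  have hE : (\int[mu]_x (F' x)%:E = (\int[mu]_x F' x)%:E)%E.
    by rewrite /Rintegral fineK//; exact: integrable_fin_num.
  rewrite hE in hc.
  have hc2 : (F n.+1%:R - F (- n.+1%:R))%:E @[n --> \oo] --> (\int[mu]_x F' x)%:E.
    by move: hc; under eq_fun do rewrite hn.
  have hc3 : F n.+1%:R - F (- n.+1%:R) @[n --> \oo] --> \int[mu]_x F' x by exact: (fine_cvg hc2).
  exact: (cvg_unique _ hc3 hF0).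
have : \int[mu]_x F' x = th * NE (fun x => cos (th * x + phi)) - (s ^+ 2)^-1 * NE (fun x => x * sin (th * x + phi)).
  rewrite /NE -RintegralZl// -RintegralZl// -RintegralB//.
  by apply: eq_Rintegral => x _; rewrite /F'; ring.
rewrite h0 => /esym/eqP; rewrite subr_eq0 => /eqP h.
by rewrite -mulrA h mulrA divff ?mul1r// gt_eqF.
Unshelve. all: by end_near. Qed.

Let intcos th phi : mu.-integrable setT (EFin \o (fun x => cos (th * x + phi) * f x)).
Proof.
by apply: (@integrable_bounded_pdf _ 1) => // x; rewrite ler_norml cos_geN1 cos_le1.
Qed.

Lemma is_derive_normal_fourier (phi th : R) :
  is_derive th 1 (fun th => NE (fun x => cos (th * x + phi))) (- (s ^+ 2 * th) * NE (fun x => cos (th * x + phi))).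
Proof.
pose h (th x : R) := cos (th * x + phi) * f x.
have dh (t x : R) : is_derive t 1 (h ^~ x) (- (x * sin (t * x + phi)) * f x).
  have -> : h ^~ x = (fun t => f x *: cos (x *: t + phi)).
    by apply/funext => u; rewrite /h /GRing.scale/= mulrC [u * x]mulrC.
  apply: is_derive_eq; rewrite scaler1 addr0 /GRing.scale/= [x * t]mulrC; ring.
have d1 t x : partial1of2 h t x = - (x * sin (t * x + phi)) * f x.
  by rewrite partial1of2E; case: (dh t x).
have [u v] := (th - 1, th + 1).
have hI : [set` `]th - 1, th + 1[%R] th by rewrite /= in_itv/=; apply/andP; split; lra.
have hf t : [set` `]th - 1, th + 1[%R] t -> mu.-integrable setT (EFin \o h t) by move=> _; exact: intcos.
have hder t x : [set` `]th - 1, th + 1[%R] t -> setT x -> derivable (h ^~ x) t 1 by move=> _ _; case: (dh t x).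
have G0 x : 0 <= `|x| * f x by rewrite mulr_ge0// normal_pdf_ge0.
have hG : mu.-integrable setT (EFin \o (fun x => `|x| * f x)).
  by apply: (@integrable_mul_pdf _ 1) => // x; rewrite normr_id mul1r.
have hub t x : [set` `]th - 1, th + 1[%R] t -> setT x -> `|partial1of2 h t x| <= `|x| * f x.
  move=> _ _; rewrite d1 normrM (ger0_norm (normal_pdf_ge0 _ _ _)) ler_wpM2r ?normal_pdf_ge0//.
  rewrite normrN normrM ler_piMr//; by rewrite ler_norml sin_geN1 sin_le1.
have D := derivable_under_integral measurableT hI hf hder G0 hG hub.
have DE := differentiation_under_integral measurableT hI hf hder G0 hG hub.
split; first exact: D.
rewrite -derive1E DE.
transitivity (- NE (fun x => x * sin (th * x + phi))).
  rewrite -mulN1r -RintegralZl//; last first.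
    apply: (@integrable_mul_pdf _ 1); first by apply: measurable_funM.
    by move=> x; rewrite normrM mulrC ler_wpM2r// ler_norml sin_geN1 sin_le1.
  by apply: eq_Rintegral => x _; rewrite d1; ring.
by rewrite normal_by_parts mulNr.
Qed.

(** Integration by parts gives [psi' = - s ^ 2 t psi]; multiplied by [exp (t ^ 2 s ^ 2 / 2)], [psi]
    becomes constant. *)
Lemma normal_fourier (th phi : R) :
  NE (fun x => cos (th * x + phi)) = expR (- (th ^+ 2 * s ^+ 2 / 2)) * cos phi.
Proof.
pose psi t := NE (fun x => cos (t * x + phi)).
pose k t := psi t * expR (t ^+ 2 * (s ^+ 2 / 2)).
have dk (t : R) : is_derive t 1 k 0.
  have h1 := is_derive_normal_fourier phi t.
  have h2 : is_derive t 1 (fun t : R => expR (t ^+ 2 * (s ^+ 2 / 2))) (t * s ^+ 2 * expR (t ^+ 2 * (s ^+ 2 / 2))).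
    apply: is_derive_eq; rewrite /GRing.scale/=; lra.
  apply: (is_derive_eq (is_deriveM h1 h2)); rewrite /GRing.scale/= -/(psi t); ring.
have hk : k th = k 0 by apply: is_derive_0_is_cst.
have k0 : k 0 = cos phi.
  rewrite /k expr0n mul0r expR0 mulr1 /psi /NE.
  transitivity (\int[mu]_x (cos phi * f x)); first by apply: eq_Rintegral => x _; rewrite mul0r add0r.
  rewrite RintegralZl//; last exact: integrable_normal_pdf.
  by rewrite /Rintegral integral_normal_pdf mulr1.
rewrite -/(psi th) -k0 -hk /k mulrCA -expRD -[LHS]mulr1; congr (_ * _).
by rewrite -[LHS]expR0; congr expR; lra.
Qed.

Lemma NE_dist (G1 G2 : R -> R) (K e : R) : measurable_fun setT G1 -> measurable_fun setT G2 ->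
  (forall x, `|G1 x| <= K) -> (forall x, `|G2 x| <= K) -> (forall x, `|G1 x - G2 x| <= e) -> `|NE G1 - NE G2| <= e.
Proof.
move=> m1 m2 h1 h2 h12.
have i1 := integrable_bounded_pdf m1 h1; have i2 := integrable_bounded_pdf m2 h2.
have i12 : mu.-integrable setT (EFin \o (fun x => (G1 x - G2 x) * f x)).
  by apply: (@integrable_bounded_pdf _ e) => //; exact: measurable_funB.
rewrite /NE -RintegralB//.
rewrite (_ : \int[mu]_x (G1 x * f x - G2 x * f x) = \int[mu]_x ((G1 x - G2 x) * f x)); last first.
  by apply: eq_Rintegral => x _; rewrite mulrBl.
apply: le_trans (le_normr_Rintegral _ i12) _ => //.
have -> : e = \int[mu]_x (e * f x).
  rewrite RintegralZl//; last exact: integrable_normal_pdf.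
  by rewrite /Rintegral integral_normal_pdf mulr1.
apply: le_Rintegral => //.
- have := integrable_abse i12; apply: eq_integrable => // x _ /=.
- rewrite (_ : _ \o _ = (fun x => e%:E * (f x)%:E)%E); last by apply/funext => x; rewrite /= EFinM.
  by apply: integrableZl => //; exact: integrable_normal_pdf.
- move=> x _; rewrite normrM (ger0_norm (normal_pdf_ge0 _ _ _)) ler_wpM2r ?normal_pdf_ge0//.
Qed.

End normal_fourier.

(** * Wiener process at random times *)

Section extension_from_indicators.
Context {R : realType} {d : measure_display} {Om : measurableType d} (P : probability Om R).

Lemma measurable_quant n (G : R -> R) : measurable_fun setT G -> measurable_fun setT (fun x => quant n (G x)).
Proof.
move=> mG; rewrite (_ : (fun x => _) = (fun z : int => z%:~R / n.+1%:R) \o (fun x => floor (n.+1%:R * G x)))//.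
apply: measurable_fun_count => z.
have : measurable_fun setT (fun x => n.+1%:R * G x) by exact: measurable_funM.
by move/(_ measurableT _ (measurable_floor_eq z)); rewrite setTI.
Qed.

Lemma NE_indic (s : R) (B : set R) : measurable B -> fine (normal_prob 0 s B) = NE s (\1_B).
Proof.
move=> mB; rewrite /normal_prob /NE /Rintegral; congr fine; rewrite [LHS]integral_mkcond.
apply: eq_integral => x _; rewrite /patch indicE; case: ifP => _; by rewrite ?mul1r ?mul0r.
Qed.

(** [X] carries all the other information and [cst] is its mean; the hypothesis says that [D] is
    normal and decoupled from [X]. Rounding [G] reduces to Borel sets, as in [Ex_sub_ext]. *)
Lemma Ex_NE_ext (s cst : R) (X D : Om -> R) (G : R -> R) (M0 : R) : 0 < s -> bmf X -> measurable_fun setT D ->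
  (forall B, measurable B -> Ex P (fun w => X w * \1_B (D w)) = cst * NE s (\1_B)) ->
  measurable_fun setT G -> (forall x, `|G x| <= M0) ->
  Ex P (fun w => X w * G (D w)) = cst * NE s G.
Proof.
move=> s0 hX mD hB mG hM0.
have [K hK] : exists K : nat, forall x, `|G x| <= K%:R.
  exists (truncn M0).+1 => x; apply: le_trans (hM0 x) _; apply: ltW; exact: truncnS_gt.
have [_ [MX hMX]] := hX.
have mS n z : measurable [set x | floor (n.+1%:R * G x) = z].
  have : measurable_fun setT (fun x => n.+1%:R * G x) by exact: measurable_funM.
  by move/(_ measurableT _ (measurable_floor_eq z)); rewrite setTI.
pose S n z : set R := [set x | floor (n.+1%:R * G x) = z].
have qE n x : quant n (G x) = \sum_(j < (2 * (K * n.+1)).+2) ((j%:~R - (K * n.+1)%:R - 1) / n.+1%:R) *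
       \1_(S n (j%:Z - (K * n.+1)%:Z - 1)) x.
  by rewrite (quant_sum n (hK x)); apply: eq_bigr => j _; rewrite !indicE.
have bI (B : set R) : measurable B -> bmf (fun w => \1_B (D w) : R).
  move=> mB; split; first by apply: measurableT_comp => //; exact: measurable_indic.
  by exists 1 => w; rewrite indicE; case: (_ \in _); rewrite ?normr1 ?normr0.
have iI (B : set R) : measurable B -> (@lebesgue_measure R).-integrable setT (EFin \o (fun x => \1_B x * normal_pdf 0 s x)).
  move=> mB; apply: (@integrable_bounded_pdf _ _ _ 1).
    exact: measurable_indic.
  by move=> w; rewrite indicE; case: (_ \in _); rewrite ?normr1 ?normr0.
have key n : Ex P (fun w => X w * quant n (G (D w))) = cst * NE s (fun x => quant n (G x)).
  transitivity (\sum_(j < (2 * (K * n.+1)).+2) ((j%:~R - (K * n.+1)%:R - 1) / n.+1%:R) *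
       Ex P (fun w => X w * \1_(S n (j%:Z - (K * n.+1)%:Z - 1)) (D w))).
    transitivity (Ex P (fun w => \sum_(j < (2 * (K * n.+1)).+2) ((j%:~R - (K * n.+1)%:R - 1) / n.+1%:R) *
       (X w * \1_(S n (j%:Z - (K * n.+1)%:Z - 1)) (D w)))).
      congr (Ex P _); apply/funext => w; rewrite qE mulr_sumr; apply: eq_bigr => j _; exact: mulrCA.
    rewrite Ex_sum; last by move=> j _; apply: bmfZ; apply: bmfM => //; apply: bI; exact: mS.
    by apply: eq_bigr => j _; rewrite ExZ//; apply: bmfM => //; apply: bI; exact: mS.
  transitivity (cst * \sum_(j < (2 * (K * n.+1)).+2) ((j%:~R - (K * n.+1)%:R - 1) / n.+1%:R) *
       NE s (\1_(S n (j%:Z - (K * n.+1)%:Z - 1)))).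
    rewrite mulr_sumr; apply: eq_bigr => j _; rewrite hB; last exact: mS.
    exact: mulrCA.
  congr (_ * _); rewrite /NE.
  have cI (J : Type) (l : seq J) (a : J -> R) (B : J -> set R) : (forall j, measurable (B j)) ->
     \sum_(j <- l) a j * \int[lebesgue_measure]_x (\1_(B j) x * normal_pdf 0 s x) =
     \int[lebesgue_measure]_x ((\sum_(j <- l) a j * \1_(B j) x) * normal_pdf 0 s x) /\
     (@lebesgue_measure R).-integrable setT (EFin \o (fun x => (\sum_(j <- l) a j * \1_(B j) x) * normal_pdf 0 s x)).
    move=> mB; elim: l => [|j l [ih1 ih2]].
      split.
        rewrite big_nil; under eq_Rintegral do rewrite big_nil mul0r.
        by rewrite /Rintegral integral0.
      rewrite (_ : _ \o _ = (fun=> 0%E)); first exact: integrable0.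
      by apply/funext => x; rewrite /= big_nil mul0r.
    have ij : (@lebesgue_measure R).-integrable setT (EFin \o (fun x => a j * (\1_(B j) x * normal_pdf 0 s x))).
      rewrite (_ : _ \o _ = (fun x => (a j)%:E * (\1_(B j) x * normal_pdf 0 s x)%:E)%E); last by apply/funext => x; rewrite /= EFinM.
      by apply: integrableZl => //; exact: iI.
    split.
      rewrite big_cons ih1 -RintegralZl//; last exact: iI.
      rewrite -RintegralD//; apply: eq_Rintegral => x _.
      by rewrite big_cons mulrDl mulrA.
    have := integrableD measurableT ij ih2; apply: eq_integrable => // x _ /=.
    by rewrite -EFinD big_cons mulrDl mulrA.
  rewrite (cI _ _ (fun j : 'I__ => _) (fun j : 'I__ => _) (fun j => mS _ _)).1.
  by apply: eq_Rintegral => x _; rewrite qE.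
have mq n := measurable_quant n mG.
have qb n x : `|quant n (G x)| <= K%:R + 1.
  rewrite -[quant n (G x)](subrK (G x)) (le_trans (ler_normD _ _))// addrC lerD//.
  by apply: le_trans (quant_dist _ _) _; rewrite invf_le1 ?ler1n// ltr0n.
have Gb x : `|G x| <= K%:R + 1 by apply: le_trans (hK x) _; rewrite lerDl.
have bq n : bmf (fun w => quant n (G (D w))).
  split; last by exists (K%:R + 1) => w.
  exact: (measurableT_comp (mq n) mD).
have bG : bmf (fun w => G (D w)).
  split; last by exists (K%:R + 1) => w.
  exact: (measurableT_comp mG mD).
have l1 : Ex P (fun w => X w * quant n (G (D w))) @[n --> \oo] --> Ex P (fun w => X w * G (D w)).
  have MU0 : 0 < `|MX| + 1 by have := normr_ge0 MX; lra.
  apply/cvgrPdist_le => e e0; near=> n.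
  apply: le_trans (_ : n.+1%:R^-1 * (`|MX| + 1) <= _).
    apply: Ex_dist; [exact: bmfM|exact: bmfM|].
    move=> w; rewrite -mulrBr normrM mulrC ler_pM//; first by rewrite distrC; exact: quant_dist.
    by have := hMX w; have := ler_norm MX; lra.
  rewrite -ler_pdivlMr//.
  by near: n; apply: near_natSinv_le; rewrite divr_gt0.
have l2 : cst * NE s (fun x => quant n (G x)) @[n --> \oo] --> cst * NE s G.
  apply: cvgM; first exact: cvg_cst.
  apply/cvgrPdist_le => e e0; near=> n.
  apply: (@le_trans _ _ n.+1%:R^-1); last by near: n; exact: near_natSinv_le.
  apply: (@NE_dist _ s _ _ (K%:R + 1)) => // x; rewrite distrC; exact: quant_dist.
have l1' : cst * NE s (fun x => quant n (G x)) @[n --> \oo] --> Ex P (fun w => X w * G (D w)).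
  apply: cvgn_near_eq; last exact: l1.
  by apply: nearW => n; rewrite key.
exact: (cvg_unique _ l1' l2).
Unshelve. all: by end_near. Qed.

End extension_from_indicators.

Section wiener.
Context {R : realType} {d d' : measure_display} {Om : measurableType d} {Om' : measurableType d'}.
Context (P : probability Om R) (P' : probability Om' R) (W : R -> Om' -> R) (Z' : Om' -> R) (Zl : Om -> R).
Hypothesis mZ' : measurable_fun setT Z'.
Hypothesis mZl : measurable_fun setT Zl.
Hypothesis mW : forall t, measurable_fun setT (W t).
Hypothesis W0 : forall w, W 0 w = 0.
Hypothesis cW : forall w, {within `[0, +oo[%classic, continuous (fun t => W t w)}.
Hypothesis lawW : forall (m : nat) (ts : nat -> R) (A : set R) (B : nat -> set R),
        ts 0%N = 0 -> (forall j, (j < m)%N -> ts j < ts j.+1) ->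
        measurable A -> (forall j, measurable (B j)) ->
        P' (Z' @^-1` A `&`
            [set w | forall j, (1 <= j <= m)%N -> B j (W (ts j) w - W (ts j.-1) w)])
        = (P (Zl @^-1` A) *
           \prod_(1 <= j < m.+1) normal_prob 0 (Num.sqrt (ts j - ts j.-1)) (B j))%E.

Lemma fine_prode (J : Type) (s : seq J) (F : J -> \bar R) : (forall j, F j \is a fin_num) ->
  (\prod_(j <- s) F j)%E \is a fin_num /\ fine (\prod_(j <- s) F j)%E = \prod_(j <- s) fine (F j).
Proof.
move=> hF; elim: s => [|j s [ih1 ih2]]; first by rewrite !big_nil.
by rewrite !big_cons fin_numM//; split => //; rewrite fineM// ih2.
Qed.

Lemma measurable_cylinder (ts : nat -> R) (k m : nat) (A : set R) (B : nat -> set R) :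
  measurable A -> (forall j, measurable (B j)) ->
  measurable (Z' @^-1` A `&` [set w | forall j, (k < j <= m)%N -> B j (W (ts j) w - W (ts j.-1) w)]).
Proof.
move=> mA mB; apply: measurableI; first by rewrite -[X in measurable X]setTI; exact: mZ'.
rewrite (_ : [set w | _] = \bigcap_j (if (k < j <= m)%N then (fun w => W (ts j) w - W (ts j.-1) w) @^-1` B j else setT)).
  apply: bigcapT_measurable => j; case: ifP => // _.
  rewrite -[X in measurable X]setTI; have : measurable_fun setT (fun w => W (ts j) w - W (ts j.-1) w) by exact: measurable_funB.
  by apply.
apply/seteqP; split => w /= h j.
  by move=> _; case: ifP => // hj; exact: h.
by move=> hj; have := h j I; rewrite hj.
Qed.

(** Induction on the number [k] of increments tested by the cosine. The later ones are still tested
    by Borel sets, so that the law of the next one can be read off; at [k = 0] this is the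
    hypothesis on the law. *)
Lemma wiener_increments_cos (m : nat) (ts beta : nat -> R) (A : set R) (k : nat) :
  ts 0%N = 0 -> (forall j, (j < m)%N -> ts j < ts j.+1) -> measurable A -> (k <= m)%N ->
  forall (phi : R) (B : nat -> set R), (forall j, measurable (B j)) ->
  Ex P' (fun w => \1_(Z' @^-1` A `&`
            [set w | forall j, (k < j <= m)%N -> B j (W (ts j) w - W (ts j.-1) w)]) w *
     cos (phi + \sum_(1 <= j < k.+1) beta j * (W (ts j) w - W (ts j.-1) w))) =
  fine (P (Zl @^-1` A)) * \prod_(k.+1 <= j < m.+1) NE (Num.sqrt (ts j - ts j.-1)) (\1_(B j)) *
    (expR (- ((\sum_(1 <= j < k.+1) beta j ^+ 2 * (ts j - ts j.-1)) / 2)) * cos phi).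
Proof.
move=> ts0 tsi mA; elim: k => [|k ih] km phi B mB.
  under eq_fun do rewrite big_geq// addr0 mulrC.
  rewrite [X in expR (- (X / 2))]big_geq// mul0r oppr0 expR0 mul1r.
  have mS : measurable (Z' @^-1` A `&` [set w | forall j, (0 < j <= m)%N -> B j (W (ts j) w - W (ts j.-1) w)]).
    exact: measurable_cylinder.
  have hfin j : normal_prob 0 (Num.sqrt (ts j - ts j.-1)) (B j) \is a fin_num.
    exact: (@fin_num_measure _ _ _ (normal_prob 0 (Num.sqrt (ts j - ts j.-1))) _ (mB j)).
  rewrite ExZ; last exact: bmf_indic.
  rewrite Ex_indic// lawW// fineM; last 2 first.
  - by apply: fin_num_measure; rewrite -[X in measurable X]setTI; exact: mZl.
  - by apply: (fine_prode _ hfin).1.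
  rewrite mulrC; congr (_ * _ * _).
  rewrite (fine_prode _ hfin).2.
  by apply: eq_bigr => j _; rewrite NE_indic.
set s := Num.sqrt (ts k.+1 - ts k).
have s0 : 0 < s by rewrite sqrtr_gt0 subr_gt0; exact: tsi.
have s2 : s ^+ 2 = ts k.+1 - ts k by rewrite sqr_sqrtr// subr_ge0 ltW// tsi.
pose D w := W (ts k.+1) w - W (ts k) w.
pose S := Z' @^-1` A `&` [set w | forall j, (k.+1 < j <= m)%N -> B j (W (ts j) w - W (ts j.-1) w)].
have mS : measurable S by exact: measurable_cylinder.
have mD : measurable_fun setT D by exact: measurable_funB.
pose L w := \sum_(1 <= j < k.+1) beta j * (W (ts j) w - W (ts j.-1) w).
have mL : measurable_fun setT L.
  by rewrite /L; apply: measurable_sum => j; apply: measurable_funM => //; exact: measurable_funB.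
pose E := expR (- ((\sum_(1 <= j < k.+1) beta j ^+ 2 * (ts j - ts j.-1)) / 2)).
pose C := fine (P (Zl @^-1` A)) * \prod_(k.+2 <= j < m.+1) NE (Num.sqrt (ts j - ts j.-1)) (\1_(B j)).
(* Letting the Borel set of the increment [k.+1] vary exposes its law jointly with all the rest. *)
have step phi' (B0 : set R) : measurable B0 ->
    Ex P' (fun w => \1_S w * cos (phi' + L w) * \1_B0 (D w)) = C * (E * cos phi') * NE s (\1_B0).
  move=> mB0; pose B' j := if j == k.+1 then B0 else B j.
  have mB' j : measurable (B' j) by rewrite /B'; case: ifP.
  have := ih (ltnW km) phi' B' mB'.
  have -> : \prod_(k.+1 <= j < m.+1) NE (Num.sqrt (ts j - ts j.-1)) (\1_(B' j)) =
      NE s (\1_B0) * \prod_(k.+2 <= j < m.+1) NE (Num.sqrt (ts j - ts j.-1)) (\1_(B j)).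
    rewrite big_ltn//; congr (_ * _); first by rewrite /B' eqxx.
    by rewrite big_nat [RHS]big_nat; apply: eq_bigr => j /andP[jk _]; rewrite /B' gtn_eqF.
  rewrite -/E.
  move=> h; transitivity (fine (P (Zl @^-1` A)) *
     (NE s (\1_B0) * \prod_(k.+2 <= j < m.+1) NE (Num.sqrt (ts j - ts j.-1)) (\1_(B j))) * (E * cos phi')).
    rewrite -h; congr (Ex P' _); apply/funext => w; rewrite mulrAC; congr (_ * _).
    rewrite -[\1_B0 (D w)]/(\1_(D @^-1` B0) w) -[LHS]/((\1_S \* \1_(D @^-1` B0)) w) -indicI.
    congr (\1_ _ w); apply/seteqP; split => w' /=.
      move=> [[hA hj] hD]; split => // j /andP[kj jm]; rewrite /B'; case: eqVneq => [->//|jk].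
      by apply: hj; rewrite jm andbT ltn_neqAle eq_sym jk.
    move=> [hA hj]; split; first split => //.
      move=> j /andP[kj jm]; have := hj j; rewrite /B' gtn_eqF//; apply; by rewrite jm andbT ltnW.
    by have := hj k.+1; rewrite /B' eqxx; apply; rewrite ltnSn.
  by rewrite /C; ring.
have bX phi' : bmf (fun w => \1_S w * cos (phi' + L w)).
  by apply: bmfM; [exact: bmf_indic|apply: bmf_cos; exact: measurable_funD].
have hc phi' psi : Ex P' (fun w => \1_S w * cos (phi' + L w) * cos (beta k.+1 * D w + psi)) =
    C * (E * cos phi') * (expR (- (beta k.+1 ^+ 2 * s ^+ 2 / 2)) * cos psi).
  rewrite -(normal_fourier s0); apply: (@Ex_NE_ext _ _ _ P' s _ _ D (fun x => cos (beta k.+1 * x + psi)) 1) => //.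
  - exact: step.
  - by case: (bmf_cos (measurable_affine (beta k.+1) psi)).
  - by move=> x; rewrite ler_norml cos_geN1 cos_le1.
(* Addition formula with the sines written as cosines shifted by [pi / 2], the form covered by [hc].
   The second term then vanishes through [cos (- pi / 2) = 0]. *)
have -> : (fun w => \1_S w * cos (phi + \sum_(1 <= j < k.+2) beta j * (W (ts j) w - W (ts j.-1) w))) =
   (fun w => \1_S w * cos (phi + L w) * cos (beta k.+1 * D w + 0) -
             \1_S w * cos (phi - pi / 2 + L w) * cos (beta k.+1 * D w - pi / 2)).
  apply/funext => w; rewrite big_nat_recr//= -/(L w) -/(D w) addrA (cosD (phi + L w)) addr0.
  by rewrite [phi - _ + _]addrAC !cosBpihalf; ring.
rewrite ExB; last 2 first.
- by apply: bmfM => //; apply: bmf_cos; apply: measurable_funD => //; exact: measurable_funM.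
- by apply: bmfM => //; apply: bmf_cos; apply: measurable_funD => //; exact: measurable_funM.
rewrite !hc cosN cos_pihalf !mulr0 subr0 cos0 mulr1.
rewrite [\sum_(1 <= j < k.+2) _]big_nat_recr//= s2 -/C.
rewrite mulrDl opprD expRD -/E; ring.
Qed.

Lemma telescope_le (x : nat -> R) (n q : nat) : (n <= q)%N ->
  \sum_(1 <= l < q.+1) (l <= n)%N%:R * (x l - x l.-1) = x n - x 0%N.
Proof.
move=> nq; rewrite (big_cat_nat _ (n := n.+1))//=.
rewrite [X in _ + X]big_nat [X in _ + X]big1 ?addr0; last first.
  by move=> l /andP[nl _]; rewrite leqNgt nl mul0r.
rewrite big_add1/= -(telescope_sumr x (leq0n n)) big_nat [RHS]big_nat; apply: eq_bigr => l /andP[_ ln].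
by rewrite ln mul1r.
Qed.

Lemma law_Z' (A : set R) : measurable A -> Ex P' (\1_(Z' @^-1` A)) = fine (P (Zl @^-1` A)).
Proof.
move=> mA.
have := @wiener_increments_cos 0 (fun=> 0) (fun=> 0) A 0 erefl _ mA (leqnn 0) 0 (fun=> setT) (fun=> measurableT).
rewrite !big_geq// mul0r oppr0 expR0 cos0 !mulr1 => <- //; congr (Ex P' _); apply/funext => w.
rewrite big_geq// addr0 cos0 mulr1; by congr (\1_ _ w); apply/seteqP; split => w' /=; [move=> h; split|case].
Qed.

(** The values of [W] are rewritten through increments by Abel summation: [beta l] is the total
    weight of the times that come after the increment [l]. *)
Lemma wiener_fixed_cos (q : nat) (s th : nat -> R) (u : R) (A : set R) (phi : R) :
  s 0%N = 0 -> (forall j, (j < q)%N -> s j < s j.+1) -> 0 <= u -> measurable A ->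
  Ex P' (fun w => \1_(Z' @^-1` A) w * cos (phi + \sum_(i < q) th i * W (u * s i.+1) w)) =
  fine (P (Zl @^-1` A)) *
   (expR (- (u * (\sum_(i < q) \sum_(j < q) th i * th j * s (minn i j).+1) / 2)) * cos phi).
Proof.
(* For [u = 0] the times are no longer strictly increasing; every value of [W] is then 0 and only
   the law of [Z'] remains. *)
move=> s0 si; rewrite le_eqVlt => /predU1P[<-|u0] mA.
  rewrite mul0r mul0r oppr0 expR0 mul1r -law_Z'// mulrC -ExZ; last first.
    by apply: bmf_indic; rewrite -[X in measurable X]setTI; exact: mZ'.
  congr (Ex P' _); apply/funext => w; rewrite mulrC big1 ?addr0// => i _.
  by rewrite mul0r W0 mulr0.
pose beta l := \sum_(i < q) th i * (l <= i.+1)%N%:R.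
pose ts j := u * s j.
have ts0 : ts 0%N = 0 by rewrite /ts s0 mulr0.
have tsi j : (j < q)%N -> ts j < ts j.+1 by move=> jq; rewrite /ts ltr_pM2l// si.
have := @wiener_increments_cos q ts beta A q ts0 tsi mA (leqnn q) phi (fun=> setT) (fun=> measurableT).
have sumE (x : nat -> R) : x 0%N = 0 -> \sum_(1 <= l < q.+1) beta l * (x l - x l.-1) = \sum_(i < q) th i * x i.+1.
  move=> x0; rewrite /beta; under eq_bigr do rewrite mulr_suml.
  rewrite exchange_big/=; apply: eq_bigr => i _.
  under eq_bigr do rewrite -mulrA; rewrite -mulr_sumr telescope_le ?ltn_ord// x0 subr0//.
have -> : \sum_(1 <= j < q.+1) beta j ^+ 2 * (ts j - ts j.-1) =
    u * \sum_(i < q) \sum_(j < q) th i * th j * s (minn i j).+1.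
  rewrite mulr_sumr.
  transitivity (\sum_(1 <= l < q.+1) \sum_(i < q) \sum_(j < q) th i * th j *
     ((l <= (minn i j).+1)%N%:R * (ts l - ts l.-1))).
    apply: eq_bigr => l _; rewrite expr2 {1 2}/beta big_distrlr/= mulr_suml; apply: eq_bigr => i _.
    rewrite mulr_suml; apply: eq_bigr => j _.
    by rewrite -minnSS leq_min -mulnb natrM; ring.
  rewrite exchange_big/=; apply: eq_bigr => i _; rewrite exchange_big/= mulr_sumr; apply: eq_bigr => j _.
  rewrite -mulr_sumr telescope_le; last by rewrite (leq_trans _ (ltn_ord i))// ltnS geq_minl.
  by rewrite ts0 subr0 /ts; ring.
rewrite [X in _ = _ * X * _](big_geq)// mulr1 => <-; congr (Ex P' _); apply/funext => w.
congr (_ * cos (phi + _)).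
  congr (\1_ _ w); apply/seteqP; split => w' /=; last by case.
  by move=> h; split => // j; case: (ltnP q j).
by rewrite (sumE (fun l => W (ts l) w)) //= ts0 W0.
Qed.

Lemma W_cvg (w : Om') (v_ : nat -> R) (v : R) : (forall n, 0 <= v_ n) -> 0 <= v -> v_ n @[n --> \oo] --> v ->
  W (v_ n) w @[n --> \oo] --> W v w.
Proof.
move=> v0 vv hv; have /continuous_within_itvcyP := @cW w.
move=> [hc h0]; have [ve|vpos] := eqVneq v 0; last first.
  have vin : v \in `]0, +oo[%R by rewrite in_itv/= andbT lt0r vpos.
  exact: (@continuous_cvg _ _ _ _ _ _ (fun t => W t w) v (hc v vin) hv).
subst v; apply/cvgrPdist_le => e e0.
have := (cvgrPdist_le _ _).1 h0 _ e0; rewrite near_withinE => -[dl dl0 hdl].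
have [K _ hK] := (cvgrPdist_lt _ _).1 hv _ dl0.
exists K => // n /= Kn; have [->|vn] := eqVneq (v_ n) 0; first by rewrite subrr normr0 ltW.
apply: hdl; first exact: hK.
by rewrite /= lt0r vn v0.
Qed.

(** The speed [u (Z')] is rounded down to finitely many levels; on each level it is deterministic
    and [wiener_fixed_cos] applies with the level set as event. Path continuity removes the
    rounding. *)
Lemma wiener_random_cos (q : nat) (s th : nat -> R) (u : R -> R) (K : nat) (phi : R) :
  s 0%N = 0 -> (forall j, (j < q)%N -> s j < s j.+1) -> (forall j, 0 <= s j) ->
  measurable_fun setT u -> (forall z, 0 <= u z <= K%:R) ->
  Ex P' (fun w => cos (phi + \sum_(i < q) th i * W (u (Z' w) * s i.+1) w)) =
  Ex P (fun w => expR (- (u (Zl w) * (\sum_(i < q) \sum_(j < q) th i * th j * s (minn i j).+1) / 2)) * cos phi).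
Proof.
move=> s0 si sge mu_ u01.
set Q := \sum_(i < q) \sum_(j < q) th i * th j * s (minn i j).+1.
pose v n z : R := (truncn (n.+1%:R * u z))%:R / n.+1%:R.
have n0 n : (0 : R) < n.+1%:R by rewrite ltr0n.
have u0 z : 0 <= u z by have /andP[] := u01 z.
have uK z : u z <= K%:R by have /andP[] := u01 z.
have nu0 n z : 0 <= n.+1%:R * u z by rewrite mulr_ge0.
have v0 n z : 0 <= v n z by rewrite divr_ge0.
have vu n z : v n z <= u z.
  by rewrite ler_pdivrMr// [u z * _]mulrC; have /andP[] := truncn_itv (nu0 n z).
have uv n z : u z - n.+1%:R^-1 <= v n z.
  have /andP[_ h] := truncn_itv (nu0 n z); rewrite -[X in _ < X]natr1 in h.
  rewrite /v ler_pdivlMr//.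
  have X (a x : R) : a != 0 -> (x - a^-1) * a = a * x - 1 by move=> ?; field.
  by rewrite X ?gt_eqF//; lra.
have v_cvg z : v n z @[n --> \oo] --> u z.
  apply/cvgrPdist_le => e e0; near=> n.
  have h1 := vu n z; have h2 := uv n z.
  rewrite ger0_norm ?subr_ge0//; apply: (@le_trans _ _ n.+1%:R^-1); first by rewrite lerBlDr -lerBlDl.
  near: n; exact: near_natSinv_le.
pose A n j : set R := [set z | truncn (n.+1%:R * u z) = j].
have mA n j : measurable (A n j).
  rewrite (_ : A n j = setT `&` (fun z => n.+1%:R * u z) @^-1` `[j%:R, j.+1%:R[%classic).
    have : measurable_fun setT (fun z => n.+1%:R * u z) by exact: measurable_funM.
    by apply.
  rewrite setTI; apply/seteqP; split => z /=; rewrite in_itv/=.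
    by move=> <-; exact: truncn_itv.
  by move=> h; apply: truncn_def.
pose J n := (K * n.+1).+1.
have dec n z (F : nat -> R) : F (truncn (n.+1%:R * u z)) = \sum_(j < J n) \1_(A n j) z * F j.
  have hj : (truncn (n.+1%:R * u z) < J n)%N.
    rewrite /J ltnS -(ler_nat R) natrM [K%:R * _]mulrC.
    by have /andP[h _] := truncn_itv (nu0 n z); apply: le_trans h _; rewrite ler_pM2l.
  rewrite (bigD1 (Ordinal hj))//= indicE mem_set// mul1r big1 ?addr0//.
  move=> j /eqP ne; rewrite indicE memNset ?mul0r//= => e; apply: ne; exact: val_inj.
have mc (x : R) : bmf (fun w => cos (phi + \sum_(i < q) th i * W (x * s i.+1) w)).
  apply: bmf_cos; apply: measurable_funD => //; apply: measurable_sum => i.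
  exact: measurable_funM.
have mZA n j : measurable (Z' @^-1` A n j) by rewrite -[X in measurable X]setTI; exact: mZ'.
have mZlA n j : measurable (Zl @^-1` A n j) by rewrite -[X in measurable X]setTI; exact: mZl.
have stepL n w : cos (phi + \sum_(i < q) th i * W (v n (Z' w) * s i.+1) w) =
    \sum_(j < J n) \1_(Z' @^-1` A n j) w * cos (phi + \sum_(i < q) th i * W (j%:R / n.+1%:R * s i.+1) w).
  by rewrite (dec n (Z' w) (fun j => cos (phi + \sum_(i < q) th i * W (j%:R / n.+1%:R * s i.+1) w))).
have stepR n w : expR (- (v n (Zl w) * Q / 2)) * cos phi =
    \sum_(j < J n) \1_(Zl @^-1` A n j) w * (expR (- (j%:R / n.+1%:R * Q / 2)) * cos phi).
  by rewrite (dec n (Zl w) (fun j => expR (- (j%:R / n.+1%:R * Q / 2)) * cos phi)).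
have bL n : bmf (fun w => cos (phi + \sum_(i < q) th i * W (v n (Z' w) * s i.+1) w)).
  under eq_fun do rewrite stepL; apply: bmf_sum => j _; apply: bmfM => //; exact: bmf_indic.
have bR n : bmf (fun w => expR (- (v n (Zl w) * Q / 2)) * cos phi).
  under eq_fun do rewrite stepR; apply: bmf_sum => j _; apply: bmfZr; exact: bmf_indic.
have key n : Ex P' (fun w => cos (phi + \sum_(i < q) th i * W (v n (Z' w) * s i.+1) w)) =
    Ex P (fun w => expR (- (v n (Zl w) * Q / 2)) * cos phi).
  under eq_fun do rewrite stepL.
  rewrite Ex_sum; last by move=> j _; apply: bmfM => //; exact: bmf_indic.
  under [in RHS]eq_fun do rewrite stepR.
  rewrite Ex_sum; last by move=> j _; apply: bmfZr; exact: bmf_indic.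
  apply: eq_bigr => j _; rewrite wiener_fixed_cos// ?divr_ge0// -Ex_indic// mulrC -ExZ; last exact: bmf_indic.
  by congr (Ex P _); apply/funext => w; rewrite mulrC.
have limL : Ex P' (fun w => cos (phi + \sum_(i < q) th i * W (v n (Z' w) * s i.+1) w)) @[n --> \oo] -->
    Ex P' (fun w => cos (phi + \sum_(i < q) th i * W (u (Z' w) * s i.+1) w)).
  have hp w : cos (phi + \sum_(i < q) th i * W (v n (Z' w) * s i.+1) w) @[n --> \oo] -->
      cos (phi + \sum_(i < q) th i * W (u (Z' w) * s i.+1) w).
    apply: continuous_cvg; first exact: continuous_cos.
    apply: cvgD; first exact: cvg_cst.
    apply: cvgn_sum => i; apply: cvgM; first exact: cvg_cst.
    apply: W_cvg; [by move=> n; rewrite mulr_ge0|by rewrite mulr_ge0|].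
    by apply: cvgM => //; exact: cvg_cst.
  apply: (@Ex_cvg _ _ _ P' _ _ 1).
  - by move=> n; case: (bL n).
  - apply: (@measurable_fun_cvg _ _ _ _ (fun n w => cos (phi + \sum_(i < q) th i * W (v n (Z' w) * s i.+1) w))) => //.
    by move=> n; case: (bL n).
  - by move=> n w; rewrite ler_norml cos_geN1 cos_le1.
  - by apply: aeW => w; exact: hp.
have limR : Ex P (fun w => expR (- (v n (Zl w) * Q / 2)) * cos phi) @[n --> \oo] -->
    Ex P (fun w => expR (- (u (Zl w) * Q / 2)) * cos phi).
  have hp w : expR (- (v n (Zl w) * Q / 2)) * cos phi @[n --> \oo] --> expR (- (u (Zl w) * Q / 2)) * cos phi.
    apply: cvgM; last exact: cvg_cst.
    apply: continuous_cvg; first exact: continuous_expR.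
    apply: cvgN; apply: cvgM; last exact: cvg_cst.
    by apply: cvgM => //; exact: cvg_cst.
  apply: (@Ex_cvg _ _ _ P _ _ (expR (K%:R * `|Q| / 2))).
  - by move=> n; case: (bR n).
  - apply: (@measurable_fun_cvg _ _ _ _ (fun n w => expR (- (v n (Zl w) * Q / 2)) * cos phi)) => //.
    by move=> n; case: (bR n).
  - move=> n w; rewrite normrM -[leRHS]mulr1; apply: ler_pM => //; last by rewrite ler_norml cos_geN1 cos_le1.
    rewrite ger0_norm ?expR_ge0// ler_expR -mulNr ler_pM2r// -mulrN.
    apply: le_trans (ler_norm _) _; rewrite normrM normrN ger0_norm// ler_wpM2r//.
    exact: le_trans (vu _ _) (uK _).
  - by apply: aeW => w; exact: hp.
have limR' : Ex P' (fun w => cos (phi + \sum_(i < q) th i * W (v n (Z' w) * s i.+1) w)) @[n --> \oo] -->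
    Ex P (fun w => expR (- (u (Zl w) * Q / 2)) * cos phi).
  by under eq_fun do rewrite key.
exact: (cvg_unique _ limL limR').
Unshelve. all: by end_near. Qed.

End wiener.

(** * From characteristic functions to Lipschitz functions *)

Section bernstein.
Context {R : realType}.

(* [bern n f v k] is the expectation of [f (k + S)] for [S] binomial of parameters [n, v]. *)
Fixpoint bern (n : nat) (f : nat -> R) (v : R) (k : nat) : R :=
  if n is n'.+1 then v * bern n' f v k.+1 + (1 - v) * bern n' f v k else f k.

(** Chebyshev's argument carried through the recursion: the bracket is the second moment of
    [k + S - a], squared offset of the mean plus binomial variance. *)
Lemma bern_dist (n : nat) (f : nat -> R) (v c A B a : R) k : 0 <= v <= 1 ->
  (forall j, `|f j - c| <= A + B * (j%:R - a) ^+ 2) ->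
  `|bern n f v k - c| <= A + B * ((k%:R + n%:R * v - a) ^+ 2 + n%:R * (v * (1 - v))).
Proof.
move=> /andP[v0 v1] hf; elim: n k => [|n ih] k /=; first by rewrite !mul0r !addr0.
have -> : v * bern n f v k.+1 + (1 - v) * bern n f v k - c =
   v * (bern n f v k.+1 - c) + (1 - v) * (bern n f v k - c) by ring.
apply: le_trans (ler_normD _ _) _; rewrite !normrM (ger0_norm v0) (ger0_norm (_ : 0 <= 1 - v)); last by lra.
have h1 := ler_wpM2l v0 (ih k.+1).
have v1' : 0 <= 1 - v by lra.
have h2 := ler_wpM2l v1' (ih k).
apply: le_trans (lerD h1 h2) _.
by rewrite -[k.+1%:R]natr1 -[n.+1%:R]natr1; apply: eq_ler; ring.
Qed.

End bernstein.

(** * Convergence for Lipschitz functions of finitely many coordinates *)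

Section lipschitz_class.
Context {R : realType} {d d' : measure_display} {Om : measurableType d} {Om' : measurableType d'}.
Context (P : probability Om R) (P' : probability Om' R) (q : nat).
Context (x : nat -> nat -> Om -> R) (y : nat -> Om' -> R).
Hypothesis mx : forall n i, measurable_fun setT (x n i).
Hypothesis my : forall i, measurable_fun setT (y i).
Hypothesis hcos : forall (th : nat -> R) (phi : R),
  Ex P (fun w => cos (phi + \sum_(i < q) th i * x n i w)) @[n --> \oo] -->
  Ex P' (fun w => cos (phi + \sum_(i < q) th i * y i w)).

Definition seqcont (F : (nat -> R) -> R) : Prop :=
  forall (a_ : nat -> nat -> R) a, (forall k, a_ n k @[n --> \oo] --> a k) -> F (a_ n) @[n --> \oo] --> F a.

(** Continuity belongs to the class because it provides measurability along [x] and [y]; like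
    boundedness, it passes to uniform limits ([good_unif]). *)
Definition good (F : (nat -> R) -> R) : Prop := [/\ exists M : R, forall a, `|F a| <= M, seqcont F &
  Ex P (fun w => F (fun i => x n i w)) @[n --> \oo] --> Ex P' (fun w => F (fun i => y i w))].

Lemma bmf_seqcont {d0} {T : measurableType d0} (F : (nat -> R) -> R) (xi : nat -> T -> R) :
  (exists M : R, forall a, `|F a| <= M) -> seqcont F -> (forall i, measurable_fun setT (xi i)) ->
  bmf (fun w => F (fun i => xi i w)).
Proof.
move=> [M hM] cF mxi; split; last by exists M => w.
exact: measurable_seq_continuous.
Qed.

Lemma good_bmf F n : good F -> bmf (fun w => F (fun i => x n i w)).
Proof. by move=> [hb hc _]; exact: bmf_seqcont. Qed.

Lemma good_bmf' F : good F -> bmf (fun w => F (fun i => y i w)).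
Proof. by move=> [hb hc _]; exact: bmf_seqcont. Qed.

Lemma goodD F G : good F -> good G -> good (fun a => F a + G a).
Proof.
move=> gF gG; have [[M hM] cF hF] := gF; have [[M' hM'] cG hG] := gG; split.
- by exists (M + M') => a; apply: le_trans (ler_normD _ _) _; exact: lerD.
- by move=> a_ a h; apply: cvgD; [exact: cF|exact: cG].
- rewrite ExD; [|exact: good_bmf'..].
  apply: (@cvgn_near_eq _ _ (fun n => Ex P (fun w => F (fun i => x n i w)) + Ex P (fun w => G (fun i => x n i w)))).
    by apply: nearW => n; rewrite ExD; [|exact: good_bmf..].
  exact: cvgD.
Qed.

Lemma goodZ (c : R) F : good F -> good (fun a => c * F a).
Proof.
move=> gF; have [[M hM] cF hF] := gF; split.
- by exists (`|c| * M) => a; rewrite normrM ler_wpM2l.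
- by move=> a_ a h; apply: cvgM; [exact: cvg_cst|exact: cF].
- rewrite ExZ; last exact: good_bmf'.
  apply: (@cvgn_near_eq _ _ (fun n => c * Ex P (fun w => F (fun i => x n i w)))).
    by apply: nearW => n; rewrite ExZ//; exact: good_bmf.
  by apply: cvgM => //; exact: cvg_cst.
Qed.

Lemma good_unif F : (forall e : R, 0 < e -> exists2 G, good G & forall a, `|F a - G a| <= e) -> good F.
Proof.
move=> h.
have [hb hc] : (exists M : R, forall a, `|F a| <= M) /\ seqcont F.
  split.
    have [G [[M hM] _ _] hG] := h 1 ltr01; exists (1 + M) => a.
    rewrite -[F a](subrK (G a)); apply: le_trans (ler_normD _ _) _; exact: lerD.
  move=> a_ a ha; apply/cvgrPdist_le => e e0; have e3 : 0 < e / 3 by rewrite divr_gt0.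
  have [G [_ cG _] hG] := h _ e3.
  have /cvgrPdist_le /(_ _ e3) := cG _ _ ha; apply: filterS => n hn.
  have -> : F a - F (a_ n) = (F a - G a) + (G a - G (a_ n)) - (F (a_ n) - G (a_ n)) by ring.
  apply: le_trans (ler_normB _ _) _; have := hG (a_ n).
  have : `|F a - G a + (G a - G (a_ n))| <= e / 3 + e / 3.
    apply: le_trans (ler_normD _ _) _; exact: lerD.
  lra.
split => //; apply/cvgrPdist_le => e e0; have e3 : 0 < e / 3 by rewrite divr_gt0.
have [G gG hG] := h _ e3; have [_ _ lG] := gG.
have /cvgrPdist_le /(_ _ e3) := lG; apply: filterS => n hn.
set A := Ex P' (fun w => F _); set B := Ex P (fun w => F _).
set A' := Ex P' (fun w => G _) in hn; set B' := Ex P (fun w => G _) in hn.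
have h1 : `|A - A'| <= e / 3.
  by apply: Ex_dist => //; [exact: bmf_seqcont|exact: good_bmf'].
have h2 : `|B - B'| <= e / 3.
  by apply: Ex_dist => //; [exact: bmf_seqcont|exact: good_bmf].
have -> : A - B = (A - A') + (A' - B') - (B - B') by ring.
apply: le_trans (ler_normB _ _) _.
have : `|A - A' + (A' - B')| <= e / 3 + e / 3 by apply: le_trans (ler_normD _ _) _; exact: lerD.
lra.
Qed.

Definition trig (t : R * R * (nat -> R)) (a : nat -> R) : R :=
  t.1.1 * cos (t.1.2 + \sum_(i < q) t.2 i * a i).

Definition tspan (F : (nat -> R) -> R) : Prop :=
  exists l : seq (R * R * (nat -> R)), forall a, F a = \sum_(t <- l) trig t a.

Lemma seqcont_trig t : seqcont (trig t).
Proof.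
move=> a_ a h; apply: cvgM; first exact: cvg_cst.
apply: continuous_cvg; first exact: continuous_cos.
apply: cvgD; first exact: cvg_cst.
by apply: cvgn_sum => i; apply: cvgM; [exact: cvg_cst|exact: h].
Qed.

Lemma good_trig t : good (trig t).
Proof.
case: t => [[c phi] th]; apply: (@goodZ c (fun a => cos (phi + \sum_(i < q) th i * a i))); split.
- by exists 1 => a; rewrite ler_norml cos_geN1 cos_le1.
- move=> a_ a h; have := @seqcont_trig (1, phi, th) a_ a h; rewrite /trig /= mul1r.
  by under eq_fun do rewrite mul1r.
- exact: hcos.
Qed.

Lemma good_ext F G : (forall a, F a = G a) -> good F -> good G.
Proof. by move=> h; have -> : F = G by exact/funext. Qed.

Lemma good_tspan F : tspan F -> good F.
Proof.
move=> [l hl]; apply: (good_ext (fun a => esym (hl a))) => {hl}.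
elim: l => [|t l ih].
  apply: (good_ext _ (goodZ 0 (good_trig (0, 0, fun=> 0)))) => a.
  by rewrite big_nil mul0r.
apply: (good_ext _ (goodD (good_trig t) ih)) => a.
by rewrite big_cons.
Qed.

Lemma tspanD F G : tspan F -> tspan G -> tspan (fun a => F a + G a).
Proof. by move=> [l hl] [k hk]; exists (l ++ k) => a; rewrite big_cat hl hk. Qed.

Lemma tspanZ c F : tspan F -> tspan (fun a => c * F a).
Proof.
move=> [l hl]; exists [seq (c * t.1.1, t.1.2, t.2) | t <- l] => a.
by rewrite hl big_map mulr_sumr; apply: eq_bigr => t _; rewrite /trig /= mulrA.
Qed.

(** Product-to-sum formula with [sin y = cos (y - pi / 2)]: the two copies of the list shift the
    coefficient of coordinate [i0] by [kap] and by [- kap]. *)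
Lemma tspan_sin (kap : R) (i0 : 'I_q) F : tspan F -> tspan (fun a => F a * sin (kap * a i0)).
Proof.
move=> [l hl].
pose up (s : R) (t : R * R * (nat -> R)) : R * R * (nat -> R) :=
  (s * t.1.1 / 2, t.1.2 - pi / 2, fun i => t.2 i + s * (kap * (i == i0 :> nat)%:R)).
exists ([seq up 1 t | t <- l] ++ [seq up (-1) t | t <- l]) => a.
rewrite hl big_cat/= !big_map -big_split/= mulr_suml; apply: eq_bigr => -[[c phi] th] _.
rewrite /trig /up /=.
have E (s : R) : \sum_(i < q) (th i + s * (kap * (i == i0 :> nat)%:R)) * a i = \sum_(i < q) th i * a i + s * (kap * a i0).
  rewrite [in RHS](_ : s * (kap * a i0) = \sum_(i < q) s * (kap * (i == i0 :> nat)%:R) * a i); last first.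
    rewrite (bigD1 i0)//= eqxx big1 ?addr0; first by rewrite mulr1 mulrA.
    move=> i ne; rewrite (_ : (i == i0 :> nat) = false); first by rewrite !mulr0 mul0r.
    by apply/negbTE.
  by rewrite -big_split/=; apply: eq_bigr => i _; ring.
rewrite !E; set A := \sum_(i < q) _; set B := kap * a i0.
have -> : phi - pi / 2 + (A + 1 * B) = (phi + A + B) - pi / 2 by ring.
have -> : phi - pi / 2 + (A + -1 * B) = (phi + A - B) - pi / 2 by ring.
by rewrite !cosBpihalf sinB sinD; field.
Qed.

Lemma tspan1 : tspan (fun=> 1).
Proof.
exists [:: (1, 0, fun=> 0)] => a; rewrite big_seq1 /trig /= big1 ?addr0 ?cos0 ?mulr1//.
by move=> i _; rewrite mul0r.
Qed.

(** Each level of [bern] multiplies the trigonometric factor by [v] or [1 - v], both affine in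
    [sin (kap * a i0)]. The general factor [g] is what makes the induction close. *)
Lemma good_bern (i0 : 'I_q) (kap : R) (f : (nat -> R) -> nat -> R) :
  (forall l g, tspan g -> good (fun a => f a l * g a)) ->
  forall n k g, tspan g -> good (fun a => bern n (f a) ((1 + sin (kap * a i0)) / 2) k * g a).
Proof.
move=> hf; elim=> [|n ih] k g hg /=; first exact: hf.
have hv : tspan (fun a => (1 + sin (kap * a i0)) / 2 * g a).
  have := tspanZ 2^-1 (tspanD hg (tspan_sin kap i0 hg)).
  by move=> [l hl]; exists l => a; rewrite -hl; ring.
have hv' : tspan (fun a => (1 - (1 + sin (kap * a i0)) / 2) * g a).
  have := tspanD hg (tspanZ (-1) hv).
  by move=> [l hl]; exists l => a; rewrite -hl; ring.
apply: good_ext (goodD (ih k.+1 _ hv) (ih k _ hv')) => a; ring.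
Qed.

Definition lipf (C L : R) (h : (nat -> R) -> R) : Prop :=
  [/\ 0 <= C, 0 <= L, (forall a, `|h a| <= C) &
    forall a b (dl : R), 0 <= dl -> (forall i, (i < q)%N -> `|a i - b i| <= dl) -> `|h a - h b| <= L * dl].

(** [K sin (a / K)] is a bounded substitute for the coordinate [a]. It equals [K (2 v - 1)] with
    [v = (1 + sin (a / K)) / 2] in [0, 1], and [v] can be the success probability of a binomial
    law. *)
Definition clipK (K : R) (j : nat) (a : nat -> R) (i : nat) : R := if (i < j)%N then K * sin (K^-1 * a i) else 0.

Definition upd (a : nat -> R) (j : nat) (v : R) (i : nat) : R := if i == j then v else a i.

Lemma lipf_upd C L h j v : lipf C L h -> lipf C L (fun a => h (upd a j v)).
Proof.
move=> [C0 L0 hC hL]; split => // a b dl dl0 hab; apply: hL => // i iq.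
by rewrite /upd; case: eqP => _; [rewrite subrr normr0|exact: hab].
Qed.

(** Coordinates are released one at a time: the value [K (2 v - 1)] of coordinate [j] is replaced by
    [K (2 S / (n + 1) - 1)] with [S] binomial of parameters [n + 1] and [v]. For each value of [S]
    it is a constant, so the induction hypothesis handles the others, and the binomial weights are
    trigonometric polynomials. *)
Lemma good_clip (K : R) : 0 < K -> forall j, (j <= q)%N -> forall C L h, lipf C L h ->
  forall g, tspan g -> good (fun a => h (clipK K j a) * g a).
Proof.
move=> K0; elim=> [|j ih] jq C L h hl g hg.
  have E a : clipK K 0 a = (fun=> 0) by apply/funext.
  have gg := good_tspan hg.
  by apply: good_ext (goodZ (h (fun=> 0)) gg) => a; rewrite E.
have [_ [M hM]] : True /\ exists M : R, forall a, `|g a| <= M by have [? _ _] := good_tspan hg.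
have M0 : 0 <= M := le_trans (normr_ge0 _) (hM (fun=> 0)).
pose i0 := Ordinal jq.
have [C0 L0 hC hL] := hl.
pose f n a l := h (upd (clipK K j a) j (K * (2 * (l%:R / n.+1%:R) - 1))).
apply: good_unif => e e0.
pose D := 2 * L * K * (M + 1) + 1.
have D0 : 0 < D by rewrite /D ltr_wpDl// mulr_ge0 ?mulr_ge0 ?(ltW K0)//; lra.
(* [dl] is the allowed deviation of [S / (n + 1)] from [v]; with [1 / (n + 1) <= dl ^ 2] the
   Chebyshev term is at most [2 L K dl] as well, and [D] makes the total at most [e]. *)
pose dl := e / (2 * D).
have dl0 : 0 < dl by rewrite divr_gt0// mulr_gt0.
have [n hn] : exists n : nat, n.+1%:R^-1 <= dl ^+ 2.
  have dl2 : 0 < dl ^+ 2 by rewrite exprn_gt0.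
  by have [n _ hn] := near_natSinv_le dl2; exists n; apply: hn => /=.
exists (fun a => bern n.+1 (f n a) ((1 + sin (K^-1 * a i0)) / 2) 0 * g a).
  apply: good_bern => // l g' hg'.
  by apply: (ih (ltnW jq) C L _ (lipf_upd j _ hl) _ hg').
move=> a; set v := (1 + _) / 2.
have v01 : 0 <= v <= 1.
  by rewrite /v; have := sin_geN1 (K^-1 * a i0); have := sin_le1 (K^-1 * a i0) => ? ?; apply/andP; split; lra.
have n0 : (0 : R) < n.+1%:R by rewrite ltr0n.
have hf l : `|f n a l - h (clipK K j.+1 a)| <= 2 * L * K * dl + (2 * L * K / dl / n.+1%:R ^+ 2) * (l%:R - n.+1%:R * v) ^+ 2.
  have Ec : clipK K j.+1 a = upd (clipK K j a) j (K * (2 * v - 1)).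
    apply/funext => i; rewrite /clipK /upd ltnS leq_eqVlt; case: eqP => [->|_]//=.
    by congr (K * _); rewrite /v /i0 /=; field.
  rewrite Ec /f.
  set z := l%:R / n.+1%:R - v.
  have Ez : (l%:R - n.+1%:R * v) ^+ 2 / n.+1%:R ^+ 2 = z ^+ 2.
    have X (l' m : R) : m != 0 -> (l' - m * v) ^+ 2 / m ^+ 2 = (l' / m - v) ^+ 2 by move=> ?; field.
    by apply: X; rewrite gt_eqF.
  have hz : `|z| <= dl + z ^+ 2 / dl.
    have [zd|zd] := leP `|z| dl; first by rewrite (le_trans zd)// lerDl divr_ge0 ?sqr_ge0// ltW.
    rewrite -[z ^+ 2](real_normK (num_real _)); apply: le_trans (_ : `|z| ^+ 2 / dl <= _); last by rewrite lerDr ltW.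
    by rewrite ler_pdivlMr// expr2 ler_wpM2l// ltW.
  apply: (@le_trans _ _ (L * (2 * K * `|z|))).
    apply: hL; first by rewrite mulr_ge0// mulr_ge0// ltW.
    move=> i iq; rewrite /upd; case: eqP => _; last by rewrite subrr normr0 mulr_ge0// mulr_ge0// ltW.
    have -> : K * (2 * (l%:R / n.+1%:R) - 1) - K * (2 * v - 1) = 2 * K * z by rewrite /z; ring.
    by rewrite normrM ger0_norm// mulr_ge0// ltW.
  apply: (@le_trans _ _ (2 * L * K * (dl + z ^+ 2 / dl))).
    have -> : L * (2 * K * `|z|) = 2 * L * K * `|z| by ring.
    by apply: ler_wpM2l => //; rewrite !mulr_ge0// ltW.
  rewrite mulrDr lerD2l -Ez.
  by apply: eq_ler; field; rewrite !gt_eqF.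
have hb := @bern_dist R n.+1 (f n a) v _ _ _ _ 0%N v01 hf.
rewrite -mulrBl normrM.
apply: (@le_trans _ _ ((2 * L * K * dl + 2 * L * K * dl) * M)).
  apply: ler_pM => //; rewrite distrC; apply: le_trans hb _; rewrite lerD2l.
  rewrite add0r subrr expr0n add0r.
  have -> : 2 * L * K / dl / n.+1%:R ^+ 2 * (n.+1%:R * (v * (1 - v))) = 2 * L * K * (v * (1 - v) * n.+1%:R^-1 / dl).
    by field; rewrite !gt_eqF.
  rewrite ler_wpM2l ?mulr_ge0 ?(ltW K0)//.
  rewrite ler_pdivrMr// -expr2; apply: le_trans hn.
  rewrite ler_piMl ?invr_ge0//; have /andP[? ?] := v01; nra.
have -> : (2 * L * K * dl + 2 * L * K * dl) * M = (2 * L * K * M) * (2 * dl) by ring.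
apply: (@le_trans _ _ (D * (2 * dl))).
  apply: ler_wpM2r; first exact: mulr_ge0 (ler0n _ 2) (ltW dl0).
  have : 0 <= 2 * L * K by rewrite !mulr_ge0// ltW.
  rewrite /D; nra.
have X (a1 b1 : R) : a1 != 0 -> a1 * (2 * (b1 / (2 * a1))) = b1 by move=> ?; field.
by apply: eq_ler; rewrite /dl X// gt_eqF.
Qed.

Lemma lipf_bounded C L h : lipf C L h -> exists M : R, forall a, `|h a| <= M.
Proof. by move=> [_ _ hC _]; exists C. Qed.

Lemma lipf_seqcont C L h : lipf C L h -> seqcont h.
Proof.
move=> [C0 L0 hC hL] a_ a ha; apply/cvgrPdist_le => e e0.
have L1 : 0 < L + 1 by lra.
have eL : 0 < e / (L + 1) by rewrite divr_gt0.
have : \forall n \near \oo, forall i, (i < q)%N -> `|a i - a_ n i| <= e / (L + 1).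
  by apply: near_all_lt => i iq; move/cvgrPdist_le : (ha i) => /(_ _ eL).
apply: filterS => n hn; apply: le_trans (hL _ _ _ (ltW eL) hn) _.
by rewrite mulrA ler_pdivrMr// mulrC ler_pM2l//; lra.
Qed.

(** The error is quadratic in [z], so that second moments control it in mean. *)
Lemma clip_dist (K z : R) : 0 < K -> `|z - K * sin (K^-1 * z)| <= 2 * z ^+ 2 / K.
Proof.
move=> K0; set u := K^-1 * z.
have zE : z = K * u by rewrite /u mulrA divff ?mul1r// gt_eqF.
have hu : `|u - sin u| <= 2 * u ^+ 2.
  rewrite -[u ^+ 2](real_normK (num_real _)).
  have u0 := normr_ge0 u.
  have [u1|u1] := leP `|u| 1.
    rewrite distrC; apply: le_trans (sin_taylor u) _; rewrite exprS.
    have : 0 <= `|u| ^+ 2 by exact: sqr_ge0.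
    nra.
  apply: le_trans (ler_normB _ _) _; have := norm_sin_le u; nra.
rewrite {1}zE -mulrBr normrM (gtr0_norm K0) [X in 2 * X ^+ 2]zE.
have -> : 2 * (K * u) ^+ 2 / K = K * (2 * u ^+ 2) by field; rewrite gt_eqF.
by rewrite ler_pM2l.
Qed.

(** The second-moment bound, uniform in [n], allows [K] to be chosen before [n]; for the fixed limit
    [y] dominated convergence is enough. *)
Lemma lipschitz_cvg (B C L : R) h : (forall n i, (i < q)%N -> Ex P (fun w => x n i w ^+ 2) <= B) ->
  (forall n i, bmf (x n i)) -> lipf C L h ->
  Ex P (fun w => h (fun i => x n i w)) @[n --> \oo] --> Ex P' (fun w => h (fun i => y i w)).
Proof.
move=> hB bx hl; have [C0 L0 hC hL] := hl.
have hb := lipf_bounded hl; have hc := lipf_seqcont hl.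
have g1 K : 0 < K -> good (fun a => h (clipK K q a)).
  move=> K0; apply: good_ext (good_clip K0 (leqnn q) hl tspan1) => a; exact: mulr1.
have cK a : h (clipK K.+1%:R q a) @[K --> \oo] --> h a.
  apply/cvgrPdist_le => e e0.
  pose S := \sum_(i < q) 2 * a i ^+ 2.
  have S0 : 0 <= S by apply: sumr_ge0 => i _; rewrite mulr_ge0// sqr_ge0.
  have SL : 0 < L * S + 1 by apply: ltr_wpDl => //; exact: mulr_ge0.
  have eS : 0 < e / (L * S + 1) by rewrite divr_gt0.
  have := near_natSinv_le eS; apply: filterS => n hn.
  have n0 : (0 : R) < n.+1%:R by rewrite ltr0n.
  apply: (@le_trans _ _ (L * (S / n.+1%:R))).
    apply: hL; first by rewrite divr_ge0.
    move=> i iq; rewrite /clipK iq; apply: le_trans (clip_dist _ n0) _.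
    rewrite ler_pM2r ?invr_gt0// /S (bigD1 (Ordinal iq))//= lerDl.
    by apply: sumr_ge0 => j _; rewrite mulr_ge0// sqr_ge0.
  rewrite mulrA mulrC; apply: (@le_trans _ _ (n.+1%:R^-1 * (L * S + 1))).
    by rewrite ler_pM2l ?invr_gt0// lerDl.
  by rewrite -ler_pdivlMr.
have lK : Ex P' (fun w => h (clipK K.+1%:R q (fun i => y i w))) @[K --> \oo] --> Ex P' (fun w => h (fun i => y i w)).
  apply: (@Ex_cvg _ _ _ P' _ _ C).
  - by move=> K; case: (good_bmf' (g1 K.+1%:R (ltr0Sn _ _))).
  - by case: (bmf_seqcont hb hc my).
  - by move=> K w; exact: hC.
  - by apply: aeW => w; exact: cK.
apply/cvgrPdist_le => e e0; have e3 : 0 < e / 3 by rewrite divr_gt0.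
have [K1 _ hK1] := (cvgrPdist_le _ _).1 lK _ e3.
pose D := L * (q%:R * (2 * B)).
have D0 : 0 < `|D| + 1 by have := normr_ge0 D; lra.
have eD : 0 < e / 3 / (`|D| + 1) by rewrite divr_gt0.
have [K2 _ hK2] := near_natSinv_le eD.
pose K := maxn K1 K2.
have n0 : (0 : R) < K.+1%:R by rewrite ltr0n.
have h1 := hK1 K (leq_maxl _ _); have h2 := hK2 K (leq_maxr _ _).
have gK := g1 _ n0; have [_ _ lG] := gK.
have /cvgrPdist_le /(_ _ e3) := lG; apply: filterS => n hn.
set A := Ex P' (fun w => h _) in h1 *; set BB := Ex P (fun w => h _).
set A' := Ex P' (fun w => h (clipK _ _ _)) in h1 hn; set B' := Ex P (fun w => h (clipK _ _ _)) in hn.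
have h3 : `|BB - B'| <= e / 3.
  have bx2 i : bmf (fun w => 2 * x n i w ^+ 2 / K.+1%:R) by exact: (bmfZr _ (bmfZ 2 (bmfX 2 (bx n i)))).
  have bS : bmf (fun w => L * (\sum_(i < q) 2 * x n i w ^+ 2 / K.+1%:R)).
    by apply: bmfZ; apply: bmf_sum => i _; exact: bx2.
  rewrite -ExB; [|exact: (bmf_seqcont hb hc (mx n))|exact: (good_bmf n gK)].
  apply: (@le_trans _ _ (Ex P (fun w => L * (\sum_(i < q) 2 * x n i w ^+ 2 / K.+1%:R)))).
    apply: Ex_norm_le; [by apply: bmfB; [exact: (bmf_seqcont hb hc (mx n))|exact: (good_bmf n gK)]|exact: bS|].
    move=> w; apply: hL.
      by apply: sumr_ge0 => i _; rewrite divr_ge0// mulr_ge0// sqr_ge0.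
    move=> i iq; rewrite /clipK iq; apply: le_trans (clip_dist _ n0) _.
    rewrite (bigD1 (Ordinal iq))//= lerDl.
    by apply: sumr_ge0 => j _; rewrite divr_ge0// mulr_ge0// sqr_ge0.
  rewrite ExZ; last by apply: bmf_sum => i _; exact: bx2.
  rewrite Ex_sum; last by move=> i _; exact: bx2.
  apply: (@le_trans _ _ (D / K.+1%:R)).
    rewrite /D -mulrA ler_wpM2l// mulr_natl mulrnAl -[q in leRHS]card_ord -sumr_const.
    apply: ler_sum => i _.
    have -> : (fun w => 2 * x n i w ^+ 2 / K.+1%:R) = (fun w => (2 / K.+1%:R) * x n i w ^+ 2).
      by apply/funext => w; rewrite mulrAC.
    rewrite ExZ; last exact: bmfX.
    by rewrite mulrAC ler_wpM2r ?invr_ge0// ler_pM2l// hB.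
  apply: (@le_trans _ _ ((`|D| + 1) / K.+1%:R)).
    by rewrite ler_pM2r ?invr_gt0//; have := ler_norm D; lra.
  by rewrite mulrC -ler_pdivlMr.
have -> : A - BB = (A - A') + (A' - B') - (BB - B') by ring.
apply: le_trans (ler_normB _ _) _.
have : `|A - A' + (A' - B')| <= e / 3 + e / 3 by apply: le_trans (ler_normD _ _) _; exact: lerD.
lra.
Qed.

End lipschitz_class.

(** * Events of small probability *)

Section small_events.
Context {R : realType} {d : measure_display} {Om : measurableType d} (P : probability Om R).

(** Only the exceptional event has to be measurable: [Q] will quantify over uncountably many
    times. *)
Definition smallev (e : R) (Q : Om -> Prop) : Prop :=
  exists A : set Om, [/\ measurable A, fine (P A) <= e & forall w, ~ A w -> Q w].

Lemma smallev_and e1 e2 Q1 Q2 : smallev e1 Q1 -> smallev e2 Q2 -> smallev (e1 + e2) (fun w => Q1 w /\ Q2 w).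
Proof.
move=> [A [mA hA QA]] [B [mB hB QB]]; exists (A `|` B); split; first exact: measurableU.
  apply: le_trans (lerD hA hB); rewrite -fineD ?fin_num_measure//.
  apply: fine_le; rewrite ?fin_numD ?fin_num_measure//; first exact: measurableU.
  exact: measureU2.
by move=> w /not_orP[nA nB]; split; [exact: QA|exact: QB].
Qed.

Lemma smallev_sub e1 e2 (Q1 Q2 : Om -> Prop) : e1 <= e2 -> (forall w, Q1 w -> Q2 w) -> smallev e1 Q1 -> smallev e2 Q2.
Proof.
move=> e12 Q12 [A [mA hA QA]]; exists A; split => //; first exact: le_trans e12.
by move=> w /QA; exact: Q12.
Qed.

Lemma smallev_all (J : nat) (e : R) (Q : nat -> Om -> Prop) : 0 <= e ->
  (forall j, (j < J)%N -> smallev e (Q j)) -> smallev (J%:R * e) (fun w => forall j, (j < J)%N -> Q j w).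
Proof.
move=> e0; elim: J => [|J ih] h.
  by exists set0; split => //; rewrite measure0 mul0r.
have h1 := ih (fun j jJ => h j (ltnW jJ)); have h2 := h J (ltnSn J).
apply: smallev_sub (smallev_and h1 h2); first by rewrite -natr1 mulrDl mul1r.
by move=> w [a1 a2] j; rewrite ltnS leq_eqVlt => /predU1P[->//|]; exact: a1.
Qed.

Lemma smallev_markov2 (X : Om -> R) (l s e : R) : bmf X -> 0 < l -> Ex P (fun w => X w ^+ 2) <= s ->
  s / l ^+ 2 <= e -> smallev e (fun w => `|X w| <= l).
Proof.
move=> hX l0 hs he; have [mX _] := bmf_norm hX.
exists [set w | l < `|X w|].
have mA : measurable [set w | l < `|X w|].
  rewrite (_ : [set w | _] = setT `&` (fun w => `|X w|) @^-1` `]l, +oo[%classic); first exact: mX.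
  by apply/seteqP; split => w /=; rewrite in_itv/= andbT // => -[].
split => //; last by move=> w /negP; rewrite -leNgt.
apply: le_trans he.
apply: (@le_trans _ _ (Ex P (fun w => X w ^+ 2) / l ^+ 2)); last by rewrite ler_pM2r// invr_gt0 exprn_gt0.
apply: Ex_markov => //; [exact: bmfX|by rewrite exprn_gt0|by move=> w; exact: sqr_ge0|].
move=> w /= lw; rewrite -[X w ^+ 2](real_normK (num_real _)).
by apply: lerXn2r; rewrite ?nnegrE// ltW.
Qed.

End small_events.

(* Summation by parts, as in the Hajek-Renyi inequality. *)
Lemma abel_bound {R : realType} (c M N : nat -> R) (B : R) k K : (k <= K)%N ->
  (forall j, 0 < c j) -> (forall j, c j <= c j.+1) ->
  (forall j, N j.+1 - N j = c j * (M j.+1 - M j)) ->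
  (forall j, (k <= j <= K)%N -> `|N j - N k| <= B) -> c k * `|M K - M k| <= B.
Proof.
move=> kK c0 ci hN hB.
have cV j i : (j <= i)%N -> (c i)^-1 <= (c j)^-1.
  move=> ji; rewrite lef_pV2 ?posrE//; elim: i ji => [|i ih]; first by rewrite leqn0 => /eqP ->.
  rewrite leq_eqVlt => /predU1P[->//|]; rewrite ltnS => /ih h; exact: le_trans h (ci i).
have B0 : 0 <= B by apply: le_trans (hB k _); rewrite ?leqnn.
(* The difference is the sum over [k <= i < j] of [(N i.+1 - N k) * (1 / c i - 1 / c i.+1)], whose
   last factors are nonnegative and telescope. *)
have main j : (k <= j)%N -> (j <= K)%N ->
    `|(M j - M k) - (N j - N k) / c j| <= B * ((c k)^-1 - (c j)^-1).
  elim: j => [|j ih].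
    by rewrite leqn0 => /eqP -> _; rewrite !subrr mul0r subrr mulr0 normr0.
  rewrite leq_eqVlt => /predU1P[<- _|]; first by rewrite !subrr mul0r subrr mulr0 normr0.
  rewrite ltnS => kj jK.
  have -> : (M j.+1 - M k) - (N j.+1 - N k) / c j.+1 = ((M j - M k) - (N j - N k) / c j) +
      (N j.+1 - N k) * ((c j)^-1 - (c j.+1)^-1).
    have -> : M j.+1 = M j + (N j.+1 - N j) / c j by rewrite hN mulrC mulKf ?gt_eqF//; ring.
    ring.
  apply: le_trans (ler_normD _ _) _.
  have h1 := ih kj (ltnW jK).
  have h2 : `|(N j.+1 - N k) * ((c j)^-1 - (c j.+1)^-1)| <= B * ((c j)^-1 - (c j.+1)^-1).
    rewrite normrM (ger0_norm (_ : 0 <= (c j)^-1 - (c j.+1)^-1)) ?subr_ge0 ?cV//.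
    by rewrite ler_wpM2r ?subr_ge0 ?cV// hB// jK leqW.
  apply: le_trans (lerD h1 h2) _; rewrite -mulrDr ler_wpM2l//; lra.
have h := main K kK (leqnn K).
have hK : `|(N K - N k) / c K| <= B / c K.
  by rewrite normrM normfV (gtr0_norm (c0 K)) ler_pM2r ?invr_gt0// hB// kK leqnn.
rewrite mulrC -ler_pdivlMr//.
have -> : M K - M k = ((M K - M k) - (N K - N k) / c K) + (N K - N k) / c K by ring.
apply: le_trans (ler_normD _ _) _; apply: le_trans (lerD h hK) _.
by rewrite -mulrDr subrK.
Qed.

(** * Tightness *)

Section tightness.
Context {R : realType} {d : measure_display} {Om : measurableType d}.
Context (P : probability Om R) (hg : nat -> set (set Om)).
Context (M cv : nat -> Om -> R) (r : nat -> R) (g c : R) (ML : Om -> R).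
Local Notation H n := (g_sigma_algebraType (hg n)).
Hypothesis HH : controlled_martingale P hg M cv r.
Hypothesis r01 : forall n, 0 <= r n < 1.
Hypothesis g_range : 2^-1 < g <= 1.
Hypothesis c_gt0 : 0 < c.
Hypothesis r_cvg : n%:R `^ g * r n @[n --> \oo] --> c.
Hypothesis M01 : forall n w, 0 <= M n w <= 1.
Hypothesis ML01 : forall w, 0 <= ML w <= 1.
Hypothesis mML : measurable_fun setT ML.
Hypothesis cvgML : {ae P, forall w, M n w @[n --> \oo] --> ML w}.
Let p := 2 * g - 1.
Local Notation tl := (rtail r).

Let p0 : 0 < p. Proof. by have /andP[] := p_range g_range. Qed.
Local Notation amp := (amp g).
Local Notation Xp := (proc M g ML).
Let bM n : bmf (M n). Proof. exact: (cm_sub HH) (cm_M HH n). Qed.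
Let bML : bmf ML. Proof. exact: bmf_bounded mML ML01. Qed.

Lemma smallev_maximal b m K (l e : R) : (m <= K)%N -> 0 < l -> 11 * qsum r b m K ^+ 2 / l ^+ 4 <= e ->
  smallev P e (fun w => forall k, (m <= k <= K)%N -> `|wsum M b m k w| < l).
Proof.
move=> mK l0 he; have [A [mA hA PA]] := maximal4 HH b mK l0.
exists A; split => //; first exact: le_trans he.
by move=> w nA k kK; rewrite ltNge; apply/negP => lk; apply: nA; apply: hA; exists k.
Qed.

Lemma amp_gt0 n : (0 < n)%N -> 0 < amp n.
Proof. by move=> n0; rewrite powR_gt0// ltr0n. Qed.

(** As [amp n ^ 2 = n ^ p] and [n t] is below [truncn (n * t) + 1], a supremum over small times
    becomes a weighted maximum over indices. *)
Lemma proc_le_weight n t w : (0 < n)%N -> 0 <= t -> amp n * `|Xp n t w| <=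
  (truncn (n%:R * t)).+1%:R `^ p * `|M (truncn (n%:R * t)) w - ML w|.
Proof.
move=> n0 t0; have nR : (0 : R) < n%:R by rewrite ltr0n.
rewrite /proc 2!normrM (ger0_norm (powR_ge0 _ _)) (ger0_norm (amp_ge0 _ _)) -/p !mulrA.
rewrite ler_wpM2r// mulrAC -expr2 amp2 -powRM ?(ltW nR)//.
apply: powR_le2; rewrite ?(ltW p0) ?mulr_ge0 ?(ltW nR)//.
exact: ltW (truncnS_gt _).
Qed.

(** Up to an index [K] just past [n * dl], the weighted maximal inequality and [abel_bound] control
    [M K - M k]; from [K] to the limit a second moment suffices. Both bounds scale with
    [x = (3 dl) ^ p], uniformly in [n]. *)
Lemma tight_small (eta e : R) : 0 < eta -> 0 < e -> exists2 dl : R, 0 < dl &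
  \forall n \near \oo, smallev P e (fun w => forall t, 0 <= t <= dl -> `|Xp n t w| <= eta).
Proof.
move=> eta0 e0; have q0 : 0 < p := p0.
have [C1 C10 hC1] := weighted_sum_bound r01 g_range c_gt0 r_cvg.
have [C2 C20 hC2] := rtail_bound r01 g_range c_gt0 r_cvg.
(* [A1] and [A2] are what the two inequalities leave once the powers of [n] cancel; [4 ^ 4] and
   [2 ^ 2] come from the thresholds [eta / 4] and [eta / 2]. *)
have [A1 A10 A1E] : exists2 a, 0 < a & a = 11 * C1 ^+ 2 * 4 ^+ 4 / eta ^+ 4.
  by eexists; last reflexivity; rewrite divr_gt0 ?mulr_gt0 ?exprn_gt0//; lra.
have [A2 A20 A2E] : exists2 a, 0 < a & a = C2 * 2 ^+ 2 / eta ^+ 2.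
  by eexists; last reflexivity; rewrite divr_gt0 ?mulr_gt0 ?exprn_gt0//; lra.
pose x := minr 1 (e / (A1 + A2)).
have x0 : 0 < x by rewrite lt_min ltr01 divr_gt0// addr_gt0.
have x1 : x <= 1 by rewrite ge_min lexx.
have hx : A1 * x ^+ 2 + A2 * x <= e.
  apply: (@le_trans _ _ ((A1 + A2) * x)).
    by rewrite mulrDl lerD2r expr2 mulrA ler_piMr// mulr_ge0// ltW.
  by rewrite mulrC -ler_pdivlMr ?addr_gt0// ge_min lexx orbT.
(* The 3 comes from [K + 1 <= n dl + 2 <= 3 n dl], valid once [n dl >= 1]. *)
pose dl := x `^ p^-1 / 3.
have dl0 : 0 < dl by rewrite divr_gt0 ?powR_gt0//; lra.
have dlx : (3 * dl) `^ p = x.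
  have -> : 3 * dl = x `^ p^-1 by rewrite /dl; lra.
  by rewrite -powRrM mulVf ?powRr1 ?(ltW x0)// gt_eqF.
exists dl => //.
have hn1 := nbhs_infty_ge (truncn (dl^-1)).+1.
near=> n.
have hn : (truncn (dl^-1) < n)%N by near: n.
have n0 : (0 < n)%N by apply: leq_ltn_trans hn.
have nR : (0 : R) < n%:R by rewrite ltr0n.
have ndl : 1 <= n%:R * dl.
  rewrite -ler_pdivrMr// div1r; apply: le_trans (ltW (truncnS_gt _)) _.
  by rewrite ler_nat.
set K := (truncn (n%:R * dl)).+1.
have hK : K.+1%:R <= n%:R * (3 * dl).
  have h : (truncn (n%:R * dl))%:R <= n%:R * dl by rewrite truncn_le// mulr_ge0 ?ltW.
  by rewrite /K -natr1 -natr1; lra.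
have hKp : K.+1%:R `^ p <= n%:R `^ p * x.
  have d3 : 0 <= 3 * dl by lra.
  rewrite -{1}dlx -powRM ?(ltW nR)//.
  by apply: powR_le2 => //; exact: ltW.
have a0 := amp_gt0 n0.
have np0 : 0 < n%:R `^ p by rewrite powR_gt0.
pose cc k : R := k.+1%:R `^ p.
have cc0 j : 0 < cc j by rewrite powR_gt0.
have cci j : cc j <= cc j.+1 by apply: powR_le2; rewrite ?(ltW q0)// ler_nat.
have amp4 : amp n ^+ 4 = (n%:R `^ p) ^+ 2 by rewrite -amp2 -exprM.
have E1 : smallev P (A1 * x ^+ 2) (fun w => forall k, (0 <= k <= K)%N -> `|wsum M cc 0 k w| < amp n * eta / 4).
  apply: smallev_maximal => //; first by rewrite divr_gt0 ?mulr_gt0.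
  rewrite ler_pdivrMr ?exprn_gt0 ?divr_gt0 ?mulr_gt0//.
  have -> : A1 * x ^+ 2 * (amp n * eta / 4) ^+ 4 = 11 * (C1 * (n%:R `^ p * x)) ^+ 2.
    by rewrite A1E !exprMn amp4; field; rewrite gt_eqF.
  rewrite ler_pM2l//; apply: lerXn2r; rewrite ?nnegrE ?qsum_ge0 ?mulr_ge0 ?powR_ge0 ?(ltW C10) ?(ltW x0)//.
  apply: le_trans (hC1 K) _; rewrite ler_pM2l//; apply: le_trans hKp.
  by apply: powR_le2; rewrite ?(ltW q0)// ler_nat.
have E2 : smallev P (A2 * x) (fun w => `|cc K * (ML w - M K w)| <= amp n * eta / 2).
  apply: (@smallev_markov2 _ _ _ _ _ _ (C2 * (n%:R `^ p * x))); first by apply: bmfZ; exact: bmfB.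
  - by rewrite divr_gt0 ?mulr_gt0.
  - have -> : Ex P (fun w => (cc K * (ML w - M K w)) ^+ 2) = cc K ^+ 2 * Ex P (fun w => (ML w - M K w) ^+ 2).
      rewrite -ExZ; last by apply: bmfX; exact: bmfB.
      by congr (Ex P _); apply/funext => w; rewrite exprMn.
    have h := le_trans (Ex_ML2 HH r01 g_range c_gt0 r_cvg M01 ML01 mML cvgML K) (hC2 K).
    apply: le_trans (ler_wpM2l (sqr_ge0 _) h) _.
    have -> : cc K ^+ 2 * (C2 * K.+1%:R `^ (- (2 * g - 1))) = C2 * K.+1%:R `^ p.
      by rewrite powRN -/p /cc; field; rewrite gt_eqF ?powR_gt0.
    by rewrite ler_pM2l.
  - apply: eq_ler; rewrite !exprMn amp2 A2E exprVn; field.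
    by rewrite (gt_eqF np0) (gt_eqF eta0).
apply: smallev_sub hx _ (smallev_and E1 E2) => w [h1 h2] t /andP[t0 tdl].
rewrite -(ler_pM2l a0); apply: le_trans (proc_le_weight _ n0 t0) _.
set k := truncn (n%:R * t).
have kK : (k <= K)%N by apply: leqW; apply: le_truncn; rewrite ler_pM2l.
have h3 : cc k * `|M K w - M k w| <= amp n * eta / 2.
  apply: (@abel_bound _ cc (fun j => M j w) (fun j => wsum M cc 0 j w)) => //.
    by move=> j; rewrite wsumS//; ring.
  move=> j /andP[kj jK]; apply: le_trans (ler_normB _ _) _.
  have := h1 j jK; have := h1 k kK; lra.
have h4 : cc k * `|ML w - M K w| <= amp n * eta / 2.
  apply: le_trans h2; rewrite normrM (ger0_norm (powR_ge0 _ _)) ler_wpM2r//.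
  by apply: powR_le2; rewrite ?(ltW q0)// ler_nat ltnS.
have : `|M k w - ML w| <= `|M K w - M k w| + `|ML w - M K w|.
  by rewrite distrC; apply: le_trans (ler_distD (M K w) _ _) _; rewrite addrC.
move/(ler_wpM2l (ltW (cc0 k))); rewrite mulrDr; rewrite -/(cc k); lra.
Unshelve. all: by end_near. Qed.

Lemma powR_lipschitz (x0 s t : R) : 0 < x0 -> x0 <= s -> s <= t ->
  `|t `^ p - s `^ p| <= p * x0 `^ (p - 1) * (t - s).
Proof.
move=> x00 xs; have /andP[q0 q1] := p_range g_range; rewrite -/p in q0 q1.
rewrite le_eqVlt => /predU1P[->|st]; first by rewrite !subrr normr0 mulr0.
have [z /andP[sz zt] ->] := powR_MVT p (lt_le_trans x00 xs) st.
have ts : 0 <= t - s by rewrite subr_ge0 ltW.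
rewrite ger0_norm; last by rewrite !mulr_ge0 ?powR_ge0// ltW.
rewrite ler_wpM2r// ler_pM2l//; apply: powR_le0 => //; last by lra.
exact: ltW (le_lt_trans xs sz).
Qed.

Lemma rtail_nincr m K : (m <= K)%N -> tl K <= tl m.
Proof.
move=> mK; rewrite -subr_ge0 -(rtail_sum r mK).
by apply: sumr_ge0 => k _; exact: sqr_ge0.
Qed.

(** Within a block of the grid, the martingale index moves, with rescaled variance at most
    [2 C / m], and the factor [t ^ p] moves by at most [D0 / m]. A fourth moment for the former and
    a second moment for the latter both give [1 / m ^ 2]. *)
Lemma tight_block (dl eta C C2 l : R) (m n j : nat) (T : R) : 0 < dl -> 0 < eta -> 0 < T -> 0 <= C -> 0 <= C2 ->
  (forall n k, (0 < n)%N -> (truncn (n%:R * (dl / 2)) <= k)%N -> n%:R `^ p * r k ^+ 2 <= C / n%:R) ->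
  n%:R `^ p * tl (truncn (n%:R * (dl / 2))) <= C2 ->
  (0 < m)%N -> 2 <= m%:R * dl -> (m <= n)%N -> l = eta / (2 * (T `^ p + 1)) ->
  smallev P ((11 * (2 * C) ^+ 2 / l ^+ 4 + (p * (dl / 2) `^ (p - 1)) ^+ 2 * C2 / (eta / 2) ^+ 2) / m%:R ^+ 2)
   (fun w => forall t, dl <= t <= T -> truncn (m%:R * t) = j ->
    `|Xp n t w - Xp n ((truncn (m%:R * t))%:R / m%:R) w| <= eta).
Proof.
move=> dl0 eta0 T0 C0 C20 hC hC2 m0 hm mn lE; have q0 : 0 < p := p0.
have Tp0 : 0 < T `^ p + 1 by rewrite ltr_pwDr ?powR_ge0.
have l0 : 0 < l by rewrite lE divr_gt0 ?mulr_gt0.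
have mR : (0 : R) < m%:R by rewrite ltr0n.
have n0 : (0 < n)%N by exact: leq_trans mn.
have nR : (0 : R) < n%:R by rewrite ltr0n.
have [D0 D00 D0E] : exists2 a, 0 < a & a = p * (dl / 2) `^ (p - 1).
  by eexists; last reflexivity; rewrite mulr_gt0 ?powR_gt0// divr_gt0.
rewrite -D0E.
(* A block starting before [dl / 2] ends before [dl], since [1 / m <= dl / 2]: the claim is void
   there. *)
have [hj|hj] := ltP (j%:R / m%:R) (dl / 2).
  exists set0; split => //.
    have l40 : 0 <= l ^+ 4 by rewrite exprn_ge0// ltW.
    have e20 : 0 <= (eta / 2) ^+ 2 := sqr_ge0 _.
    rewrite measure0 /=; apply: divr_ge0; last exact: sqr_ge0.
    by apply: addr_ge0; apply: divr_ge0 => //; apply: mulr_ge0 => //; exact: sqr_ge0.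
  move=> w _ t /andP[dt _] E; exfalso.
  have h1 : m%:R * dl <= m%:R * t by rewrite ler_pM2l.
  have h2 := truncnS_gt (m%:R * t); rewrite E -natr1 in h2.
  by rewrite ltr_pdivrMr// in hj; lra.
pose a := truncn (n%:R * (j%:R / m%:R) : R); pose b := truncn (n%:R * (j.+1%:R / m%:R) : R).
have jR : (0 : R) <= j%:R by [].
have nj0 : 0 <= n%:R * (j%:R / m%:R) :> R by exact: mulr_ge0 (ler0n _ _) (divr_ge0 (ler0n _ _) (ler0n _ _)).
have nj1 : 0 <= n%:R * (j.+1%:R / m%:R) :> R by exact: mulr_ge0 (ler0n _ _) (divr_ge0 (ler0n _ _) (ler0n _ _)).
have ab : (a <= b)%N by apply: le_truncn; rewrite ler_pM2l// ler_pM2r ?invr_gt0// ler_nat.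
have a_dl : (truncn (n%:R * (dl / 2)) <= a)%N by apply: le_truncn; rewrite ler_pM2l.
(* The truncations cost at most 1, absorbed by the factor 2 because [m <= n]. *)
have hba : (b - a)%:R <= 2 * n%:R / m%:R :> R.
  rewrite natrB//.
  have h1 : b%:R <= n%:R * (j.+1%:R / m%:R) :> R by rewrite /b truncn_le.
  have h2 := truncnS_gt (n%:R * (j%:R / m%:R) : R); rewrite -/a -natr1 in h2.
  have h3 : n%:R * (j.+1%:R / m%:R) = n%:R * (j%:R / m%:R) + n%:R / m%:R :> R by rewrite -natr1; ring.
  have h4 : 1 <= (n%:R : R) / m%:R by rewrite ler_pdivlMr// mul1r ler_nat.
  by rewrite -mulrA; lra.
have hq : qsum r (fun=> amp n) a b <= 2 * C / m%:R.
  apply: (@le_trans _ _ (\sum_(a <= k < b) C / n%:R)).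
    rewrite /qsum big_nat [leRHS]big_nat; apply: ler_sum => k /andP[ak _].
    by rewrite exprMn amp2; apply: hC => //; exact: leq_trans ak.
  rewrite sumr_const_nat -[leLHS]mulr_natr.
  apply: le_trans (ler_wpM2l _ hba) _; first by rewrite divr_ge0.
  by apply: eq_ler; field; rewrite (gt_eqF mR) (gt_eqF nR).
have E1 : smallev P (11 * (2 * C) ^+ 2 / l ^+ 4 / m%:R ^+ 2)
    (fun w => forall k, (a <= k <= b)%N -> `|wsum M (fun=> amp n) a k w| < l).
  apply: smallev_maximal => //.
  have -> : 11 * (2 * C) ^+ 2 / l ^+ 4 / m%:R ^+ 2 = 11 * (2 * C / m%:R) ^+ 2 / l ^+ 4.
    by field; rewrite (gt_eqF l0) (gt_eqF mR).
  rewrite ler_pM2r ?invr_gt0 ?exprn_gt0// ler_pM2l//.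
  by apply: lerXn2r; rewrite ?nnegrE ?qsum_ge0 ?divr_ge0 ?mulr_ge0.
have E2 : smallev P (D0 ^+ 2 * C2 / (eta / 2) ^+ 2 / m%:R ^+ 2)
    (fun w => `|D0 / m%:R * amp n * (ML w - M a w)| <= eta / 2).
  apply: (@smallev_markov2 _ _ _ _ _ _ ((D0 / m%:R) ^+ 2 * C2)).
  - by apply: bmfZ; exact: bmfB.
  - by rewrite divr_gt0.
  - have -> : Ex P (fun w => (D0 / m%:R * amp n * (ML w - M a w)) ^+ 2) =
        (D0 / m%:R) ^+ 2 * (n%:R `^ p * Ex P (fun w => (ML w - M a w) ^+ 2)).
      rewrite -amp2 mulrA -exprMn -ExZ; last by apply: bmfX; exact: bmfB.
      by congr (Ex P _); apply/funext => w; rewrite [in RHS]exprMn [in LHS]exprMn exprMn.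
    rewrite ler_wpM2l ?sqr_ge0//; apply: le_trans hC2; rewrite ler_wpM2l ?powR_ge0//.
    by apply: le_trans (Ex_ML2 HH r01 g_range c_gt0 r_cvg M01 ML01 mML cvgML a) _; exact: rtail_nincr.
  - apply: eq_ler; field; by rewrite (gt_eqF mR) (gt_eqF eta0).
apply: smallev_sub (smallev_and E1 E2); first by rewrite -mulrDl.
move=> w [h1 h2] t /andP[dt tT] E; rewrite E.
have t0 : 0 < t by exact: lt_le_trans dt.
have hjt : j%:R / m%:R <= t.
  by rewrite ler_pdivrMr// mulrC -E truncn_le// mulr_ge0// ltW.
have htj : t <= j.+1%:R / m%:R.
  by rewrite ler_pdivlMr// mulrC -E ltW// truncnS_gt.
set k := truncn (n%:R * t).
have ak : (a <= k)%N by apply: le_truncn; rewrite ler_pM2l.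
have kb : (k <= b)%N by apply: le_truncn; rewrite ler_pM2l.
have hk : amp n * `|M k w - M a w| <= l.
  have := h1 k; rewrite ak kb => /(_ isT)/ltW.
  have -> : wsum M (fun=> amp n) a k w = amp n * (M k w - M a w).
    by rewrite -(wsum1 _ _ ak) /wsum mulr_sumr; apply: eq_bigr => i _; rewrite mul1r.
  by rewrite normrM (ger0_norm (amp_ge0 _ _)).
have hp : `|t `^ p - (j%:R / m%:R) `^ p| <= D0 / m%:R.
  have dl20 : 0 < dl / 2 by rewrite divr_gt0.
  apply: le_trans (powR_lipschitz dl20 hj hjt) _; rewrite -D0E ler_pM2l//.
  by have : j.+1%:R / m%:R = j%:R / m%:R + m%:R^-1 :> R; [rewrite -natr1; ring|lra].
rewrite /proc -/p -/k -/a.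
have -> : t `^ p * amp n * (M k w - ML w) - (j%:R / m%:R) `^ p * amp n * (M a w - ML w) =
   t `^ p * (amp n * (M k w - M a w)) - (t `^ p - (j%:R / m%:R) `^ p) * (amp n * (ML w - M a w)) by ring.
apply: le_trans (ler_normB _ _) _.
have g1 : `|t `^ p * (amp n * (M k w - M a w))| <= eta / 2.
  rewrite normrM (ger0_norm (powR_ge0 _ _)) normrM (ger0_norm (amp_ge0 _ _)).
  have tp : t `^ p <= T `^ p by apply: powR_le2 => //; exact: ltW.
  apply: (@le_trans _ _ ((T `^ p + 1) * l)).
    apply: ler_pM => //; rewrite ?powR_ge0 ?mulr_ge0 ?amp_ge0//; lra.
  by apply: eq_ler; rewrite lE; field; rewrite gt_eqF.
have g2 : `|(t `^ p - (j%:R / m%:R) `^ p) * (amp n * (ML w - M a w))| <= eta / 2.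
  apply: le_trans h2; rewrite -mulrA normrM [leRHS]normrM ler_wpM2r//.
  by apply: le_trans hp _; exact: ler_norm.
lra.
Qed.

Lemma tight_large (dl eta e T : R) : 0 < dl -> 0 < eta -> 0 < e -> 0 < T -> exists m0 : nat,
  forall m, (m0 <= m)%N -> \forall n \near \oo, smallev P e (fun w => forall t, dl <= t <= T ->
    `|Xp n t w - Xp n ((truncn (m%:R * t))%:R / m%:R) w| <= eta).
Proof.
move=> dl0 eta0 e0 T0; have q0 : 0 < p := p0.
have dl20 : 0 < dl / 2 by rewrite divr_gt0.
have [C C0 hC] := rstep_trunc r01 g_range c_gt0 r_cvg dl20.
have hlim := rtail_trunc r01 g_range c_gt0 r_cvg dl20.
have L0 : 0 <= c ^+ 2 / (2 * g - 1) * (dl / 2) `^ (- (2 * g - 1)).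
  by rewrite mulr_ge0 ?powR_ge0// divr_ge0 ?sqr_ge0// ltW.
move: hlim L0; set L := _ * (dl / 2) `^ _ => hlim L0.
have L10 : 0 <= L + 1 by lra.
have hL : \forall n \near \oo, n%:R `^ p * tl (truncn (n%:R * (dl / 2))) <= L + 1.
  have [A _ hA] := (cvgrPdist_le _ _).1 hlim _ ltr01.
  exists A => // n /hA /=; rewrite distrC => /(le_trans (ler_norm _)); rewrite -/p; lra.
have [l _ lE] : exists2 l : R, True & l = eta / (2 * (T `^ p + 1)) by eexists.
have Tp0 : 0 < T `^ p + 1 by rewrite ltr_pwDr ?powR_ge0.
have l0 : 0 < l by rewrite lE divr_gt0 ?mulr_gt0.
have hB := @tight_block dl eta C (L + 1) l _ _ _ T dl0 eta0 T0 (ltW C0) L10 hC.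
have D0 : 0 <= 11 * (2 * C) ^+ 2 / l ^+ 4 + (p * (dl / 2) `^ (p - 1)) ^+ 2 * (L + 1) / (eta / 2) ^+ 2.
  have l40 : 0 <= l ^+ 4 by rewrite exprn_ge0// ltW.
  have e20 : 0 <= (eta / 2) ^+ 2 := sqr_ge0 _.
  by apply: addr_ge0; apply: divr_ge0 => //; apply: mulr_ge0 => //; exact: sqr_ge0.
move: hB D0; set D := (X in _ -> 0 <= X -> _) => hB D0.
exists (maxn (truncn (2 / dl)).+1 (truncn (D * (T + 1) / e)).+1) => m; rewrite geq_max => /andP[m1 m2].
have m0 : (0 < m)%N by exact: leq_ltn_trans m1.
have mR : (0 : R) < m%:R by rewrite ltr0n.
have mdl : 2 <= m%:R * dl.
  by rewrite -ler_pdivrMr//; apply: le_trans (ltW (truncnS_gt _)) _; rewrite ler_nat.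
(* At most [m (T + 1)] blocks, each failing with probability at most [D / m ^ 2]. *)
have mD : D * (T + 1) / m%:R <= e.
  rewrite ler_pdivrMr// mulrC [leRHS]mulrC mulrC -ler_pdivrMr//.
  by apply: le_trans (ltW (truncnS_gt _)) _; rewrite ler_nat.
near=> n.
have mn : (m <= n)%N by near: n; exact: nbhs_infty_ge.
have hLn : n%:R `^ p * tl (truncn (n%:R * (dl / 2))) <= L + 1 by near: n.
set J := (truncn (m%:R * T)).+1.
have hJ : J%:R <= m%:R * (T + 1).
  have h : (truncn (m%:R * T))%:R <= m%:R * T by rewrite truncn_le// mulr_ge0 ?ltW.
  have : (1 : R) <= m%:R by rewrite ler1n.
  by rewrite /J -natr1 mulrDr; lra.
have E0 : 0 <= D / m%:R ^+ 2 by rewrite divr_ge0 ?exprn_ge0.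
apply: smallev_sub (smallev_all E0 (fun j _ => hB m n j hLn m0 mdl mn lE)).
  apply: le_trans mD; apply: le_trans (ler_wpM2r E0 hJ) _.
  by apply: eq_ler; field; rewrite gt_eqF.
move=> w h t /andP[dt tT]; apply: (h (truncn (m%:R * t))) => //; last by rewrite dt.
by rewrite ltnS; apply: le_truncn; rewrite ler_pM2l.
Unshelve. all: by end_near. Qed.

Lemma tight (eta e T : R) : 0 < eta -> 0 < e -> 0 < T -> exists m0 : nat,
  forall m, (m0 <= m)%N -> \forall n \near \oo, smallev P e (fun w => forall t, 0 <= t <= T ->
    `|Xp n t w - Xp n ((truncn (m%:R * t))%:R / m%:R) w| <= eta).
Proof.
move=> eta0 e0 T0.
have eta20 : 0 < eta / 2 by rewrite divr_gt0.
have e20 : 0 < e / 2 by rewrite divr_gt0.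
have [dl dl0 h1] := tight_small eta20 e20.
have [m0 h2] := tight_large dl0 eta0 e20 T0.
exists (maxn 1 m0) => m; rewrite geq_max => /andP[m1 m0m].
have h3 := h2 m m0m.
have mR : (0 : R) < m%:R by rewrite ltr0n.
near=> n.
have s1 : smallev P (e / 2) (fun w => forall t, 0 <= t <= dl -> `|Xp n t w| <= eta / 2) by near: n.
have s2 : smallev P (e / 2) (fun w => forall t, dl <= t <= T ->
    `|Xp n t w - Xp n ((truncn (m%:R * t))%:R / m%:R) w| <= eta) by near: n.
apply: smallev_sub (smallev_and s1 s2); first by lra.
move=> w [a1 a2] t /andP[t0 tT]; have [tdl|/ltW dlt] := leP t dl; last by apply: a2; rewrite dlt.
have mt : (truncn (m%:R * t))%:R / m%:R <= t.
  by rewrite ler_pdivrMr// mulrC truncn_le// mulr_ge0.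
apply: le_trans (ler_normB _ _) _.
have b1 := a1 t; rewrite t0 tdl in b1; have {}b1 := b1 isT.
have b2 : `|Xp n ((truncn (m%:R * t))%:R / m%:R) w| <= eta / 2.
  by apply: a1; rewrite divr_ge0//= (le_trans mt).
lra.
Unshelve. all: by end_near. Qed.

End tightness.

(** * Paths *)

Section paths.
Context {R : realType}.
Implicit Types (x y : R -> R) (t s e T : R).

(** A single epsilon-delta statement for the interior points and for one-sided continuity at 0. *)
Definition halfline_continuous y : Prop := forall t e, 0 <= t -> 0 < e ->
  exists2 dl : R, 0 < dl & forall s, 0 <= s -> `|s - t| < dl -> `|y s - y t| <= e.

Lemma halfline_continuousP y : {within `[0, +oo[%classic, continuous y} -> halfline_continuous y.
Proof.
move=> /continuous_within_itvcyP[hc h0] t e t0 e0; have [tE|tpos] := eqVneq t 0.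
  have := (cvgrPdist_le _ _).1 h0 _ e0; rewrite near_withinE => -[dl dl0 hdl].
  exists dl => // s s0; rewrite tE; have [->|sn] := eqVneq s 0; first by move=> _; rewrite subrr normr0 ltW.
  by move=> h; rewrite distrC; apply: hdl; [rewrite /= distrC|rewrite /= lt0r sn].
have tin : t \in `]0, +oo[%R by rewrite in_itv/= andbT lt0r tpos.
have [dl dl0 hdl] := (cvgrPdist_le _ _).1 (hc t tin) _ e0.
by exists dl => // s s0 h; rewrite distrC; apply: hdl; rewrite /= distrC.
Qed.

Lemma halfline_continuous_comp y z : (forall t, 0 <= t -> 0 <= z t) ->
  halfline_continuous y -> halfline_continuous z -> halfline_continuous (y \o z).
Proof.
move=> z0 hy hz t e t0 e0; have [d1 d10 h1] := hy (z t) e (z0 _ t0) e0.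
have d20 : 0 < d1 / 2 by rewrite divr_gt0.
have [d2 d2p h2] := hz t (d1 / 2) t0 d20.
exists d2 => // s s0 st /=; apply: h1; first exact: z0.
by apply: le_lt_trans (h2 s s0 st) _; rewrite ltr_pdivrMr// ltr_pMr// ltrDl.
Qed.

Lemma halfline_continuous_cst (k : R) : halfline_continuous (fun=> k).
Proof. by move=> t e _ e0; exists 1 => // s _ _; rewrite subrr normr0 ltW. Qed.

Lemma halfline_continuousZ (k : R) y : halfline_continuous y -> halfline_continuous (fun t => k * y t).
Proof.
move=> hy t e t0 e0; have k1 : 0 < `|k| + 1 by rewrite ltr_pwDr.
have ek : 0 < e / (`|k| + 1) by rewrite divr_gt0.
have [dl dl0 h] := hy t _ t0 ek; exists dl => // s s0 st.
rewrite -mulrBr normrM; apply: (@le_trans _ _ ((`|k| + 1) * (e / (`|k| + 1)))).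
  by apply: ler_pM => //; [rewrite lerDl|exact: h].
by rewrite mulrC divfK ?gt_eqF.
Qed.

Lemma halfline_continuous_powR (p : R) : 0 < p -> halfline_continuous (fun t => t `^ p).
Proof.
move=> p0 t e t0 e0; have [tE|tpos] := eqVneq t 0.
  exists (e `^ p^-1); first by rewrite powR_gt0.
  move=> s s0; rewrite tE subr0 powR0 ?gt_eqF// subr0 !ger0_norm ?powR_ge0// => se.
  have -> : e = (e `^ p^-1) `^ p by rewrite -powRrM mulVf ?gt_eqF// powRr1// ltW.
  by apply: powR_le2; rewrite ?(ltW p0)// ltW.
have t1 : 0 < t by rewrite lt0r tpos.
have hd : is_derive t 1 (fun x : R => x `^ p) (p * t `^ (p - 1)) by exact: is_derive1_powR.
have hc : {for t, continuous (fun x : R => x `^ p)}.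
  by apply: differentiable_continuous; apply/derivable1_diffP; case: hd.
have [dl dl0 hdl] := (cvgrPdist_le _ _).1 hc _ e0.
by exists dl => // s s0 h; rewrite distrC; apply: hdl; rewrite /= distrC.
Qed.

Lemma truncn_right (v t : R) : 0 <= v -> 0 <= t -> \forall s \near t^'+, truncn (v * s) = truncn (v * t).
Proof.
move=> v0 t0; have h := truncnS_gt (v * t).
have [vE|vn] := eqVneq v 0; first by apply: nearW => s; rewrite vE !mul0r.
have vp : 0 < v by rewrite lt0r vn.
have hd : 0 < ((truncn (v * t)).+1%:R - v * t) / v by rewrite divr_gt0// subr_gt0.
near=> s.
have ts : t < s by near: s; exact: nbhs_right_gt.
have st : s < t + ((truncn (v * t)).+1%:R - v * t) / v.
  by near: s; apply: nbhs_right_lt; rewrite ltrDl.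
apply: truncn_def; apply/andP; split.
  apply: (@le_trans _ _ (v * t)); first by rewrite truncn_le// mulr_ge0.
  by rewrite ler_pM2l// ltW.
move: st; rewrite -(ltr_pM2l vp) mulrDr [v * (_ / v)]mulrC divfK ?gt_eqF//; lra.
Unshelve. all: by end_near. Qed.

Lemma truncn_left (v t : R) : 0 <= v -> 0 < t -> exists k : nat, \forall s \near t^'-, truncn (v * s) = k.
Proof.
move=> v0 t0; have [vE|vn] := eqVneq v 0.
  by exists 0%N; apply: nearW => s; rewrite vE mul0r truncn0.
have vp : 0 < v by rewrite lt0r vn.
have vt : 0 < v * t by rewrite mulr_gt0.
have [k /andP[k1 k2]] : exists k : nat, k%:R < v * t <= k.+1%:R.
  have /andP[h1 h2] := truncn_itv (ltW vt).
  have [E|nE] := eqVneq (truncn (v * t))%:R (v * t); last first.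
    by exists (truncn (v * t)); rewrite lt_neqAle nE h1 ltW.
  case: (truncn (v * t)) E => [|k] E; first by rewrite -E ltxx in vt.
  by exists k; rewrite -E lexx ltr_nat ltnSn.
exists k; near=> s.
have st : s < t by near: s; exact: nbhs_left_lt.
have ks : k%:R / v < s by near: s; apply: nbhs_left_gt; rewrite ltr_pdivrMr// mulrC.
apply: truncn_def; apply/andP; split.
  by rewrite -ler_pdivrMl// mulrC ltW.
by apply: lt_le_trans k2; rewrite ltr_pM2l.
Unshelve. all: by end_near. Qed.

(** Common form of the paths at hand: rescaled paths ([y] the weight, [v = n]), grid approximations
    ([y = 1], [v = m.+1]) and continuous paths ([v = 0]). *)
Definition step_path y (v : R) (a : nat -> R) t : R := if t < 0 then 0 else y t * a (truncn (v * t)).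

Lemma cadlag_step y v a : halfline_continuous y -> 0 <= v -> cadlag (step_path y v a).
Proof.
move=> hy v0; split; [by move=> t t0; rewrite /step_path t0|split].
- move=> t t0.
  have h : y s * a (truncn (v * t)) @[s --> t^'+] --> y t * a (truncn (v * t)).
    apply: cvgM; last exact: cvg_cst.
    apply/cvgrPdist_le => e e0; have [dl dl0 hdl] := hy t e t0 e0.
    near=> s.
    have ts : t < s by near: s; exact: nbhs_right_gt.
    have st : s < t + dl by near: s; apply: nbhs_right_lt; rewrite ltrDl.
    rewrite distrC; apply: hdl; first by rewrite ltW// (le_lt_trans t0).
    by rewrite gtr0_norm ?subr_gt0// ltrBlDl.
  rewrite [X in _ --> X](_ : _ = y t * a (truncn (v * t))); last by rewrite /step_path ltNge t0.
  have E : {near t^'+, (fun s => y s * a (truncn (v * t))) =1 step_path y v a}.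
    have ht := truncn_right v0 t0.
    near=> s.
    have ts : t < s by near: s; exact: nbhs_right_gt.
    rewrite /step_path ltNge ltW ?(le_lt_trans t0)//=.
    by congr (_ * a _); apply/esym; near: s.
  exact: cvg_trans (near_eq_cvg E) h.
- move=> t t0; have [k hk] := truncn_left v0 t0; exists (y t * a k).
  have h : y s * a k @[s --> t^'-] --> y t * a k.
    apply: cvgM; last exact: cvg_cst.
    apply/cvgrPdist_le => e e0; have [dl dl0 hdl] := hy t e (ltW t0) e0.
    near=> s.
    have ts : s < t by near: s; exact: nbhs_left_lt.
    have s0 : 0 < s by near: s; exact: nbhs_left_gt.
    have st : t - dl < s by near: s; apply: nbhs_left_gt; rewrite ltrBlDr ltrDl.
    rewrite distrC; apply: hdl; first exact: ltW.
    by rewrite ltr0_norm ?subr_lt0//; lra.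
  have E : {near t^'-, (fun s => y s * a k) =1 step_path y v a}.
    near=> s.
    have s0 : 0 < s by near: s; exact: nbhs_left_gt.
    rewrite /step_path ltNge ltW//=.
    by congr (_ * a _); apply/esym; near: s.
  exact: cvg_trans (near_eq_cvg E) h.
Unshelve. all: by end_near. Qed.

Definition cpath y t : R := if t < 0 then 0 else y t.

Lemma cadlag_cpath y : halfline_continuous y -> cadlag (cpath y).
Proof.
move=> hy; have := @cadlag_step y 0 (fun=> 1) hy (lexx 0); congr cadlag.
by apply/funext => t; rewrite /step_path /cpath mulr1.
Qed.

Definition luc_cvg (xs : nat -> R -> R) y : Prop := forall T e, 0 < T -> 0 < e ->
  \forall k \near \oo, forall t, 0 <= t <= T -> `|xs k t - y t| <= e.

(** The consequence of Skorohod continuity obtained with identity time changes. It is enough because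
    every approximation of paths below is locally uniform. *)
Definition luc_continuous (F : (R -> R) -> R) (B : R) : Prop :=
  (forall x, cadlag x -> `|F x| <= B) /\
  forall xs y, (forall k, cadlag (xs k)) -> cadlag y -> luc_cvg xs y -> F (xs k) @[k --> \oo] --> F y.

Lemma skorohod_bcont_luc f : skorohod_bcont f -> exists B, luc_continuous f B.
Proof.
move=> [[B hB] hf]; exists B; split => // xs y cxs cy hxy; apply: hf => //.
exists (fun _ t => t); split.
  move=> _; split; first by apply: continuous_subspaceT => t; exact: cvg_id.
  by split => //; split => // u u0; exists u.
move=> T T0 e e0; have := hxy T e T0 e0; apply: filterS => k h t tT; split; last exact: h.
by rewrite subrr normr0 ltW.
Qed.

(** On [0, T] only finitely many terms of the sequence are read, and [y] is bounded by compactness.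
    With [measurable_seq_continuous] this makes functionals of step paths measurable. *)
Lemma luc_cvg_step y (v : R) (a_ : nat -> nat -> R) (a : nat -> R) : halfline_continuous y -> 0 <= v ->
  (forall k, a_ n k @[n --> \oo] --> a k) -> luc_cvg (fun n => step_path y v (a_ n)) (step_path y v a).
Proof.
move=> hy v0 ha T e T0 e0.
have [B B0 hB] : exists2 B : R, 0 < B & forall t, 0 <= t <= T -> `|y t| <= B.
  have hc : compact `[0, T] by exact: segment_compact.
  have /compact_near_coveringP/(_ nat \oo (fun n t => 0 <= t -> `|y t| <= n%:R)) := hc.
  case=> [t tT /=|n _ hn].
    move: tT; rewrite /= in_itv/= => /andP[t0 _].
    have [dl dl0 h] := hy t 1 t0 ltr01.
    exists (ball t dl, [set n | (truncn (`|y t| + 1) < n)%N]).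
      by split; [exact: nbhsx_ballx|exists (truncn (`|y t| + 1)).+1].
    move=> [s n] [/= hs hn] s0.
    have h1 : `|y s - y t| <= 1 by apply: h => //; rewrite distrC.
    apply: (@le_trans _ _ (`|y t| + 1)).
      by rewrite -(subrK (y t) (y s)); apply: le_trans (ler_normD _ _) _; rewrite addrC lerD2l.
    by apply: le_trans (ltW (truncnS_gt _)) _; rewrite ler_nat.
  exists (n%:R + 1); first by rewrite ltr_wpDl.
  move=> t /andP[t0 tT]; apply: (@le_trans _ _ n%:R); last by rewrite lerDl.
  by apply: (hn n) => //=; rewrite in_itv/= t0.
have eB : 0 < e / B by rewrite divr_gt0.
have hnear : \forall n \near \oo, forall k, (k < (truncn (v * T)).+1)%N -> `|a_ n k - a k| <= e / B.
  apply: (@near_all_lt _ (fun k n => `|a_ n k - a k| <= e / B)) => k _.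
  have [A _ hA] := (cvgrPdist_le _ _).1 (ha k) _ eB.
  by exists A => // n /hA /=; rewrite distrC.
case: hnear => A _ hA; exists A => // n /hA /= h t /andP[t0 tT]; rewrite /step_path ltNge t0 /= -mulrBr normrM.
apply: (@le_trans _ _ (B * (e / B))); last by rewrite mulrC divfK// gt_eqF.
apply: ler_pM => //; first by apply: hB; rewrite t0.
by apply: h; rewrite ltnS; apply: le_truncn; rewrite ler_wpM2l.
Qed.

Lemma luc_cvg_grid y : halfline_continuous y ->
  luc_cvg (fun m => step_path (fun=> 1) m.+1%:R (fun i => y (i%:R / m.+1%:R))) (cpath y).
Proof.
move=> hy T e T0 e0.
have hc : compact `[0, T] by exact: segment_compact.
have /compact_near_coveringP/(_ nat \oo (fun m t => 0 <= t ->
  `|y ((truncn (m.+1%:R * t))%:R / m.+1%:R) - y t| <= e)) := hc.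
case=> [t tT /=|n _ hn]; last first.
  exists n => // m nm t /andP[t0 tT]; rewrite /step_path /cpath ltNge t0 /= mul1r.
  by apply: (hn m) => //=; rewrite in_itv/= t0.
move: tT; rewrite /= in_itv/= => /andP[t0 _].
have e20 : 0 < e / 2 by rewrite divr_gt0.
have [dl dl0 h] := hy t _ t0 e20.
have dl20 : 0 < dl / 2 by rewrite divr_gt0.
have [A _ hA] := near_natSinv_le (divr_gt0 dl20 (ltr0n R 2)).
exists (ball t (dl / 2), [set m | (A <= m)%N]); first by split; [exact: nbhsx_ballx|exists A].
move=> [s m] [/= hs hm] s0; have hmA := hA m hm; rewrite /= in hmA.
have hst : `|s - t| < dl / 2 by rewrite distrC.
have m0 : (0 : R) < m.+1%:R by rewrite ltr0n.
have ms0 : 0 <= m.+1%:R * s by rewrite mulr_ge0.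
set s' := (truncn (m.+1%:R * s))%:R / m.+1%:R.
have s's : `|s' - s| <= m.+1%:R^-1.
  have /andP[h1 h2] := truncn_itv ms0; rewrite -[X in _ < X]natr1 in h2.
  have E : s' - s = ((truncn (m.+1%:R * s))%:R - m.+1%:R * s) / m.+1%:R.
    by rewrite /s' mulrBl mulrAC divff ?mul1r// gt_eqF.
  rewrite E normrM normfV (gtr0_norm m0) ler_piMl ?invr_ge0//.
  rewrite ler_norml; apply/andP; split; lra.
have k1 : `|y s - y t| <= e / 2 by apply: h => //; apply: lt_trans hst _; lra.
have k2 : `|y s' - y t| <= e / 2.
  apply: h; first by rewrite divr_ge0.
  apply: le_lt_trans (le_trans (ler_distD s _ _) (lerD (le_trans s's hmA) (ltW hst))) _; lra.
rewrite distrC in k1; apply: le_trans (le_trans (ler_distD (y t) _ _) (lerD k2 k1)) _; lra.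
Qed.

End paths.

(** * Weak convergence in path space *)

(* Lipschitz regularisation from below: [minorant k] increases to [F] and is Lipschitz for
   the uniform distance on [0, k], hence only sees finitely many grid values of a step path. *)
Section minorant.
Context {R : realType} (F : (R -> R) -> R) (B : R) (hF : luc_continuous F B).
Implicit Types (x y : R -> R) (k : nat).

Definition minorant_set k x : set R := [set v | exists y (dl : R), [/\ cadlag y, 0 <= dl,
  (forall t, 0 <= t <= k%:R -> `|x t - y t| <= dl) & v = F y + k%:R * dl]].

Definition minorant k x : R := inf (minorant_set k x).

Let FB x : cadlag x -> `|F x| <= B. Proof. exact: hF.1. Qed.

Lemma cadlag0 : cadlag (fun _ : R => 0 : R).
Proof.
have := @cadlag_step R (fun=> 0) 0 (fun=> 0) (@halfline_continuous_cst R 0) (lexx 0).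
by congr cadlag; apply/funext => t; rewrite /step_path mul0r if_same.
Qed.

Lemma luc_bound_ge0 : 0 <= B.
Proof. exact: le_trans (FB cadlag0). Qed.

Lemma minorant_set_self k x : cadlag x -> minorant_set k x (F x).
Proof.
by move=> cx; exists x, 0; split; rewrite ?mulr0 ?addr0// => t _; rewrite subrr normr0.
Qed.

Lemma minorant_set_lb k x v : minorant_set k x v -> - B <= v.
Proof.
move=> [y [dl [cy dl0 _ ->]]]; apply: (@le_trans _ _ (F y)); last by rewrite lerDl mulr_ge0.
by have := FB cy; rewrite ler_norml => /andP[].
Qed.

Lemma minorant_le_elt k x v : minorant_set k x v -> minorant k x <= v.
Proof. by move=> hv; apply: ge_inf => //; exists (- B) => u; exact: minorant_set_lb. Qed.

Lemma minorant_le k x : cadlag x -> minorant k x <= F x.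
Proof. by move=> cx; apply: minorant_le_elt; exact: minorant_set_self. Qed.

Lemma minorant_ge k x b : cadlag x -> (forall v, minorant_set k x v -> b <= v) -> b <= minorant k x.
Proof.
move=> cx h; apply: lb_le_inf; first by exists (F x); exact: minorant_set_self.
by move=> v; exact: h.
Qed.

Lemma minorant_norm k x : cadlag x -> `|minorant k x| <= B.
Proof.
move=> cx; rewrite ler_norml; apply/andP; split.
  by apply: minorant_ge => // v; exact: minorant_set_lb.
by apply: le_trans (minorant_le k cx) _; have := FB cx; rewrite ler_norml => /andP[].
Qed.

Lemma minorant_lip k x y (D : R) : cadlag x -> cadlag y -> 0 <= D ->
  (forall t, 0 <= t <= k%:R -> `|x t - y t| <= D) -> minorant k x <= minorant k y + k%:R * D.
Proof.
move=> cx cy D0 hxy; rewrite -lerBlDr; apply: minorant_ge => // _ [z [dl [cz dl0 hz ->]]].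
rewrite lerBlDr -addrA -mulrDr; apply: minorant_le_elt; exists z, (dl + D); split => //; first exact: addr_ge0.
by move=> t tk; apply: le_trans (ler_distD (y t) _ _) _; rewrite addrC lerD ?hz ?hxy.
Qed.

Lemma minorant_dist k x y (D : R) : cadlag x -> cadlag y -> 0 <= D ->
  (forall t, 0 <= t <= k%:R -> `|x t - y t| <= D) -> `|minorant k x - minorant k y| <= k%:R * D.
Proof.
move=> cx cy D0 hxy; have h1 := minorant_lip cx cy D0 hxy.
have h2 : minorant k y <= minorant k x + k%:R * D by apply: minorant_lip => // t /hxy; rewrite distrC.
rewrite ler_norml; apply/andP; split; lra.
Qed.

Lemma minorant_luc k : luc_continuous (minorant k) B.
Proof.
split; first by move=> x; exact: minorant_norm.
move=> xs y cxs cy hxy; apply/cvgrPdist_le => e e0.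
have k1 : (0 : R) < k%:R + 1 by rewrite ltr_wpDl.
have ek : 0 < e / (k%:R + 1) by rewrite divr_gt0.
have [A _ hA] := hxy _ _ k1 ek; exists A => // n /hA /= h.
rewrite distrC; apply: le_trans (minorant_dist (cxs n) cy (ltW ek) _) _.
  by move=> t /andP[t0 tk]; apply: h; rewrite t0 (le_trans tk)// lerDl.
by rewrite mulrCA ler_piMr ?(ltW e0)// ler_pdivrMr// mul1r lerDl.
Qed.

Lemma minorant_nd k l x : (k <= l)%N -> cadlag x -> minorant k x <= minorant l x.
Proof.
move=> kl cx; apply: minorant_ge => // _ [y [dl [cy dl0 hy ->]]].
apply: (@le_trans _ _ (F y + k%:R * dl)); last by rewrite lerD2l ler_wpM2r// ler_nat.
apply: minorant_le_elt; exists y, dl; split => // t /andP[t0 tk]; apply: hy.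
by rewrite t0 (le_trans tk)// ler_nat.
Qed.

(** Otherwise near-minimisers [y k], within [dl] of [x] on [0, k], satisfy [k * dl <= 2 B], hence
    tend to [x] locally uniformly while [F (y k) < F x - e]. *)
Lemma minorant_cvg x : cadlag x -> minorant k x @[k --> \oo] --> F x.
Proof.
move=> cx; apply/cvgrPdist_le => e e0.
have [[k0 hk0]|hno] := pselect (exists k0, F x - e <= minorant k0 x).
  exists k0 => // k /= k0k; have h := minorant_nd k0k cx; have := minorant_le k cx.
  by move=> h'; rewrite ger0_norm; lra.
exfalso.
have hk k : minorant k x < F x - e by rewrite ltNge; apply/negP => h; apply: hno; exists k.
have /choice[y hy] : forall k, exists y : R -> R, exists dl : R, [/\ cadlag y, 0 <= dl,
    (forall t, 0 <= t <= k%:R -> `|x t - y t| <= dl) & F y + k%:R * dl < F x - e].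
  move=> k; have hinf : has_inf (minorant_set k x).
    split; first by exists (F x); exact: minorant_set_self.
    by exists (- B) => u; exact: minorant_set_lb.
  have gap : 0 < F x - e - minorant k x by rewrite subr_gt0.
  have [_ [y [dl [cy dl0 hy ->]]] hv] := inf_adherent gap hinf.
  by exists y, dl; split => //; move: hv; rewrite -/(minorant k x); lra.
have cy k : cadlag (y k) by have [dl []] := hy k.
have hcv : luc_cvg y x.
  move=> T eps T0 eps0; have B0 := luc_bound_ge0.
  exists (maxn (truncn T).+1 (truncn (2 * B / eps)).+1) => // k /=; rewrite geq_max => /andP[k1 k2] t /andP[t0 tT].
  have kR : (0 : R) < k%:R by rewrite ltr0n (leq_trans _ k1).
  have [dl [_ dl0 h hlt]] := hy k; rewrite distrC; apply: le_trans (h t _) _.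
    rewrite t0 (le_trans tT)// (le_trans (ltW (truncnS_gt T)))//.
    by rewrite ler_nat.
  have h1 := FB cx; have h2 := FB (cy k); rewrite !ler_norml in h1 h2.
  have : k%:R * dl <= 2 * B by lra.
  rewrite mulrC -ler_pdivlMr// => /le_trans; apply.
  rewrite ler_pdivrMr// [leRHS]mulrC -ler_pdivrMr//.
  by apply: (le_trans (ltW (truncnS_gt (2 * B / eps)))); rewrite ler_nat.
have := hF.2 _ _ cy cx hcv => hc.
have : F x <= F x - e.
  apply: (cvgn_le_near hc); apply: nearW => k; have [dl [_ dl0 _ h]] := hy k.
  have : 0 <= k%:R * dl by rewrite mulr_ge0.
  lra.
lra.
Qed.

End minorant.

Lemma luc_continuousN {R : realType} (F : (R -> R) -> R) B : luc_continuous F B -> luc_continuous (fun x => - F x) B.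
Proof.
move=> [h1 h2]; split; first by move=> x cx; rewrite normrN; exact: h1.
by move=> xs y cxs cy h; apply: cvgN; exact: h2.
Qed.

Section weak_convergence.
Context {R : realType} {d d' : measure_display} {Om : measurableType d} {Om' : measurableType d'}.
Context (P : probability Om R) (P' : probability Om' R) (X : nat -> Om -> R -> R) (Y : Om' -> R -> R).
Hypothesis cX : forall n w, cadlag (X n w).
Hypothesis X0 : forall n w, X n w 0 = 0.
Hypothesis mX : forall F B n, luc_continuous F B -> measurable_fun setT (fun w => F (X n w)).
Hypothesis mXt : forall n t, measurable_fun setT (fun w => X n w t).
Hypothesis cY : forall w, halfline_continuous (Y w).
Hypothesis Y0 : forall w, Y w 0 = 0.
Hypothesis mY : forall t, 0 <= t -> measurable_fun setT (fun w => Y w t).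
Hypothesis tightX : forall eta e T : R, 0 < eta -> 0 < e -> 0 < T -> exists m0 : nat,
  forall m, (m0 <= m)%N -> \forall n \near \oo, smallev P e (fun w => forall t, 0 <= t <= T ->
    `|X n w t - X n w ((truncn (m%:R * t))%:R / m%:R)| <= eta).
Hypothesis fddX : forall m q (C L : R) h, (0 < m)%N -> lipf q C L h ->
  Ex P (fun w => h (fun i => X n w (i.+1%:R / m%:R))) @[n --> \oo] -->
  Ex P' (fun w => h (fun i => Y w (i.+1%:R / m%:R))).

Let one_cont := @halfline_continuous_cst R 1.

Local Notation grid m y := (step_path (fun=> 1) m.+1%:R (fun i => y (i%:R / m.+1%:R))).

Lemma cadlag_grid m (y : R -> R) : cadlag (grid m y).
Proof. exact: cadlag_step. Qed.

Lemma bmf_grid {d0} {T : measurableType d0} (xi : T -> R -> R) F B m : luc_continuous F B ->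
  (forall i : nat, measurable_fun setT (fun w => xi w (i%:R / m.+1%:R))) -> bmf (fun w => F (grid m (xi w))).
Proof.
move=> hF mxi; split; last by exists B => w; apply: hF.1; exact: cadlag_grid.
apply: (@measurable_seq_continuous _ _ _ (fun i w => xi w (i%:R / m.+1%:R))
  (fun a => F (step_path (fun=> 1) m.+1%:R a))) => // a_ a ha.
apply: hF.2; [by move=> k; exact: cadlag_step|exact: cadlag_step|].
exact: luc_cvg_step.
Qed.

Let mYg (m i : nat) : measurable_fun setT (fun w => Y w (i%:R / m.+1%:R)).
Proof. by apply: mY; rewrite divr_ge0. Qed.

Lemma F_grid_cvg F B w : luc_continuous F B -> F (grid m (Y w)) @[m --> \oo] --> F (cpath (Y w)).
Proof.
move=> hF; apply: hF.2; [by move=> k; exact: cadlag_step|exact: cadlag_cpath|exact: luc_cvg_grid].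
Qed.

Lemma bmf_limit F B : luc_continuous F B -> bmf (fun w => F (cpath (Y w))).
Proof.
move=> hF; split; last by exists B => w; apply: hF.1; exact: cadlag_cpath.
apply: (@measurable_fun_cvg _ _ _ _ (fun m w => F (grid m (Y w)))) => //.
  by move=> m; case: (bmf_grid (m := m) hF (mYg m)).
by move=> w _; exact: F_grid_cvg hF.
Qed.

Lemma bmf_FX F B n : luc_continuous F B -> bmf (fun w => F (X n w)).
Proof. by move=> hF; split; [exact: mX hF|exists B => w; exact: hF.1]. Qed.

(** One-sided because [minorant] lies below [F]. Going to a minorant, to the grid and to the
    marginals costs [e / 4] each; returning from the grid to [X n] costs a Lipschitz error [e / 8],
    and the bad event, with the bound [2 B], another [e / 8]. The index [k] is fixed before the mesh
    because it is the Lipschitz constant. *)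
Lemma lower_bound F B (e : R) : luc_continuous F B -> 0 < e ->
  \forall n \near \oo, Ex P' (fun w => F (cpath (Y w))) - e <= Ex P (fun w => F (X n w)).
Proof.
move=> hF e0; have B0 := luc_bound_ge0 hF.
have e40 : 0 < e / 4 by rewrite divr_gt0.
have hk : Ex P' (fun w => minorant F k (cpath (Y w))) @[k --> \oo] --> Ex P' (fun w => F (cpath (Y w))).
  apply: (@Ex_cvg _ _ _ P' _ _ B).
  - by move=> k; case: (bmf_limit (minorant_luc hF k)).
  - by case: (bmf_limit hF).
  - by move=> k w; apply: minorant_norm => //; exact: cadlag_cpath.
  - by apply: aeW => w; apply: minorant_cvg hF _ _; exact: cadlag_cpath.
have [k _ /(_ k (leqnn k))/= hk1] := (cvgrPdist_le _ _).1 hk _ e40.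
have hkl := minorant_luc hF k.
have hm : Ex P' (fun w => minorant F k (grid m (Y w))) @[m --> \oo] --> Ex P' (fun w => minorant F k (cpath (Y w))).
  apply: (@Ex_cvg _ _ _ P' _ _ B).
  - by move=> m; case: (bmf_grid (m := m) hkl (mYg m)).
  - by case: (bmf_limit hkl).
  - by move=> m w; apply: minorant_norm => //; exact: cadlag_grid.
  - by apply: aeW => w; exact: F_grid_cvg hkl.
have [A _ hA] := (cvgrPdist_le _ _).1 hm _ e40.
have k1 : (0 : R) < k%:R + 1 by rewrite ltr_wpDl.
have eta0 : 0 < e / 8 / (k%:R + 1) by rewrite !divr_gt0.
have B1 : 0 < 2 * B + 1 by lra.
have eps0 : 0 < e / 8 / (2 * B + 1) by rewrite !divr_gt0.
have [m0 hm0] := tightX eta0 eps0 k1.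
pose m := maxn A m0.
have hA1 := hA m (leq_maxl _ _); rewrite /= in hA1.
have hm1 := hm0 m.+1 (leqW (leq_maxr _ _)).
(* The grid value at time 0 is set to 0: marginals are available at positive times, and both
   processes start at 0. *)
pose h a := minorant F k (step_path (fun=> 1) m.+1%:R (fun i => if i is j.+1 then a j else 0)).
have hl : lipf (m.+1 * k) B k%:R h.
  split => //; first by move=> a; apply: minorant_norm => //; exact: cadlag_step.
  move=> a b dl dl0 hab; apply: (minorant_dist hF) => //; [exact: cadlag_step|exact: cadlag_step|].
  move=> t /andP[t0 tk]; rewrite /step_path ltNge t0 /= !mul1r.
  have : (truncn (m.+1%:R * t) <= m.+1 * k)%N.
    rewrite -(ler_nat R); apply: le_trans (_ : m.+1%:R * t <= _); first by rewrite truncn_le// mulr_ge0.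
    by rewrite natrM ler_wpM2l.
  case: (truncn _) => [|j] jk; first by rewrite subrr normr0.
  exact: hab.
have hX n w : h (fun i => X n w (i.+1%:R / m.+1%:R)) = minorant F k (grid m (X n w)).
  rewrite /h; congr minorant; apply/funext => t; rewrite /step_path; case: ifP => // _.
  by case: (truncn _) => [|j]; rewrite ?mul0r ?X0.
have hY w : h (fun i => Y w (i.+1%:R / m.+1%:R)) = minorant F k (grid m (Y w)).
  rewrite /h; congr minorant; apply/funext => t; rewrite /step_path; case: ifP => // _.
  by case: (truncn _) => [|j]; rewrite ?mul0r ?Y0.
have hf := @fddX m.+1 _ _ _ _ isT hl.
have EX : (fun n => Ex P (fun w => h (fun i => X n w (i.+1%:R / m.+1%:R)))) =
    (fun n => Ex P (fun w => minorant F k (grid m (X n w)))).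
  by apply/funext => n; congr (Ex P _); apply/funext => w; exact: hX.
rewrite EX in hf.
have EY : Ex P' (fun w => h (fun i => Y w (i.+1%:R / m.+1%:R))) = Ex P' (fun w => minorant F k (grid m (Y w))).
  by congr (Ex P' _); apply/funext => w; exact: hY.
rewrite EY in hf.
have [A2 _ hA2] := (cvgrPdist_le _ _).1 hf _ e40.
case: hm1 => A3 _ hA3.
exists (maxn A2 A3) => // n /=; rewrite geq_max => /andP[n2 n3].
have /= g2 := hA2 n n2; have /= [E [mE PE hE]] := hA3 n n3.
have bg := bmf_grid (m := m) hkl (fun i => mXt n (i%:R / m.+1%:R)).
have bF := bmf_FX n hF.
have bE : bmf (\1_E : Om -> R) by exact: bmf_indic.
have main : Ex P (fun w => minorant F k (grid m (X n w))) <=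
    Ex P (fun w => F (X n w)) + (e / 8 + 2 * B * fine (P E)).
  have -> : Ex P (fun w => F (X n w)) + (e / 8 + 2 * B * fine (P E)) =
      Ex P (fun w => F (X n w) + (e / 8 + 2 * B * \1_E w)).
    have bE2 := bmfZ (2 * B) bE.
    by rewrite ExD//; [rewrite ExD ?Ex_cst ?ExZ ?Ex_indic//; exact: bmf_cst|apply: bmfD => //; exact: bmf_cst].
  apply: le_Ex => //.
    by apply: bmfD => //; apply: bmfD; [exact: bmf_cst|exact: bmfZ].
  move=> w; have [hw|hw] := pselect (E w).
    rewrite indicE mem_set//= mulr1.
    have := hF.1 _ (cX n w); have := @minorant_norm _ _ _ hF k _ (cadlag_grid m (X n w)).
    by rewrite !ler_norml => /andP[_ u1] /andP[u2 _]; lra.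
  rewrite indicE memNset//= mulr0 addr0.
  apply: (@le_trans _ _ (minorant F k (X n w) + k%:R * (e / 8 / (k%:R + 1)))).
    apply: (minorant_lip hF) => //; [exact: cadlag_grid|exact: ltW|].
    move=> t /andP[t0 tk]; rewrite distrC /step_path ltNge t0 /= mul1r.
    by apply: hE => //; rewrite t0 (le_trans tk)// lerDl.
  apply: lerD; first exact: (minorant_le hF).
  by rewrite mulrCA ler_piMr ?divr_ge0 ?(ltW e0)// ler_pdivrMr// mul1r lerDl.
have hB : 2 * B * fine (P E) <= e / 8.
  apply: le_trans (ler_wpM2l _ PE) _; first by rewrite mulr_ge0.
  by rewrite mulrCA ler_piMr ?divr_ge0 ?(ltW e0)// ler_pdivrMr// mul1r lerDl.
move: hk1 hA1 g2; rewrite !ler_norml => /andP[_ v1] /andP[_ v2] /andP[_ v3].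
by lra.
Qed.

Lemma weak_cvg F B : luc_continuous F B ->
  Ex P (fun w => F (X n w)) @[n --> \oo] --> Ex P' (fun w => F (cpath (Y w))).
Proof.
move=> hF; have hN := luc_continuousN hF; apply/cvgrPdist_le => e e0.
have [A _ hA] := lower_bound hF e0; have [A' _ hA'] := lower_bound hN e0.
exists (maxn A A') => // n /=; rewrite geq_max => /andP[/hA /= h1 /hA' /= h2].
rewrite !ExN in h2; [|exact: bmf_FX hF|exact: bmf_limit hF].
rewrite ler_norml; apply/andP; split; lra.
Qed.

End weak_convergence.

(** * Integrals of functions altered on a null set; evaluation at random times *)

Section null_sets.
Context {R : realType} {d : measure_display} {T : measurableType d} (P : probability T R).

(** Holds for arbitrary nonnegative functions, the integral being a supremum over simple functions
    below. *)
Lemma ge0_le_integralT (f1 f2 : T -> \bar R) : (forall w, (0 <= f1 w)%E) -> (forall w, (f1 w <= f2 w)%E) ->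
  (\int[P]_w f1 w <= \int[P]_w f2 w)%E.
Proof.
move=> f10 f12; rewrite !ge0_integralTE//; last by move=> w; exact: le_trans (f12 w).
apply: le_ereal_sup => _ [h hh <-]; exists h => //= x; exact: le_trans (f12 x).
Qed.

(** [h1] may fail to be measurable on [N], where a functional can meet irregular paths; it is
    squeezed between two bounded measurable functions that agree with [h2] off [N]. *)
Lemma ge0_integral_null_ext (N : set T) (h1 h2 : T -> R) (B : R) : measurable N -> P N = 0%E ->
  (forall w, 0 <= h1 w <= B) -> (forall w, 0 <= h2 w) -> bmf h2 -> (forall w, ~ N w -> h1 w = h2 w) ->
  (\int[P]_w (h1 w)%:E = \int[P]_w (h2 w)%:E)%E.
Proof.
move=> mN PN hB h20 bh h12.
have bN : bmf (\1_N : T -> R) by exact: bmf_indic.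
have bg : bmf (fun w => (1 - \1_N w) * h2 w) by apply: bmfM => //; apply: bmfB => //; exact: bmf_cst.
have bu : bmf (fun w => (1 - \1_N w) * h2 w + B * \1_N w) by apply: bmfD => //; exact: bmfZ.
have ae0 : {ae P, forall w, ~ N w} by exists N; split => // w /=; exact: contrapT.
have Eg : Ex P (fun w => (1 - \1_N w) * h2 w) = Ex P h2.
  apply: Ex_eq_ae => //; apply: filterS ae0 => w nN.
  by rewrite indicE memNset//= subr0 mul1r.
have Eu : Ex P (fun w => (1 - \1_N w) * h2 w + B * \1_N w) = Ex P h2.
  apply: Ex_eq_ae => //; apply: filterS ae0 => w nN.
  by rewrite indicE memNset//= subr0 mul1r mulr0 addr0.
have le1 : (\int[P]_w ((1 - \1_N w) * h2 w)%:E <= \int[P]_w (h1 w)%:E)%E.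
  apply: ge0_le_integralT => w; rewrite lee_fin; have [hN|hN] := pselect (N w);
    rewrite indicE ?(mem_set hN) ?(memNset hN)//= ?subrr ?subr0 ?mul0r ?mul1r//.
    by have /andP[] := hB w.
  by rewrite h12.
have le2 : (\int[P]_w (h1 w)%:E <= \int[P]_w ((1 - \1_N w) * h2 w + B * \1_N w)%:E)%E.
  apply: ge0_le_integralT => w; rewrite lee_fin; first by have /andP[] := hB w.
  have [hN|hN] := pselect (N w); rewrite indicE ?(mem_set hN) ?(memNset hN)//=.
    by rewrite subrr mul0r add0r mulr1; have /andP[] := hB w.
  by rewrite subr0 mul1r mulr0 addr0 h12.
rewrite (Ex_EFin P bg) Eg in le1; rewrite (Ex_EFin P bu) Eu in le2.
by rewrite (Ex_EFin P bh); apply/eqP; rewrite eq_le le2 le1.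
Qed.

Lemma integral_null_ext (N : set T) (h1 h2 : T -> R) (B : R) : measurable N -> P N = 0%E ->
  (forall w, `|h1 w| <= B) -> bmf h2 -> (forall w, ~ N w -> h1 w = h2 w) ->
  (\int[P]_w (h1 w)%:E = \int[P]_w (h2 w)%:E)%E.
Proof.
move=> mN PN hB bh h12.
have B0 (w : T) : 0 <= B by exact: le_trans (normr_ge0 _) (hB w).
have Ep (h : T -> R) : ((fun w : T => (h w)%:E) ^\+ = (fun w => (maxr (h w) 0)%:E))%E.
  by apply/funext => w; rewrite funeposE EFin_max.
have En (h : T -> R) : ((fun w : T => (h w)%:E) ^\- = (fun w => (maxr (- h w) 0)%:E))%E.
  by apply/funext => w; rewrite funenegE EFin_max EFinN.
have bmax (h : T -> R) : bmf h -> bmf (fun w => maxr (h w) 0).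
  move=> bh'; have -> : (fun w => maxr (h w) 0) = (fun w => 2^-1 * (h w + `|h w|)).
    by apply/funext => w; case: (leP (h w) 0) => hw; [rewrite ler0_norm// subrr mulr0|rewrite gtr0_norm// -mulr2n -[h w *+ 2]mulr_natl mulKf ?pnatr_eq0].
  by apply: bmfZ; apply: bmfD => //; exact: bmf_norm.
rewrite integralE [RHS]integralE !Ep !En; congr (_ - _)%E; apply: (ge0_integral_null_ext mN PN (B := B)).
- by move=> w; rewrite le_max lexx orbT/= ge_max (B0 w) andbT (le_trans (ler_norm _)).
- by move=> w; rewrite le_max lexx orbT.
- exact: bmax.
- by move=> w /h12 ->.
- by move=> w; rewrite le_max lexx orbT/= ge_max (B0 w) andbT (le_trans (ler_norm _))// normrN.
- by move=> w; rewrite le_max lexx orbT.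
- by apply: bmax; exact: bmfN.
- by move=> w /h12 ->.
Qed.

Lemma measurable_fun_select (c : T -> nat) (F : nat -> T -> R) :
  (forall k, measurable [set w | c w = k]) -> (forall k, measurable_fun setT (F k)) ->
  measurable_fun setT (fun w => F (c w) w).
Proof.
move=> mc mF _ B mB; rewrite setTI.
rewrite (_ : _ @^-1` B = \bigcup_k ([set w | c w = k] `&` F k @^-1` B)).
  apply: bigcup_measurable => k _; apply: measurableI => //.
  by rewrite -[X in measurable X]setTI; exact: mF.
by apply/seteqP; split => [w /= hw|w [k _ [/= <-]]//]; exists (c w).
Qed.

(** Rounding [tau] down leaves countably many deterministic times; path continuity gives the
    limit. *)
Lemma measurable_random_time (W : R -> T -> R) (tau : T -> R) : (forall t, measurable_fun setT (W t)) ->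
  (forall w, halfline_continuous (fun t => W t w)) -> measurable_fun setT tau -> (forall w, 0 <= tau w) ->
  measurable_fun setT (fun w => W (tau w) w).
Proof.
move=> mW cW mtau tau0.
apply: (@measurable_fun_cvg _ _ _ _ (fun n w => W ((truncn (n.+1%:R * tau w))%:R / n.+1%:R) w)).
  move=> n; apply: (@measurable_fun_select (fun w => truncn (n.+1%:R * tau w)) (fun k => W (k%:R / n.+1%:R))) => // k.
  have -> : [set w | truncn (n.+1%:R * tau w) = k] = setT `&` (fun w => n.+1%:R * tau w) @^-1` `[k%:R, k.+1%:R[%classic.
    rewrite setTI; apply/seteqP; split => w /=; rewrite in_itv/=.
      by move=> <-; apply: truncn_itv; rewrite mulr_ge0.
    by move=> h; apply: truncn_def.
  have : measurable_fun setT (fun w => n.+1%:R * tau w) by exact: measurable_funM.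
  by apply.
move=> w _; apply/cvgrPdist_le => e e0.
have [A _ hA] := luc_cvg_grid (cW w) (T := tau w + 1) (ltr_wpDl (tau0 w) ltr01) e0.
exists A => // n /hA /= /(_ (tau w)); rewrite tau0 lerDl ler01 => /(_ isT).
by rewrite /step_path /cpath ltNge tau0 /= mul1r distrC.
Qed.

End null_sets.

(** * Functional central limit theorem *)

(** The limit lies in [0, 1] only almost surely; clipping makes the bounds hold at every point. *)
Definition clip {R : realType} (z : R) : R := maxr 0 (minr z 1).

Lemma clip01 {R : realType} (z : R) : 0 <= clip z <= 1.
Proof. by rewrite /clip le_max lexx/= ge_max ler01/= ge_min lexx orbT. Qed.

Lemma clip_id {R : realType} (z : R) : 0 <= z <= 1 -> clip z = z.
Proof. by move=> /andP[z0 z1]; rewrite /clip (min_idPl z1) (max_idPr z0). Qed.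

Lemma measurable_clip {R : realType} : measurable_fun setT (@clip R).
Proof. by apply: measurable_maxr => //; apply: measurable_minr. Qed.

Section functional_clt.
Context {R : realType} {d : measure_display} {Om : measurableType d}.
Context (P : probability Om R) (hg : nat -> set (set Om)).
Context (M cv : nat -> Om -> R) (r : nat -> R) (N : nat) (g c : R) (Zlim : Om -> R).
Local Notation H n := (g_sigma_algebraType (hg n)).
Hypothesis HH : controlled_martingale P hg M cv r.
Hypothesis N_gt0 : (0 < N)%N.
Hypothesis r01 : forall n, 0 <= r n < 1.
Hypothesis g_range : 2^-1 < g <= 1.
Hypothesis c_gt0 : 0 < c.
Hypothesis r_cvg : n%:R `^ g * r n @[n --> \oo] --> c.
Hypothesis M01 : forall n w, 0 <= M n w <= 1.
Hypothesis Hcvv : Ex P (fun w => `|cv n w - vproc N (M n w)|) @[n --> \oo] --> 0.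
Let p := 2 * g - 1.
Local Notation tl := (rtail r).

Let p0 : 0 < p. Proof. by have /andP[] := p_range g_range. Qed.
Let N1 : (1 : R) <= N%:R. Proof. by rewrite ler1n. Qed.
Let N0 : (0 : R) < N%:R. Proof. by rewrite ltr0n. Qed.
Local Notation ML := (fun w => clip (Zlim w)).
Hypothesis mZlim : measurable_fun setT Zlim.
Hypothesis cvgML : {ae P, forall w, M n w @[n --> \oo] --> ML w}.
Context {d' : measure_display} {Om' : measurableType d'} (P' : probability Om' R).
Context (W : R -> Om' -> R) (Z' : Om' -> R).
Hypothesis mZ' : measurable_fun setT Z'.
Hypothesis mW : forall t, measurable_fun setT (W t).
Hypothesis W0 : forall w, W 0 w = 0.
Hypothesis cW : forall w, {within `[0, +oo[%classic, continuous (fun t => W t w)}.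
Hypothesis lawW : forall (m : nat) (ts : nat -> R) (A : set R) (B : nat -> set R),
        ts 0%N = 0 -> (forall j, (j < m)%N -> ts j < ts j.+1) ->
        measurable A -> (forall j, measurable (B j)) ->
        P' (Z' @^-1` A `&`
            [set w | forall j, (1 <= j <= m)%N -> B j (W (ts j) w - W (ts j.-1) w)])
        = (P (Zlim @^-1` A) *
           \prod_(1 <= j < m.+1) normal_prob 0 (Num.sqrt (ts j - ts j.-1)) (B j))%E.

Let ML01 w : 0 <= ML w <= 1. Proof. exact: clip01. Qed.
Let mML : measurable_fun setT ML. Proof. by apply: measurableT_comp mZlim; exact: measurable_clip. Qed.
Let bM n : bmf (M n). Proof. exact: (cm_sub HH) (cm_M HH n). Qed.
Let bML : bmf ML. Proof. exact: bmf_bounded mML ML01. Qed.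

(** The clock of the limit process is [V_t = speed Z * t ^ p]. *)
Definition speed (z : R) : R := c ^+ 2 / p * vproc N (clip z).
Definition rpath (n : nat) (w : Om) : R -> R :=
  step_path (fun t => t `^ p * amp g n) n%:R (fun k => M k w - ML w).
Definition lpath (w : Om') (t : R) : R := W (speed (Z' w) * t `^ p) w.

Lemma rpathE n w t : 0 <= t -> rpath n w t = proc M g ML n t w.
Proof. by move=> t0; rewrite /rpath /step_path ltNge t0. Qed.

Lemma cadlag_rpath_aux n : halfline_continuous (fun t : R => t `^ p * amp g n).
Proof.
have h := halfline_continuousZ (amp g n) (halfline_continuous_powR p0).
by move=> t e t0 e0; have [dl dl0 hd] := h t e t0 e0; exists dl => // s s0 st; rewrite ![_ * amp g n]mulrC hd.
Qed.

Lemma cadlag_rpath n w : cadlag (rpath n w).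
Proof. exact: cadlag_step (cadlag_rpath_aux n) _. Qed.

Lemma rpath0 n w : rpath n w 0 = 0.
Proof. by rewrite rpathE// /proc powR0 ?mul0r// gt_eqF. Qed.

Lemma measurable_rpath F B n : luc_continuous F B -> measurable_fun setT (fun w => F (rpath n w)).
Proof.
move=> hF; apply: (@measurable_seq_continuous _ _ _ (fun k w => M k w - ML w)
  (fun a => F (step_path (fun t => t `^ p * amp g n) n%:R a))).
  by move=> k; apply: measurable_funB => //; case: (bM k).
move=> a_ a ha; have hc := cadlag_rpath_aux n.
apply: hF.2; [by move=> k; exact: cadlag_step|exact: cadlag_step|exact: luc_cvg_step].
Qed.

Lemma measurable_rpath_at n t : measurable_fun setT (fun w => rpath n w t).
Proof.
have [t0|t0] := boolP (t < 0); rewrite /rpath /step_path ?t0 ?(negbTE t0)//.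
apply: measurable_funM => //; apply: measurable_funB => //.
by case: (bM (truncn (n%:R * t))).
Qed.

Lemma speed_ge0 z : 0 <= speed z.
Proof.
apply: mulr_ge0; first exact: divr_ge0 (sqr_ge0 _) (ltW p0).
by have /andP[] := vproc01 N_gt0 (clip01 z).
Qed.

Lemma speed_le z : speed z <= (truncn (c ^+ 2 / p)).+1%:R.
Proof.
have cp : 0 <= c ^+ 2 / p by rewrite divr_ge0 ?sqr_ge0 ?(ltW p0).
apply: le_trans (ltW (truncnS_gt (c ^+ 2 / p))); rewrite ler_piMr//.
by have /andP[] := vproc01 N_gt0 (clip01 z).
Qed.

Lemma measurable_speed : measurable_fun setT speed.
Proof.
apply: measurable_funM => //; rewrite /vproc; apply: measurable_funM => //.
by apply: measurable_funM; [exact: measurable_clip|apply: measurable_funB => //; exact: measurable_clip].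
Qed.

Let hW w : halfline_continuous (fun t => W t w). Proof. exact: halfline_continuousP. Qed.

Lemma lpath_continuous w : halfline_continuous (lpath w).
Proof.
have h := halfline_continuousZ (speed (Z' w)) (halfline_continuous_powR p0).
by apply: (halfline_continuous_comp _ (hW w) h) => t t0; rewrite mulr_ge0 ?speed_ge0 ?powR_ge0.
Qed.

Lemma lpath0 w : lpath w 0 = 0.
Proof. by rewrite /lpath powR0 ?gt_eqF// mulr0 W0. Qed.

Lemma measurable_lpath t : 0 <= t -> measurable_fun setT (fun w => lpath w t).
Proof.
move=> t0; apply: measurable_random_time => //.
  by apply: measurable_funM => //; apply: measurableT_comp mZ'; exact: measurable_speed.
by move=> w; rewrite mulr_ge0 ?speed_ge0 ?powR_ge0.
Qed.

Lemma Ex_proc2_bound : exists2 C : R, 0 < C & forall n t, 0 < t ->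
  Ex P (fun w => proc M g ML n t w ^+ 2) <= C * t `^ p.
Proof.
have [C C0 hC] := rtail_bound r01 g_range c_gt0 r_cvg; exists C => // n t t0.
have tp : 0 < t `^ p by rewrite powR_gt0.
apply: le_trans (Ex_proc2 HH r01 g_range c_gt0 r_cvg M01 ML01 mML cvgML n t) _.
rewrite -/p; case: n => [|n]; first by rewrite powR0 ?gt_eqF// mul0r mulr0 mulr_ge0// ltW.
have nR : (0 : R) < n.+1%:R by rewrite ltr0n.
have np : 0 < n.+1%:R `^ p by rewrite powR_gt0.
have h : n.+1%:R `^ p * tl (truncn (n.+1%:R * t)) <= C / t `^ p.
  apply: le_trans (ler_wpM2l (ltW np) (hC _)) _.
  have hn : (truncn (n.+1%:R * t)).+1%:R `^ (- p) <= (n.+1%:R * t) `^ (- p).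
    by apply: powR_le0; [rewrite mulr_gt0|exact: ltW (truncnS_gt _)|rewrite oppr_le0 ltW].
  rewrite mulrCA ler_pM2l//; apply: le_trans (ler_wpM2l (ltW np) hn) _.
  by rewrite powRM ?(ltW nR) ?(ltW t0)// !powRN mulVKf ?gt_eqF.
apply: le_trans (ler_wpM2l (sqr_ge0 _) h) _.
by rewrite expr2 -mulrA [C / _]mulrC mulrA mulrA mulfK ?gt_eqF// mulrC.
Qed.

Lemma fdd_cvg m q (C L : R) h : (0 < m)%N -> lipf q C L h ->
  Ex P (fun w => h (fun i => rpath n w (i.+1%:R / m%:R))) @[n --> \oo] -->
  Ex P' (fun w => h (fun i => lpath w (i.+1%:R / m%:R))).
Proof.
move=> m0 hl; have mR : (0 : R) < m%:R by rewrite ltr0n.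
pose t i : R := i.+1%:R / m%:R.
have t0 i : 0 < t i by rewrite divr_gt0// ltr0n.
have [C1 C10 hC1] := Ex_proc2_bound.
apply: (@lipschitz_cvg _ _ _ _ _ P P' q (fun n i w => rpath n w (t i)) (fun i w => lpath w (t i)) _ _ _
  (C1 * (q.+1%:R / m%:R) `^ p) C L h _ _ hl).
- by move=> n i; exact: measurable_rpath_at.
- by move=> i; exact: measurable_lpath (ltW (t0 i)).
- move=> th phi.
  have h1 := fdd_cos HH N_gt0 r01 g_range c_gt0 r_cvg M01 ML01 mML cvgML Hcvv (th := th) (phi := phi) (fun i (_ : (i < q)%N) => t0 i).
  have -> : (fun n => Ex P (fun w => cos (phi + \sum_(i < q) th i * rpath n w (t i)))) =
     (fun n => Ex P (fun w => cos (phi + \sum_(i < q) th i * proc M g ML n (t i) w))).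
    apply/funext => n; congr (Ex P _); apply/funext => w; congr (cos (_ + _)).
    by apply: eq_bigr => i _; rewrite rpathE// ltW.
  (* The clock [t ^ p] at the grid times, increasing from [s 0 = 0]; the random speed multiplies
     it. *)
  pose s i : R := (i%:R / m%:R) `^ p.
  have s0 : s 0%N = 0 by rewrite /s mul0r powR0// gt_eqF.
  have si j : (j < q)%N -> s j < s j.+1.
    move=> _; rewrite /s; have := @gt0_ltr_powR R p p0 (j%:R / m%:R) (j.+1%:R / m%:R).
    by apply; rewrite ?nnegrE ?divr_ge0// ltr_pM2r ?invr_gt0// ltr_nat.
  have sge j : 0 <= s j by exact: powR_ge0.
  have u01 z : 0 <= speed z <= (truncn (c ^+ 2 / p)).+1%:R by rewrite speed_ge0 speed_le.
  have h2 := wiener_random_cos mZ' mZlim mW W0 cW lawW th phi s0 si sge measurable_speed u01.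
  rewrite h2.
  have -> : Ex P (fun w => expR (- (speed (Zlim w) * (\sum_(i < q) \sum_(j < q) th i * th j * s (minn i j).+1) / 2)) * cos phi) =
     Ex P (fun w => expR (- (vproc N (ML w) * qform g c q t th / 2)) * cos phi).
    congr (Ex P _); apply/funext => w; congr (expR (- (_ / 2)) * _).
    rewrite /speed /qform -/p [c ^+ 2 / p * vproc _ _]mulrC -[LHS]mulrA; congr (_ * (_ * _)).
    apply: eq_bigr => i _; apply: eq_bigr => j _; congr (_ * _); rewrite /s /t; congr (_ `^ _).
    have [ij|ij] := leqP i j.
      by rewrite (min_idPl _)// ler_pM2r ?invr_gt0// ler_nat ltnS.
    by rewrite (min_idPr _)// ler_pM2r ?invr_gt0// ler_nat ltnS ltnW.
  exact: h1.
- move=> n i iq.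
  have -> : (fun w => rpath n w (t i) ^+ 2) = (fun w => proc M g ML n (t i) w ^+ 2).
    by apply/funext => w; rewrite rpathE// ltW.
  apply: le_trans (hC1 n _ (t0 i)) _; rewrite ler_pM2l//; apply: powR_le2; rewrite ?(ltW p0) ?(ltW (t0 i))//.
  by rewrite ler_pM2r ?invr_gt0// ler_nat ltnS ltnW.
- move=> n i; have -> : (fun w => rpath n w (t i)) = proc M g ML n (t i).
    by apply/funext => w; rewrite rpathE// ltW.
  exact: (bmf_proc g HH ML01 mML).
Qed.

Lemma functional_clt F B : luc_continuous F B ->
  Ex P (fun w => F (rpath n w)) @[n --> \oo] --> Ex P' (fun w => F (cpath (lpath w))).
Proof.
apply: (weak_cvg cadlag_rpath rpath0 measurable_rpath measurable_rpath_at lpath_continuous lpath0 measurable_lpath).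
- move=> eta e T eta0 e0 T0.
  have [m0 hm0] := tight HH r01 g_range c_gt0 r_cvg M01 ML01 mML cvgML eta0 e0 T0.
  exists m0 => m mm; have [A _ hA] := hm0 m mm; exists A => // n /hA /=.
  apply: smallev_sub => // w h t /andP[t0 tT]; rewrite !rpathE ?divr_ge0//; apply: h; by rewrite t0.
- exact: fdd_cvg.
Qed.

End functional_clt.

(** * Synchronization *)

(** Summing the recursion bounds [\sum r_k x_k], so [x] is small at arbitrarily late indices
    ([rsum_dvg]); after such an index it can grow by at most [K] times the tail sum of [r ^ 2]. *)
Lemma contraction_cvg0 {R : realType} (r : nat -> R) (g c a K : R) (x : nat -> R) :
  (forall n, 0 <= r n < 1) -> 2^-1 < g <= 1 -> 0 < c -> n%:R `^ g * r n @[n --> \oo] --> c ->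
  0 < a -> 0 <= K -> (forall n, 0 <= x n) -> (forall n, x n.+1 <= (1 - a * r n) * x n + K * r n ^+ 2) ->
  x n @[n --> \oo] --> 0.
Proof.
move=> r01 g_range c_gt0 r_cvg a0 K0 x0 hx.
have r0 n : 0 <= r n by have /andP[] := r01 n.
have tl0 m : 0 <= rtail r m by exact: (rtail_ge0 r01 g_range c_gt0 r_cvg).
have hsum L : a * \sum_(0 <= k < L) r k * x k + x L <= x 0%N + K * \sum_(0 <= k < L) r k ^+ 2.
  elim: L => [|L ih]; first by rewrite !big_geq// !mulr0 add0r addr0.
  by rewrite !big_nat_recr//= !mulrDr; have := hx L; lra.
have hA L : \sum_(0 <= k < L) r k * x k <= (x 0%N + K * rtail r 0) / a.
  rewrite ler_pdivlMr// mulrC; have := hsum L; rewrite rtail_sum// mulrBr.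
  have := x0 L; have := mulr_ge0 K0 (tl0 L); lra.
have hdec k L : (k <= L)%N -> x L <= x k + K * rtail r k.
  move=> kL; have : x L <= x k + K * (rtail r k - rtail r L).
    elim: L kL => [|L ih]; first by rewrite leqn0 => /eqP ->; rewrite subrr mulr0 addr0.
    rewrite leq_eqVlt => /predU1P[->|]; first by rewrite subrr mulr0 addr0.
    rewrite ltnS => kL; have h1 := ih kL; have h2 := hx L.
    have h3 : rtail r k - rtail r L.+1 = rtail r k - rtail r L + r L ^+ 2.
      by rewrite -!rtail_sum ?(leqW kL)// big_nat_recr.
    rewrite h3 mulrDr; have : 0 <= a * r L * x L by rewrite !mulr_ge0 ?(ltW a0).
    lra.
  by have := mulr_ge0 K0 (tl0 L); lra.
apply/cvgrPdist_le => e e0.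
have K1 : 0 < K + 1 by lra.
have e20 : 0 < e / 2 by rewrite divr_gt0.
have eK : 0 < e / 2 / (K + 1) by rewrite divr_gt0.
have [A _ hA'] := (cvgrPdist_le _ _).1 (@rtail_cvg0 _ _ _ _ r01 g_range c_gt0 r_cvg) _ eK.
have [k Ak xk] := rsum_dvg r01 g_range c_gt0 r_cvg hA x0 e20 A.
exists k => // L /= kL; rewrite sub0r normrN ger0_norm//.
apply: le_trans (hdec k L kL) _.
have := hA' k Ak; rewrite /= sub0r normrN ger0_norm// => h.
have : K * rtail r k <= e / 2.
  apply: le_trans (ler_wpM2l K0 h) _.
  by rewrite mulrCA ler_piMr ?(ltW e20)// ler_pdivrMr// mul1r lerDl.
lra.
Qed.

Section synchronization.
Context {R : realType} {d : measure_display} {Om : measurableType d}.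
Context (P : probability Om R) (N : nat) (alpha g c : R) (r : nat -> R).
Context (Z : nat -> 'I_N -> Om -> R) (I : nat -> 'I_N -> Om -> R).
Hypothesis N_gt0 : (0 < N)%N.
Hypothesis alpha01 : 0 < alpha <= 1.
Hypothesis r01 : forall n, 0 <= r n < 1.
Hypothesis g_range : 2^-1 < g <= 1.
Hypothesis c_gt0 : 0 < c.
Hypothesis r_cvg : n%:R `^ g * r n @[n --> \oo] --> c.
Hypothesis mZ : forall n i, measurable_fun setT (Z n i).
Hypothesis mI : forall n i, measurable_fun setT (I n i).
Hypothesis Z01 : forall n i w, 0 <= Z n i w <= 1.
Hypothesis I01 : forall n i w, I n i w = 0 \/ I n i w = 1.
Hypothesis Zrec : forall n i w, Z n.+1 i w = (1 - r n) * Z n i w + r n * I n.+1 i w.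
Hypothesis Icond : forall n (A : set Om), filtr Z n A -> forall e : {ffun 'I_N -> bool},
     P (A `&` [set w | forall i, I n.+1 i w = (e i)%:R]) =
     (\int[P]_(w in A)
        (\prod_(i < N)
           (if e i then (1 - alpha) * Z n i w + alpha * zmean Z n w
            else 1 - ((1 - alpha) * Z n i w + alpha * zmean Z n w)))%:E)%E.

Let N1 : (1 : R) <= N%:R. Proof. by rewrite ler1n. Qed.
Let N0 : (0 : R) < N%:R. Proof. by rewrite ltr0n. Qed.
Let zm01' n w : 0 <= zmean Z n w <= 1 := zm01 N_gt0 Z01 n w.
Let pick01' n i w : 0 <= draw_prob alpha Z n i w <= 1 := pick01 N_gt0 alpha01 Z01 n i w.

Lemma cvar_ge0 n w : 0 <= cvar alpha Z n w.
Proof.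
rewrite /cvar divr_ge0 ?sqr_ge0 ?sumr_ge0// => i _.
by have /andP[? ?] := pick01' n i w; rewrite mulr_ge0// subr_ge0.
Qed.

(** Concavity of [x (1 - x)]: the draw probabilities average to the mean, and their spread only
    lowers the sum. *)
Lemma cvar_le_vproc n w : cvar alpha Z n w <= vproc N (zmean Z n w).
Proof.
have NN := N0; rewrite /cvar /vproc ler_pdivrMr ?exprn_gt0//.
set z := zmean Z n w.
have -> : z * (1 - z) / N%:R * N%:R ^+ 2 = N%:R * (z * (1 - z)) by field; rewrite gt_eqF.
have E i : draw_prob alpha Z n i w * (1 - draw_prob alpha Z n i w) =
   z * (1 - z) + (1 - 2 * z) * (draw_prob alpha Z n i w - z) - (draw_prob alpha Z n i w - z) ^+ 2 by ring.
have S0 : \sum_(i < N) (draw_prob alpha Z n i w - z) = 0.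
  by rewrite sumrB sum_pick// -/z sumr_const card_ord -[z *+ N]mulr_natl subrr.
under eq_bigr do rewrite E.
have S1 : \sum_(i < N) (1 - 2 * z) * (draw_prob alpha Z n i w - z) = 0 by rewrite -mulr_sumr S0 mulr0.
rewrite sumrB big_split/= S1 addr0 sumr_const card_ord -[_ *+ N]mulr_natl.
by rewrite lerBlDr lerDl sumr_ge0// => i _; exact: sqr_ge0.
Qed.

Lemma cvar_le_gfun n w : cvar alpha Z n w <= gfun (zmean Z n w).
Proof.
apply: le_trans (cvar_le_vproc n w) _; rewrite /vproc /gfun.
have /andP[z0 z1] := zm01' n w.
by rewrite ler_pdivrMr// ler_peMr// mulr_ge0// subr_ge0.
Qed.

Lemma mean_controlled_martingale : controlled_martingale P (hist_gen Z) (zmean Z) (cvar alpha Z) r.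
Proof.
constructor.
- by move=> n X; exact: (@bmf_hist _ _ _ _ _ mZ n X).
- by move=> n m X; exact: hist_mono.
- by move=> n; exact: (@bmf_zm _ _ _ _ _ Z01 n n (leqnn n)).
- by move=> n; exact: (@bmf_cvar _ _ _ _ alpha _ Z01 n).
- exact: cvar_ge0.
- move=> n w; apply: le_trans (cvar_le_gfun n w) _; have /andP[z0 z1] := zm01' n w; rewrite /gfun; nra.
- by move=> n; have /andP[] := r01 n.
- exact: (zm_step_le N_gt0 alpha01 r01 Z01 I01 Zrec).
- by move=> n G; exact: (zm_mart N_gt0 mZ mI Z01 I01 Zrec Icond).
- by move=> n G; exact: (zm_cvar N_gt0 mZ mI Z01 I01 Zrec Icond).
Qed.

Let bgap n i : bmf (gap Z n i). Proof. exact: (bmf_hist mZ (bmf_gap Z01 n i)). Qed.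

Lemma Ex_gap2_cvg0 i : Ex P (fun w => gap Z n i w ^+ 2) @[n --> \oo] --> 0.
Proof.
have /andP[a0 _] := alpha01.
apply: (contraction_cvg0 r01 g_range c_gt0 r_cvg a0 (ler0n R 4)).
  by move=> n; apply: Ex_ge0 => w; exact: sqr_ge0.
by move=> n; exact: (gap_step N_gt0 alpha01 r01 mZ mI Z01 I01 Zrec Icond).
Qed.

Lemma Ex_gap_cvg0 i : Ex P (fun w => `|gap Z n i w|) @[n --> \oo] --> 0.
Proof.
apply/cvgrPdist_le => e e0.
have e20 : 0 < e / 2 by rewrite divr_gt0.
have e40 : 0 < e / 2 * (e / 2) by rewrite mulr_gt0.
have [A _ hA] := (cvgrPdist_le _ _).1 (@Ex_gap2_cvg0 i) _ e40.
exists A => // n /hA /=; rewrite !sub0r !normrN => h.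
rewrite ger0_norm; last by apply: Ex_ge0.
apply: le_trans (Ex_cauchy_schwarz1 P (bgap n i) e20) _.
rewrite ger0_norm in h; last by apply: Ex_ge0 => w; exact: sqr_ge0.
by rewrite -ler_pdivrMr// in h; lra.
Qed.

(** [x (1 - x)] is 1-Lipschitz on [0, 1], and each draw probability differs from the mean by at most
    the gap of its site. *)
Lemma cvar_vproc_cvg : Ex P (fun w => `|cvar alpha Z n w - vproc N (zmean Z n w)|) @[n --> \oo] --> 0.
Proof.
have hs : \sum_(i < N) Ex P (fun w => `|gap Z n i w|) @[n --> \oo] --> 0.
  have := @cvgn_sum R 'I_N (index_enum 'I_N) (fun i n => Ex P (fun w => `|gap Z n i w|)) (fun=> 0) Ex_gap_cvg0.
  by rewrite big1.
have NN := N0.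
have bn n i : bmf (fun w => `|gap Z n i w|) by exact: bmf_norm.
have bz n : bmf (zmean Z n) by exact: (bmf_hist mZ (bmf_zm Z01 (leqnn n))).
have bd n : bmf (fun w => `|cvar alpha Z n w - vproc N (zmean Z n w)|).
  apply: bmf_norm; apply: bmfB; first exact: (bmf_hist mZ (bmf_cvar alpha Z01 n)).
  by apply: bmfZr; apply: bmfM => //; apply: bmfB => //; exact: bmf_cst.
have hle n : Ex P (fun w => `|cvar alpha Z n w - vproc N (zmean Z n w)|) <=
    \sum_(i < N) Ex P (fun w => `|gap Z n i w|).
  rewrite -Ex_sum//; apply: le_Ex => //; first by apply: bmf_sum.
  move=> w; set z := zmean Z n w.
  have -> : cvar alpha Z n w - vproc N z = (\sum_(i < N) (draw_prob alpha Z n i w * (1 - draw_prob alpha Z n i w) - z * (1 - z))) / N%:R ^+ 2.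
    rewrite sumrB sumr_const card_ord -mulr_natl /cvar /vproc; field; by rewrite gt_eqF.
  have V0 : 0 <= (N%:R ^+ 2 : R)^-1 by rewrite invr_ge0 sqr_ge0.
  rewrite normrM (ger0_norm V0) -[leRHS]mulr1; apply: ler_pM => //.
  - apply: le_trans (ler_norm_sum _ _ _) _; apply: ler_sum => i _.
    have -> : draw_prob alpha Z n i w * (1 - draw_prob alpha Z n i w) - z * (1 - z) =
      gap Z n i w * ((1 - alpha) * (1 - draw_prob alpha Z n i w - z)) by rewrite /draw_prob /gap -/z; ring.
    rewrite normrM ler_piMr// normrM.
    have /andP[p0 p1] := pick01' n i w; have /andP[z0 z1] := zm01' n w; have /andP[a0 a1] := alpha01.
    rewrite -[leRHS]mulr1; apply: ler_pM => //; rewrite ler_norml; apply/andP; split; rewrite -/z in z0 z1; lra.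
  - by rewrite invf_le1 ?exprn_gt0// exprn_ege1.
apply: (@squeeze_cvgr _ _ _ _ (fun=> 0) (fun n => \sum_(i < N) Ex P (fun w => `|gap Z n i w|))) => //; last exact: cvg_cst.
by apply: nearW => n; rewrite hle Ex_ge0.
Qed.

End synchronization.

Theorem theorem2p5 (R : realType) (d : measure_display) (Om : measurableType d)
  (P : probability Om R) (N : nat) (alpha gamma c : R) (r : nat -> R)
  (Z : nat -> 'I_N -> Om -> R) (I : nat -> 'I_N -> Om -> R) (Zlim : Om -> R) :
  (0 < N)%N ->
  0 < alpha <= 1 ->
  (forall n, 0 <= r n < 1) ->
  2^-1 < gamma <= 1 ->
  0 < c ->
  powR n%:R gamma * r n @[n --> \oo] --> c ->
  (forall n i, measurable_fun setT (Z n i)) ->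
  (forall n i, measurable_fun setT (I n i)) ->
  (forall n i w, 0 <= Z n i w <= 1) ->
  (forall n i w, I n i w = 0 \/ I n i w = 1) ->
  (forall n i w, Z n.+1 i w = (1 - r n) * Z n i w + r n * I n.+1 i w) ->
  (* I_{n+1}(1..N) conditionally independent given F_n, with
     P(I_{n+1}(i) = 1 | F_n) = (1 - alpha) Z_n(i) + alpha Z_n *)
  (forall n (A : set Om), filtr Z n A -> forall e : {ffun 'I_N -> bool},
     P (A `&` [set w | forall i, I n.+1 i w = (e i)%:R]) =
     (\int[P]_(w in A)
        (\prod_(i < N)
           (if e i then (1 - alpha) * Z n i w + alpha * zmean Z n w
            else 1 - ((1 - alpha) * Z n i w + alpha * zmean Z n w)))%:E)%E) ->
  (* the law of (Z_0(1), ..., Z_0(N)) is permutation invariant *)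
  (forall (s : {perm 'I_N}) (B : 'I_N -> set R), (forall i, measurable (B i)) ->
     P [set w | forall i, B i (Z 0%N i w)] =
     P [set w | forall i, B i (Z 0%N (s i) w)]) ->
  (forall i, ('E_P[Z 0%N i] = (2^-1)%:E)%E) ->
  (0 < 'E_P[fun w => (zmean Z 0 w * (1 - zmean Z 0 w))%R])%E ->
  (* Z is the almost sure limit of Z_n *)
  measurable_fun setT Zlim ->
  {ae P, forall w, zmean Z n w @[n --> \oo] --> Zlim w} ->
  (P (Zlim @^-1` [set 0%R; 1%R]) < 1)%E /\
  (forall z, 0 < z < 1 -> P (Zlim @^-1` [set z]) = 0%E) /\
  (* for any standard Wiener process W independent of a random variable Z'
     distributed as Z (on any probability space), the rescaled process
     converges in distribution in D[0,+oo) to (W_{V_t})_t *)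
  (forall (d' : measure_display) (Om' : measurableType d')
     (P' : probability Om' R) (W : R -> Om' -> R) (Z' : Om' -> R),
     measurable_fun setT Z' ->
     (forall t, measurable_fun setT (W t)) ->
     (forall w, W 0 w = 0) ->
     (forall w, {within `[0, +oo[%classic, continuous (fun t => W t w)}) ->
     (* joint law: Z' ~ Z, and for 0 = t_0 < t_1 < ... < t_m the increments
        W_{t_j} - W_{t_{j-1}} are independent N(0, t_j - t_{j-1}) and
        independent of Z' *)
     (forall (m : nat) (ts : nat -> R) (A : set R) (B : nat -> set R),
        ts 0%N = 0 -> (forall j, (j < m)%N -> ts j < ts j.+1) ->
        measurable A -> (forall j, measurable (B j)) ->
        P' (Z' @^-1` A `&`
            [set w | forall j, (1 <= j <= m)%N -> B j (W (ts j) w - W (ts j.-1) w)])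
        = (P (Zlim @^-1` A) *
           \prod_(1 <= j < m.+1) normal_prob 0 (Num.sqrt (ts j - ts j.-1)) (B j))%E) ->
     cvg_dist_skorohod P (rescaled Z Zlim gamma)
       P' (time_changed_bm N c gamma W Z')).

Proof.
move=> N_gt0 alpha01 r01 g_range c_gt0 r_cvg mZ mI Z01 I01 Zrec Icond _ _ E0 mZlim cvgZ.
have HH := mean_controlled_martingale N_gt0 alpha01 r01 mZ mI Z01 I01 Zrec Icond.
have Hcvv := @cvar_vproc_cvg _ _ _ P N alpha gamma c r Z I N_gt0 alpha01 r01 g_range c_gt0 r_cvg mZ mI Z01 I01 Zrec Icond.
have M01 n w : 0 <= zmean Z n w <= 1 := zm01 N_gt0 Z01 n w.
pose ML w := clip (Zlim w).
have ML01 w : 0 <= ML w <= 1 by exact: clip01.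
have mML : measurable_fun setT ML by apply: measurableT_comp mZlim; exact: measurable_clip.
have Zlim01 : {ae P, forall w, 0 <= Zlim w <= 1}.
  apply: filterS cvgZ => w hw; apply/andP; split.
    by apply: (cvgn_ge_near hw); apply: nearW => n; have /andP[] := M01 n w.
  by apply: (cvgn_le_near hw); apply: nearW => n; have /andP[] := M01 n w.
have cvgML : {ae P, forall w, zmean Z n w @[n --> \oo] --> ML w}.
  by apply: filterS2 cvgZ Zlim01 => w hw h01; rewrite /ML clip_id.
(* Where clipping changes the value. This Borel set is null for [Zlim], hence for [Z'], which has
   the same law. *)
pose out : set R := [set z | ~~ (0 <= z <= 1)].
have mout : measurable out.
  rewrite (_ : out = ~` `[0, 1]%classic); first exact: measurableC.
  by apply/seteqP; split => z /=; rewrite in_itv/= => /negP.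
have mZout : measurable (Zlim @^-1` out) by rewrite -[X in measurable X]setTI; exact: mZlim.
have Pout : P (Zlim @^-1` out) = 0%E.
  have [A [mA PA hA]] := Zlim01; apply/eqP; rewrite eq_le measure_ge0 andbT -PA.
  apply: le_measure; rewrite ?inE// => w /= hw; apply: hA => /= h.
  by rewrite /out /= h in hw.
have gfun0 : 0 < Ex P (fun w => gfun (zmean Z 0 w)).
  have bz : bmf (zmean Z 0) by exact: (bmf_hist mZ (bmf_zm Z01 (leqnn 0))).
  have bg : bmf (fun w => gfun (zmean Z 0 w)) by apply: bmfM => //; apply: bmfB => //; exact: bmf_cst.
  by move: E0; rewrite unlock (Ex_EFin P bg) lte_fin.
have gML := gfun_ML_gt0 HH r01 g_range c_gt0 r_cvg M01 ML01 mML cvgML (cvar_le_gfun alpha N_gt0 Z01) gfun0.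
split; [|split].
(* If [Zlim] were almost surely in {0, 1}, [gfun (ML w)] would have mean 0. *)
- set A := Zlim @^-1` _.
  have mA : measurable A.
    rewrite -[X in measurable X]setTI; apply: mZlim => //.
    by apply: measurableU; exact: measurable_set1.
  rewrite lt_neqAle probability_le1// andbT; apply/eqP => PA1.
  have PC : P (~` A) = 0%E by rewrite probability_setC// PA1 subee.
  have bML : bmf ML by exact: bmf_bounded mML ML01.
  have bg : bmf (fun w => gfun (ML w)) by apply: bmfM => //; apply: bmfB => //; exact: bmf_cst.
  have : Ex P (fun w => gfun (ML w)) = Ex P (fun=> 0).
    apply: Ex_eq_ae => //; first exact: bmf_cst.
    exists (~` A); split => //; first exact: measurableC.
    move=> w /= hw hA; apply: hw; case: hA => h; rewrite /ML h clip_id ?lexx ?ler01// /gfun ?mul0r// subrr mulr0//.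
  by rewrite Ex_cst => E; rewrite E ltxx in gML.
- move=> z z01.
  have h := fourier_no_atom mML ML01 z01 (@fourier_decay _ _ _ _ _ _ _ _ _ _ _ _ HH N_gt0 r01 g_range c_gt0 r_cvg M01 ML01 mML cvgML Hcvv z).
  have mz : measurable [set z] by exact: measurable_set1.
  apply/eqP; rewrite eq_le measure_ge0 andbT -h; apply: le_measure; rewrite ?inE.
  + by rewrite -[X in measurable X]setTI; exact: mZlim.
  + by rewrite -[X in measurable X]setTI; exact: mML.
  + move=> w /= hw; rewrite /ML hw clip_id//; have /andP[? ?] := z01; by rewrite !ltW.
- move=> d' Om' P' W Z' mZ' mW W0 cW lawW f hf.
  have [B hB] := skorohod_bcont_luc hf; have [[B' hB'] _] := hf.
  have NR : (0 : R) < N%:R by rewrite ltr0n.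
  have /andP[p0 _] := p_range g_range.
  have hlim := @functional_clt _ _ _ _ _ _ _ _ _ _ _ _ HH N_gt0 r01 g_range c_gt0 r_cvg M01 Hcvv mZlim cvgML
    _ _ _ _ _ mZ' mW W0 cW lawW f B hB.
  have EX n : (\int[P]_w (f (rescaled Z Zlim gamma n w))%:E =
      (Ex P (fun w => f (rpath (zmean Z) gamma Zlim n w)))%:E)%E.
    have bf : bmf (fun w => f (rpath (zmean Z) gamma Zlim n w)).
      by split; [exact: (measurable_rpath HH g_range mZlim n hB)|exists B'].
    rewrite -Ex_EFin//; apply: (integral_null_ext mZout Pout) => // w hw; congr f; apply/funext => t.
    rewrite /rescaled /rpath /step_path /amp clip_id//.
    by apply: contrapT => /negP h; exact: hw.
  have mZ'out : measurable (Z' @^-1` out) by rewrite -[X in measurable X]setTI; exact: mZ'.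
  have P'out : P' (Z' @^-1` out) = 0%E.
    have := law_Z' mZ' mZlim mW lawW mout; rewrite Ex_indic// Pout /= => h.
    by rewrite -[LHS]fineK ?fin_num_measure// h.
  (* Off the null set the clock equals [speed Z' * t ^ p]; on it, [W] might be read at negative
     times, where nothing is assumed of its paths. *)
  have EY : (\int[P']_w (f (time_changed_bm N c gamma W Z' w))%:E =
      (Ex P' (fun w => f (cpath (lpath N gamma c W Z' w))))%:E)%E.
    have bf := bmf_limit (lpath_continuous c N_gt0 g_range Z' cW) (@measurable_lpath _ _ _ c N_gt0 g_range _ _ _ _ mZ' mW cW) hB.
    rewrite -Ex_EFin//; apply: (integral_null_ext mZ'out P'out) => // w hw; congr f; apply/funext => t.
    rewrite /time_changed_bm /cpath; case: ifP => // _; rewrite /lpath /speed /vproc clip_id; last first.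
      by apply: contrapT => /negP h; exact: hw.
    by congr (W _ w); field; rewrite (gt_eqF p0) (gt_eqF NR).
  rewrite EY; under eq_fun do rewrite EX.
  by apply: cvg_EFin; [exact: nearW|exact: hlim].
Qed.
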